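(* Let $\gamma$ be fixed with $\frac{13}{14}<\gamma<1$, let $\alpha$ be an irrational real number and $\beta$ a real number, and let $\varepsilon>0$. Then there exist infinitely many primes $p$ of the form $p=[n^{1/\gamma}]$ for some positive integer $n$ such that \[ \|\alpha p^2+\beta\|<p^{\frac{13-14\gamma}{29}+\varepsilon}. \]
   Context: $[x]$ denotes the integer part (floor) of $x$, and $\|x\|$ denotes the distance from the real number $x$ to the nearest integer. *)

(* Defs.v *)
From mathcomp Require Import all_boot all_order all_algebra.
From mathcomp Require Import all_classical all_reals all_analysis.
Set Implicit Arguments.
Unset Strict Implicit.
Unset Printing Implicit Defensive.
Import Order.TTheory GRing.Theory Num.Theory.
Local Open Scope classical_set_scope.
Local Open Scope ring_scope.

(* The set of distances is nonempty and bounded below by 0, so [inf] is a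
   genuine infimum (and it is attained). *)
Definition dist_int (R : realType) (x : R) : R :=
  inf [set `|x - m%:~R| | m in [set: int]].

(* Main.v *)
(* Put g = 1 - gamma, delta = (14 gamma - 13) / 29 and sigma = g + delta, so that
   14 sigma + 15 delta = 1. For N < p <= 16 N, the number p is of the form
   [n^(1/gamma)] as soon as p^gamma + eta1 is at distance less than eta1 from an
   integer, where eta1 is of order N^(-g). Hence a prime p is wanted for which the
   point (p^gamma + eta1, alpha p^2 + beta) lies, modulo 1, in a box with sides of
   order N^(-g) and N^(-delta). A combination of products of Fejer kernels that is
   nonpositive outside the box reduces this to
     |sum_(N < n <= 16 N) Lambda(n) cos (2 pi (h n^gamma + k alpha n^2 + c))|
       <= N^(1 - sigma - eta / 2)
   for all (h, k) <> (0, 0) with |h| <= N^(g + eta) and |k| <= N^(delta + eta).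
   Vaughan's identity turns this sum into linear and bilinear sums. After
   Cauchy-Schwarz and van der Corput differencing, the phases of the inner sums have
   increments t + x_n with x_n small and monotone. Such a sum is at most a constant
   times 1 / ||t|| when ||t|| exceeds the size of x_n (Kusmin-Landau), and otherwise
   at most a constant times (M / ||t||)^(1/2), where M is its length (counting the n
   for which the increment is nearly an integer). The slopes t are products of
   2 alpha with integers having few factorisations, so sums over them are estimated
   by counting how often ||2 alpha n|| is small, using a rational approximation a / q
   of 2 alpha; N is chosen of order q^(2 / (15 sigma)). When k = 0 the slopes vanish
   and Kusmin-Landau applies directly. *)
Require Import Defs.
From mathcomp Require Import all_boot all_order all_algebra.
From mathcomp Require Import all_classical all_reals all_analysis.
From mathcomp Require Import ring lra zify.
Set Implicit Arguments.
Unset Strict Implicit.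
Unset Printing Implicit Defensive.
Import Order.TTheory GRing.Theory Num.Theory.
Local Open Scope classical_set_scope.
Local Open Scope ring_scope.

(** * Cosine sums and the Kusmin-Landau inequality *)

(** The box needs frequencies up to about N^(1 - gamma) and N^delta, so every sum must save a factor
    N^sigma. Cauchy-Schwarz saves the square root of its shift length, hence shifts [Q] of order T =
    N^(2 sigma), up to powers of N^eta; the sums over pairs must then save T on average, which takes
    differencing shifts [Y] of order T^2. Slopes near integers are harmless if k T^2 L (Q Y)^(1/2)
    stays below N. The shorter variable may reach L of order N^(1/2), so this asks for 7 sigma +
    delta < 1/2; as delta tends to 0 it becomes gamma > 13/14. The denominator q has to lie between
    k T^3 and T^4, with q T^3 below N, and q of order N^(15 sigma / 2) does. All these hold with
    room of order delta, and eta = delta / 16 pays for logarithms, divisor counts and constants.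
    Only 2 alpha is approximated: k is merged into the integer that multiplies it, so one q serves
    every k. As alpha is merely irrational, its good denominators may be sparse; N has to follow q,
    which gives arbitrarily large scales but not all large ones. *)

(* Cosines suffice, because the phases below carry an arbitrary constant. *)
Definition ec (R : realType) (x : R) : R := cos (2 * pi * x).
Definition es (R : realType) (x : R) : R := sin (2 * pi * x).

Lemma ecB (R : realType) (x y : R) : ec (x - y) = ec x * ec y + es x * es y.
Proof. by rewrite /ec mulrBr cosB. Qed.

Lemma ecD (R : realType) (x y : R) : ec (x + y) = ec x * ec y - es x * es y.
Proof. by rewrite /ec mulrDr cosD. Qed.

Lemma esD (R : realType) (x y : R) : es (x + y) = es x * ec y + ec x * es y.
Proof. by rewrite /es mulrDr sinD. Qed.

Lemma ecN (R : realType) (x : R) : ec (- x) = ec x.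
Proof. by rewrite /ec mulrN cosN. Qed.

Lemma ec0 (R : realType) : ec (0 : R) = 1.
Proof. by rewrite /ec mulr0 cos0. Qed.

Lemma ec2es2 (R : realType) (x : R) : ec x ^+ 2 + es x ^+ 2 = 1.
Proof. exact: cos2Dsin2. Qed.

Lemma ec_max (R : realType) (x : R) : `|ec x| <= 1.
Proof. exact: cos_max. Qed.

Lemma es_max (R : realType) (x : R) : `|es x| <= 1.
Proof. exact: sin_max. Qed.

Lemma ecDn (R : realType) (x : R) (n : nat) : ec (x + n%:R) = ec x.
Proof.
elim: n => [|n IH]; first by rewrite addr0.
rewrite -natr1 addrA -[RHS]IH /ec mulrDr mulr1.
by rewrite -[RHS]cosD2pi -[pi *+ 2]mulr_natl.
Qed.

Lemma ecDz (R : realType) (x : R) (m : int) : ec (x + m%:~R) = ec x.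
Proof.
case: m => n; first exact: ecDn.
by rewrite NegzE mulrNz -[LHS](ecDn _ n.+1) -pmulrn subrK.
Qed.

Lemma abel_sum (R : realType) (c S : nat -> R) (a b : nat) : (a < b)%N ->
  \sum_(a <= n < b) c n * (S n.+1 - S n) =
  c b.-1 * S b - c a * S a + \sum_(a <= n < b.-1) (c n - c n.+1) * S n.+1.
Proof.
case: b => // b; rewrite ltnS => ab /=.
elim: b ab => [|b IH] ab.
  by move: ab; rewrite leqn0 => /eqP->; rewrite big_nat1 big_geq // addr0 mulrBr.
move: ab; rewrite leq_eqVlt => /predU1P[->|ab].
  by rewrite big_nat1 big_geq // addr0 mulrBr.
rewrite ltnS in ab.
rewrite big_nat_recr ?(leqW ab) //= IH // [in RHS]big_nat_recr //=.
by ring.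
Qed.

(** The two boundary terms of [abel_sum] cost [C * B] each; monotone coefficients have total
    variation at most [2 * C], which costs the remaining [2 * C * B]. *)
Lemma abel_antitone_bound (R : realType) (c S : nat -> R) (a b : nat) (C B : R) :
  (a < b)%N -> (forall n, (a <= n < b)%N -> `|c n| <= C) ->
  (forall n, (a <= n)%N -> (n.+1 < b)%N -> c n.+1 <= c n) ->
  (forall n, (a <= n <= b)%N -> `|S n| <= B) ->
  `|\sum_(a <= n < b) c n * (S n.+1 - S n)| <= 4 * C * B.
Proof.
move=> ab hC hm hS.
have B0 : 0 <= B by apply: le_trans (hS a _); rewrite ?leqnn ?(ltnW ab).
have ha : (a <= a < b)%N by rewrite leqnn.
have hb : (a <= b.-1 < b)%N by case: b ab {hC hm hS ha} => // b; rewrite ltnS /= => ->/=.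
have hab : (a <= b.-1)%N by case/andP: hb.
have C0 : 0 <= C by apply: le_trans (hC a ha).
rewrite abel_sum //.
have h1 : `|c b.-1 * S b| <= C * B.
  by rewrite normrM ler_pM // ?hC // hS // leqnn (ltnW ab).
have h2 : `|c a * S a| <= C * B.
  by rewrite normrM ler_pM // ?hC // hS // leqnn (ltnW ab).
have h3 : `|\sum_(a <= n < b.-1) (c n - c n.+1) * S n.+1| <= 2 * C * B.
  apply: le_trans (ler_norm_sum _ _ _) _.
  apply: (@le_trans _ _ (\sum_(a <= n < b.-1) (c n - c n.+1) * B)).
    apply: ler_sum_nat => n /andP[an nb].
    have nb' : (n.+1 < b)%N by rewrite -[b](ltn_predK ab) ltnS.
    rewrite normrM ler_pM //.
      by rewrite ger0_norm // subr_ge0 hm.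
    by apply: hS; rewrite (leq_trans an) //= ltnW.
  rewrite -mulr_suml ler_wpM2r //.
  have -> : \sum_(a <= n < b.-1) (c n - c n.+1) = c a - c b.-1.
    rewrite -[RHS]opprB -(telescope_sumr c hab) -sumrN.
    by apply: eq_bigr => i _; rewrite opprB.
  have := hC _ ha; have := hC _ hb; rewrite !ler_norml => /andP[??] /andP[??].
  by lra.
have h4 := ler_normD (c b.-1 * S b - c a * S a)
  (\sum_(a <= n < b.-1) (c n - c n.+1) * S n.+1).
have h5 := ler_normB (c b.-1 * S b) (c a * S a).
by lra.
Qed.

Lemma cos_piquarter2 (R : realType) : cos (pi / 4 : R) ^+ 2 = 1 / 2.
Proof.
have := @cos_mulr2n R (pi / 4).
have -> : (pi / 4 : R) *+ 2 = pi / 2 by rewrite -mulr_natl; field.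
by rewrite cos_pihalf -mulr_natl => ?; lra.
Qed.

(** A weak Jordan inequality. Up to pi/4 the derivative is at least cos(pi/4) >= 1/2; beyond, the
    sine is at least 1/2 while x / 4 < 1/2, because pi/2 < 2. *)
Lemma sin_ge_quarter (R : realType) (x : R) : 0 <= x <= pi / 2 -> x / 4 <= sin x.
Proof.
move=> /andP[x0 x1].
have pg := @pi_gt0 R; have ph := @pihalf_lt2 R.
have c0 : 0 < cos (pi / 4 : R) by apply: cos_gt0_pihalf; apply/andP; split; lra.
have c1 : 1 / 2 <= cos (pi / 4 : R).
  have := cos_piquarter2 R; have : cos (pi / 4 : R) <= 1 by exact: cos_le1.
  by nra.
case: (leP x (pi / 4)) => x2.
  have [->|xn0] := eqVneq x 0; first by rewrite sin0 mul0r.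
  have xp : 0 < x by rewrite lt_neqAle eq_sym xn0.
  have [|c /[!in_itv]/= /andP[h1 h2]] := @MVT R (@sin R) (@cos R) 0 x xp.
    by apply: derivable_within_continuous => i _; exact: ex_derive.
  rewrite sin0 !subr0 => ->.
  have : cos (pi / 4) <= cos c.
    have [->//|ne] := eqVneq c (pi / 4).
    by rewrite ltW // ltr_cos // ?in_itv /=; try (apply/andP; split); lra.
  by nra.
have : sin (pi / 4) <= sin x.
  by rewrite ltW // ltr_sin // ?in_itv /=; try (apply/andP; split); lra.
have s0 : 0 < sin (pi / 4 : R) by apply: sin_gt0_pihalf; apply/andP; split; lra.
have := cos2Dsin2 (pi / 4 : R); rewrite cos_piquarter2.
have : sin (pi / 4 : R) <= 1 by exact: sin_le1.
by nra.
Qed.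

Lemma sinpi_ge (R : realType) (th t : R) : 0 < th -> th <= t <= 1 - th ->
  th / 2 <= sin (pi * t).
Proof.
move=> th0 /andP[h1 h2].
have pg := @pi_ge2 R.
case: (leP t (1/2)) => ht.
  have := @sin_ge_quarter R (pi * t).
  have -> : (0 <= pi * t <= pi / 2) by apply/andP; split; nra.
  by move=> /(_ isT); nra.
have -> : sin (pi * t) = sin (pi * (1 - t)).
  by rewrite -[RHS]opprK -sinN -sinDpi; congr sin; ring.
have := @sin_ge_quarter R (pi * (1 - t)).
have -> : (0 <= pi * (1 - t) <= pi / 2) by apply/andP; split; nra.
by move=> /(_ isT); nra.
Qed.

(* Abel summation applies to this form of [ec x], since the cotangent is monotone. *)
Lemma kl_step (R : realType) (x y : R) : sin (pi * (y - x)) != 0 ->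
  ec x = - 2^-1 * (ec y - ec x) +
         2^-1 * ((cos (pi * (y - x)) / sin (pi * (y - x))) * (es y - es x)).
Proof.
move=> s0; set u := pi * (y - x) in s0 *.
have -> : y = x + (y - x) by ring.
have c2u : ec (y - x) = 2 * cos u ^+ 2 - 1.
  rewrite /ec (_ : 2 * pi * (y - x) = u *+ 2); last by rewrite /u -mulr_natl; ring.
  by rewrite cos_mulr2n mulr_natl.
have s2u : es (y - x) = 2 * (cos u * sin u).
  rewrite /es (_ : 2 * pi * (y - x) = u *+ 2); last by rewrite /u -mulr_natl; ring.
  by rewrite sin_mulr2n mulr_natl.
rewrite (ecD x) (esD x) c2u s2u.
have cs := cos2Dsin2 u.
have e : cos u ^+ 2 = 1 - sin u ^+ 2 by lra.
apply: (mulfI s0); rewrite e; move: (cos u) (sin u) e s0 cs => c s e s0 cs.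
have -> : s * (- 2^-1 * (ec x * (2 * (1 - s ^+ 2) - 1) - es x * (2 * (c * s)) - ec x) + 2^-1 * (c / s * (es x * (2 * (1 - s ^+ 2) - 1) + ec x * (2 * (c * s)) - es x)))
  = s * (ec x * s ^+2 + es x * (c * s) - es x * c * s + c ^+ 2 * ec x) by field.
by rewrite e; ring.
Qed.

(** Over a common denominator the difference of the cotangents has numerator sin(pi (t - s)) >=
    0. *)
Lemma cotpi_antitone (R : realType) (s t : R) : 0 < s -> s <= t -> t < 1 ->
  cos (pi * t) / sin (pi * t) <= cos (pi * s) / sin (pi * s).
Proof.
move=> s0 st t1.
have pg := @pi_gt0 R.
have ss : 0 < sin (pi * s) by apply: sin_gt0_pi; apply/andP; split; nra.
have ts : 0 < sin (pi * t) by apply: sin_gt0_pi; apply/andP; split; nra.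
rewrite ler_pdivrMr // mulrAC ler_pdivlMr //.
rewrite -subr_ge0.
have -> : cos (pi * s) * sin (pi * t) - cos (pi * t) * sin (pi * s) = sin (pi * (t - s)).
  by rewrite mulrBr sinB; ring.
by apply: sin_ge0_pi; apply/andP; split; nra.
Qed.

(** In [kl_step] the first half telescopes and contributes at most 1 <= 1 / th. In the second, the
    cotangents are monotone and at most 2 / th by [sinpi_ge], so Abel summation gives 8 / th, halved
    to 4 / th. *)
Lemma kusmin_landau (R : realType) (psi : nat -> R) (a b : nat) (th : R) :
  0 < th -> th <= 1 ->
  (forall n, (a <= n < b)%N -> th <= psi n.+1 - psi n <= 1 - th) ->
  (forall n, (a <= n)%N -> (n.+1 < b)%N ->
     psi n.+1 - psi n <= psi n.+2 - psi n.+1) ->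
  `|\sum_(a <= n < b) ec (psi n)| <= 5 / th.
Proof.
move=> th0 th1 hb hm.
have th5 : 5 <= 5 / th by rewrite ler_pdivlMr //; nra.
case: (ltnP a b) => ab; last by rewrite big_geq // normr0; lra.
pose u n := psi n.+1 - psi n.
pose c n := cos (pi * u n) / sin (pi * u n).
have hs n : (a <= n < b)%N -> th / 2 <= sin (pi * u n).
  by move=> h; exact: sinpi_ge th0 (hb n h).
have e : \sum_(a <= n < b) ec (psi n) = - 2^-1 * (ec (psi b) - ec (psi a))
   + 2^-1 * \sum_(a <= n < b) c n * (es (psi n.+1) - es (psi n)).
  rewrite -(telescope_sumr (fun n => ec (psi n)) (ltnW ab)) !mulr_sumr -big_split /=.
  apply: eq_big_nat => n /hs h; apply: kl_step; apply: lt0r_neq0.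
  by apply: lt_le_trans h; lra.
have h1 : `|\sum_(a <= n < b) c n * (es (psi n.+1) - es (psi n))| <= 4 * (2 / th) * 1.
  apply: (@abel_antitone_bound R c (fun n => es (psi n))) => //.
  - move=> n h; rewrite /c normrM normfV.
    have h' := hs n h.
    have sp : 0 < sin (pi * u n) by apply: lt_le_trans h'; lra.
    rewrite (gtr0_norm sp) ler_pdivrMr // mulrAC ler_pdivlMr //.
    have := cos_max (pi * u n); nra.
  - move=> n an nb; apply: cotpi_antitone; last 1 first.
    + by rewrite /u; have /andP[] := hb n.+1 (introT andP (conj (leq_trans an (leqnSn n)) nb)); lra.
    + by rewrite /u; have /andP[] := hb n (introT andP (conj an (ltnW nb))); lra.
    + exact: hm.
  - by move=> n _; exact: es_max.
have := ec_max (psi b); have := ec_max (psi a).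
rewrite e; move: h1; set S := \sum_(_ <= _ < _) _; rewrite mulr1.
have -> : 4 * (2 / th) = 8 / th by ring.
have -> : 5 / th = 1 / th + 4 / th by field; lra.
have : 1 <= 1 / th by rewrite ler_pdivlMr //; lra.
have -> : 8 / th = 2 * (4 / th) by field; lra.
rewrite !ler_norml => ? /andP[? ?] /andP[? ?] /andP[? ?].
by apply/andP; split; lra.
Qed.

(** * Distance to the nearest integer, and increments near an integer *)

Lemma le_of_eq (R : numDomainType) (x y : R) : x = y -> x <= y.
Proof. by move=> ->. Qed.

(** Unlike the infimum [dist_int], this names an integer that attains the distance, so that signed
    remainders in [-1/2, 1/2] are available. *)
Definition nd (R : realType) (x : R) : R := `|x - (Num.floor (x + 2^-1))%:~R|.

Lemma nd_ge0 (R : realType) (x : R) : 0 <= nd x.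
Proof. exact: normr_ge0. Qed.

Lemma nd_ex (R : realType) (x : R) :
  exists2 m : int, nd x = `|x - m%:~R| & - 2^-1 <= x - m%:~R <= 2^-1.
Proof.
exists (Num.floor (x + 2^-1)) => //.
have h1 := floor_le (x + 2^-1); have := lt_succ_floor (x + 2^-1).
by rewrite intrD /= => h2; apply/andP; split; lra.
Qed.

Lemma nd_le_half (R : realType) (x : R) : nd x <= 2^-1.
Proof. by have [m -> /andP[h1 h2]] := nd_ex x; rewrite ler_norml; apply/andP; split. Qed.

Lemma nd_min (R : realType) (x : R) (k : int) : nd x <= `|x - k%:~R|.
Proof.
have [m -> /andP[h1 h2]] := nd_ex x.
have [->//|km] := eqVneq k m.
have h : 1 <= `|(m - k)%:~R : R|.
  by rewrite -intr_norm -[1]/(1%:~R) ler_int; move: km; lia.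
have : `|x - m%:~R| <= 2^-1 by rewrite ler_norml; apply/andP; split.
have := ler_normB (x - k%:~R) (x - m%:~R).
have -> : x - k%:~R - (x - m%:~R) = (m - k)%:~R by rewrite intrB; ring.
by lra.
Qed.

Lemma ndN (R : realType) (x : R) : nd (- x) = nd x.
Proof.
suff h (y : R) : nd (- y) <= nd y by apply: le_anti; rewrite h -{1}[x]opprK h.
have [m -> _] := nd_ex y; apply: le_trans (nd_min _ (- m)) _.
by rewrite -normrN intrN; apply: le_of_eq; congr `|_|; ring.
Qed.

(** Adding [k * n] to the phase leaves every cosine unchanged and moves the increments by [k]. *)
Lemma kusmin_landau_int (R : realType) (psi : nat -> R) (k : int) (a b : nat) (th : R) :
  0 < th -> th <= 1 ->
  (forall n, (a <= n < b)%N -> th <= psi n.+1 - psi n + k%:~R <= 1 - th) ->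
  (forall n, (a <= n)%N -> (n.+1 < b)%N ->
     psi n.+1 - psi n <= psi n.+2 - psi n.+1) ->
  `|\sum_(a <= n < b) ec (psi n)| <= 5 / th.
Proof.
move=> th0 th1 hb hm.
pose phi n := psi n + (k * n%:Z)%:~R.
have d n : phi n.+1 - phi n = psi n.+1 - psi n + k%:~R.
  by rewrite /phi -addn1 PoszD mulrDr mulr1 intrD; ring.
rewrite (eq_bigr (fun n => ec (phi n))); last by move=> n _; rewrite ecDz.
apply: kusmin_landau => // [n h|n an nb]; rewrite !d; first exact: hb.
by rewrite lerD2r; exact: hm.
Qed.

Lemma sum_ec_trivial (R : realType) (psi : nat -> R) (a b : nat) :
  `|\sum_(a <= n < b) ec (psi n)| <= (b - a)%:R.
Proof.
apply: le_trans (ler_norm_sum _ _ _) _.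
apply: (@le_trans _ _ (\sum_(a <= n < b) 1)).
  by apply: ler_sum => n _; exact: ec_max.
by rewrite sumr_const_nat.
Qed.

Lemma monotone_split (P : pred nat) (a b : nat) : (a <= b)%N ->
  (forall n, (a <= n)%N -> (n.+1 < b)%N -> P n -> P n.+1) ->
  exists2 c, (a <= c <= b)%N & (forall n, (a <= n < c)%N -> ~~ P n) /\
    (forall n, (c <= n < b)%N -> P n).
Proof.
move=> ab hm.
(* The disjunct [n == b] makes the search succeed even if [P] never holds; then c = b. *)
have ex : exists n, (a <= n)%N && ((n == b) || P n) by exists b; rewrite ab eqxx.
case: (ex_minnP ex) => c /andP[ac Pc] cmin.
have cb : (c <= b)%N by apply: cmin; rewrite ab eqxx.
exists c; first by rewrite ac cb.
split=> n /andP[h1 h2].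
  by apply/negP => Pn; have := cmin n; rewrite h1 Pn orbT leqNgt h2 => /(_ isT).
elim: n h1 h2 => [|n IH] cn nb.
  move: cn Pc nb; rewrite leqn0 => /eqP-> /orP[/eqP->|//]; by rewrite ltnn.
move: cn; rewrite leq_eqVlt => /predU1P[e|cn].
  by move: Pc; rewrite e => /orP[/eqP e'|//]; rewrite e' ltnn in nb.
by apply: hm => //; [exact: leq_trans ac _|exact: IH (ltnW nb)].
Qed.

Lemma mono_chain (R : realType) (f : nat -> R) (mu : R) (a b : nat) :
  (forall n, (a <= n)%N -> (n.+1 < b)%N -> f n + mu <= f n.+1) ->
  forall n m, (a <= n)%N -> (n <= m)%N -> (m < b)%N -> f n + (m - n)%:R * mu <= f m.
Proof.
move=> hm n m an; elim: m => [|m IH].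
  by rewrite leqn0 => /eqP->; rewrite subnn mul0r addr0.
rewrite leq_eqVlt => /predU1P[->|nm mb]; first by rewrite subnn mul0r addr0.
apply: le_trans (hm m (leq_trans an nm) mb).
rewrite subSn // -natr1 mulrDl mul1r addrA lerD2r.
by apply: IH => //; exact: ltnW.
Qed.

(* Three ranges according to the position of the increment [t n] relative to
   [(-th, th)]: Kusmin-Landau on the outer two, counting on the middle one. *)
Lemma second_derivative_test (R : realType) (psi : nat -> R) (k : int)
    (a b : nat) (mu th : R) :
  (a <= b)%N -> 0 < mu -> 0 < th -> th <= 8^-1 ->
  (forall n, (a <= n < b)%N -> - (5 / 8) <= psi n.+1 - psi n + k%:~R <= 2^-1) ->
  (forall n, (a <= n)%N -> (n.+1 < b)%N ->
     psi n.+1 - psi n + mu <= psi n.+2 - psi n.+1) ->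
  `|\sum_(a <= n < b) ec (psi n)| <= 10 / th + 2 * th / mu + 1.
Proof.
move=> ab mu0 th0 th8 hr hm.
pose t n := psi n.+1 - psi n + k%:~R.
have ht n : (a <= n)%N -> (n.+1 < b)%N -> t n + mu <= t n.+1.
  by move=> an nb; rewrite /t; have := hm n an nb; lra.
have hm0 n : (a <= n)%N -> (n.+1 < b)%N -> psi n.+1 - psi n <= psi n.+2 - psi n.+1.
  by move=> an nb; have := hm n an nb; lra.
have [|c /andP[ac cb] [c1 c2]] := @monotone_split (fun n => - th < t n) a b ab.
  by move=> n an nb h; apply: lt_le_trans h _; have := ht n an nb; lra.
have [|d /andP[cd db] [d1 d2]] := @monotone_split (fun n => th <= t n) c b cb.
  by move=> n an nb h; apply: le_trans h _; have := ht n (leq_trans ac an) nb; lra.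
have th1 : th <= 1 by lra.
rewrite (big_cat_nat ac cb) (big_cat_nat cd db) /=.
have h1 : `|\sum_(a <= n < c) ec (psi n)| <= 5 / th.
  (* One more unit moves the increments from [-5/8, -th] into [3/8, 1 - th]. *)
  apply: (@kusmin_landau_int R psi (k + 1)) => // [n nc|n an nc]; last first.
    by apply: hm0 => //; apply: leq_trans cb.
  have := c1 n nc; rewrite -leNgt /t.
  have := hr n; case/andP: nc => -> nc; rewrite (leq_trans nc cb) => /(_ isT)/andP[? ?] ?.
  by rewrite intrD; apply/andP; split; lra.
have h3 : `|\sum_(d <= n < b) ec (psi n)| <= 5 / th.
  have ad := leq_trans ac cd.
  apply: (@kusmin_landau_int R psi k) => // [n nc|n an nc]; last first.
    by apply: hm0 => //; apply: leq_trans an.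
  have := d2 n nc; rewrite /t.
  have := hr n; case/andP: nc => nd nb; rewrite (leq_trans ad nd) nb => /(_ isT)/andP[? ?] ?.
  by apply/andP; split; lra.
(* The increments grow by at least [mu] at each step and stay inside (-th, th), so at most 2 th / mu
   + 1 of them fit. *)
have h2 : `|\sum_(c <= n < d) ec (psi n)| <= 2 * th / mu + 1.
  apply: le_trans (sum_ec_trivial _ _ _) _.
  have p0 : 0 <= 2 * th / mu by rewrite divr_ge0 //; lra.
  case: (ltnP c d) => cd'; last by rewrite (eqP cd') /=; lra.
  have [e ed] : exists e, d = e.+1 by exists d.-1; lia.
  rewrite ed in cd' d1 db *.
  have hc : - th < t c by apply: c2; lia.
  have he : t e < th by rewrite ltNge; apply: d1; lia.
  have := @mono_chain R t mu a b ht c e ac; rewrite -ltnS cd' db => /(_ isT isT) h.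
  rewrite subSn; last by rewrite -ltnS.
  rewrite -natr1 lerD2r ler_pdivlMr //; lra.
have -> : 10 / th = 5 / th + 5 / th by field; lra.
apply: le_trans (ler_normD _ _) _.
have := ler_normD (\sum_(c <= n < d) ec (psi n)) (\sum_(d <= n < b) ec (psi n)).
by lra.
Qed.

(* [s] is the slope and [x] the small perturbation: the slope is far from the
   integers if [nd s >= 2 * nu] and near them otherwise. *)
Lemma inner_far (R : realType) (psi x : nat -> R) (s nu : R) (a b : nat) :
  (forall n, (a <= n < b)%N -> psi n.+1 - psi n = s + x n) ->
  (forall n, (a <= n < b)%N -> - nu <= x n <= 0) ->
  (forall n, (a <= n)%N -> (n.+1 < b)%N -> x n <= x n.+1) ->
  2 * nu <= nd s -> nd s * `|\sum_(a <= n < b) ec (psi n)| <= 10.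
Proof.
move=> hp hx hm hs.
have [e|s0] := eqVneq (nd s) 0; first by rewrite e mul0r.
have sp : 0 < nd s by rewrite lt_neqAle eq_sym s0 nd_ge0.
have sh := nd_le_half s.
have hm0 n : (a <= n)%N -> (n.+1 < b)%N -> psi n.+1 - psi n <= psi n.+2 - psi n.+1.
  move=> an nb; rewrite !hp ?lerD2l; first exact: hm.
    by rewrite nb (leq_trans an).
  by rewrite an ltnW.
suff : `|\sum_(a <= n < b) ec (psi n)| <= 5 / (nd s / 2).
  by rewrite ler_pdivlMr; lra.
have [m em /andP[m1 m2]] := nd_ex s.
case: (leP 0 (s - m%:~R)) => hsm.
  rewrite ger0_norm // in em.
  apply: (@kusmin_landau_int R psi (- m)) => //; try lra.
  by move=> n h; rewrite hp // intrN; have /andP[? ?] := hx n h; apply/andP; split; lra.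
rewrite ltr0_norm // in em.
apply: (@kusmin_landau_int R psi (1 - m)) => //; try lra.
by move=> n h; rewrite hp // intrB; have /andP[? ?] := hx n h; apply/andP; split; lra.
Qed.

(** A far slope combines [inner_far] with the trivial bound. For a near one the second derivative
    test gives S^2 <= 1024 / mu, and nd s < 2 nu <= 2 kap mu M cancels the [mu]. *)
Lemma inner_near (R : realType) (psi x : nat -> R) (s nu mu kap M : R) (a b : nat) :
  (a <= b)%N -> (b - a)%:R <= M -> 1 <= M -> 1 <= kap ->
  (forall n, (a <= n < b)%N -> psi n.+1 - psi n = s + x n) ->
  (forall n, (a <= n < b)%N -> - nu <= x n <= 0) ->
  (forall n, (a <= n)%N -> (n.+1 < b)%N -> x n + mu <= x n.+1) ->
  0 <= mu -> nu <= 8^-1 -> nu <= kap * mu * M ->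
  nd s * (\sum_(a <= n < b) ec (psi n)) ^+ 2 <= 2048 * kap * M.
Proof.
move=> ab hM M1 k1 hp hx hm mu0 nu8 nuk.
have kM : 1 <= kap * M by nra.
set S := \sum_(_ <= _ < _) _.
have S0 := normr_ge0 S.
have SM : `|S| <= M by apply: le_trans (sum_ec_trivial _ _ _) hM.
have n0 := nd_ge0 s; have nh := nd_le_half s.
rewrite -(real_normK (num_real S)) -[2048 * kap * M]mulrA.
case: (leP (2 * nu) (nd s)) => hs.
  have : nd s * `|S| <= 10.
    apply: inner_far hp hx _ hs => n an nb; have := hm n an nb; lra.
  by nra.
have mup : 0 < mu by case: (ltgtP 0 mu) mu0 => // e _; rewrite -e in nuk; nra.
case: (leqP (b - a) 1) => ba.
  have : `|S| <= 1 by apply: le_trans (sum_ec_trivial _ _ _) _; rewrite (ler_nat R _ 1).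
  by nra.
(* Two consecutive perturbations both lie in [-nu, 0], so their gap, at least [mu], is at most
   nu. *)
have mu8 : mu <= 8^-1.
  have /andP[h1 h2] : - nu <= x a <= 0 by apply: hx; clear -ba; lia.
  have /andP[h3 h4] : - nu <= x a.+1 <= 0 by apply: hx; clear -ba; lia.
  have : x a + mu <= x a.+1 by apply: hm; clear -ba; lia.
  by lra.
pose r := Num.sqrt mu.
have r0 : 0 < r by rewrite sqrtr_gt0.
have r2 : r ^+ 2 = mu by rewrite sqr_sqrtr.
have r38 : r / 3 <= 8^-1 by nra.
have [m em /andP[m1 m2]] := nd_ex s.
(* A multiple of sqrt(mu) balances 10 / th against 2 th / mu; the factor 1/3 keeps [th] below
   1/8. *)
have hS : `|S| <= 10 / (r / 3) + 2 * (r / 3) / mu + 1.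
  apply: (@second_derivative_test R psi (- m)) => //; first by rewrite divr_gt0.
    by move=> n h; rewrite hp // intrN; have /andP[? ?] := hx n h; apply/andP; split; lra.
  move=> n an nb; rewrite !hp; [have := hm n an nb; lra| |].
    by rewrite nb (leq_trans an).
  by rewrite an ltnW.
have hS' : `|S| * r <= 32.
  have : `|S| * r <= (10 / (r / 3) + 2 * (r / 3) / mu + 1) * r by rewrite ler_pM2r.
  have -> : (10 / (r / 3) + 2 * (r / 3) / mu + 1) * r = 30 + 2 / 3 + r.
    by rewrite -r2; field; rewrite gt_eqF.
  have : r <= 1 by nra.
  by lra.
have : `|S| ^+ 2 * mu <= 1024.
  have -> : `|S| ^+ 2 * mu = (`|S| * r) ^+ 2 by rewrite -r2; ring.
  have : 0 <= `|S| * r by rewrite mulr_ge0 // ltW.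
  by nra.
have h2 : nd s <= 2 * kap * mu * M by lra.
have : nd s * `|S| ^+ 2 <= 2 * kap * mu * M * `|S| ^+ 2 by rewrite ler_wpM2r // exprn_ge0.
by nra.
Qed.

(** With slope 0 all increments are negative; adding 1 puts them in [1/2, 1 - x0], where
    Kusmin-Landau applies. *)
Lemma inner_zero (R : realType) (psi x : nat -> R) (x0 : R) (a b : nat) :
  0 < x0 -> x0 <= 2^-1 ->
  (forall n, (a <= n < b)%N -> psi n.+1 - psi n = x n) ->
  (forall n, (a <= n < b)%N -> - 2^-1 <= x n <= - x0) ->
  (forall n, (a <= n)%N -> (n.+1 < b)%N -> x n <= x n.+1) ->
  `|\sum_(a <= n < b) ec (psi n)| <= 5 / x0.
Proof.
move=> x00 x02 hp hx hm; apply: (@kusmin_landau_int R psi 1) => //; first by lra.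
  by move=> n h; rewrite hp //; have /andP[? ?] := hx n h; apply/andP; split; lra.
move=> n an nb; rewrite !hp; [exact: hm| |].
  by rewrite nb (leq_trans an).
by rewrite an ltnW.
Qed.

(** * Van der Corput differencing *)

(** The expansion of the squared modulus of an exponential sum, with real and imaginary parts kept
    separate. *)
Lemma sqr_sum_trig (R : realType) (I : finType) (w phi : I -> R) :
  (\sum_i w i * ec (phi i)) ^+ 2 + (\sum_i w i * es (phi i)) ^+ 2 =
  \sum_i \sum_j w i * w j * ec (phi i - phi j).
Proof.
rewrite !expr2 !big_distrl -big_split /=; apply: eq_bigr => i _.
rewrite !big_distrr -big_split /=; apply: eq_bigr => j _.
by rewrite ecB; ring.
Qed.

(** Cauchy-Schwarz against the constant 1, from the nonnegativity of the double sum of (f i - f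
    j)^2. *)
Lemma sqr_sum_le (R : realType) (I : finType) (P : pred I) (f : I -> R) :
  (\sum_(i | P i) f i) ^+ 2 <= #|P|%:R * \sum_(i | P i) f i ^+ 2.
Proof.
have hc (c : R) : \sum_(i | P i) c = #|P|%:R * c.
  by rewrite (eq_bigl (fun i => i \in P)) // sumr_const mulr_natl.
have h : 0 <= \sum_(i | P i) \sum_(j | P j) (f i - f j) ^+ 2.
  by apply: sumr_ge0 => i _; apply: sumr_ge0 => j _; exact: sqr_ge0.
have e : \sum_(i | P i) \sum_(j | P j) (f i - f j) ^+ 2 =
  2 * (#|P|%:R * \sum_(i | P i) f i ^+ 2) - 2 * (\sum_(i | P i) f i) ^+ 2.
  have -> : \sum_(i | P i) \sum_(j | P j) (f i - f j) ^+ 2 =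
    \sum_(i | P i) (#|P|%:R * f i ^+ 2 + \sum_(j | P j) f j ^+ 2
       - 2 * f i * \sum_(j | P j) f j).
    apply: eq_bigr => i _.
    have -> : #|P|%:R * f i ^+ 2 = \sum_(j | P j) f i ^+ 2.
      by rewrite hc.
    rewrite mulr_sumr -big_split /= -sumrB; apply: eq_bigr => j _; ring.
  rewrite sumrB big_split /= -mulr_sumr hc -mulr_suml -mulr_sumr.
  ring.
by move: h; rewrite e; lra.
Qed.

Lemma sum_indic_nat (R : pzRingType) (n k : nat) (f : nat -> R) :
  \sum_(m < n) (m == k :> nat)%:R * f m = (k < n)%:R * f k.
Proof.
case: (ltnP k n) => kn.
  rewrite (bigD1 (Ordinal kn)) //= eqxx mul1r big1 ?addr0 ?mul1r // => i.
  by move=> /negP ik; case: eqP => [e|]; rewrite ?mul0r //; case: ik; apply/eqP/val_inj.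
rewrite mul0r big1 // => i _; case: eqP => [e|]; rewrite ?mul0r //.
by have := ltn_ord i; rewrite e ltnNge kn.
Qed.

Lemma sum_indic_le (R : realType) (n k : nat) : \sum_(m < n) (m == k :> nat)%:R <= 1 :> R.
Proof.
have := sum_indic_nat n k (fun=> 1 : R); rewrite (eq_bigr (fun m : 'I_n => (m == k :> nat)%:R)).
  by move=> ->; rewrite mulr1; case: (k < n)%N.
by move=> i _; rewrite mulr1.
Qed.

Definition vdc_corr (R : realType) (n : nat) (phi : nat -> R) (t : nat) :=
  \sum_(0 <= m < n - t) ec (phi (m + t)%N - phi m).

Lemma vdc_shift (R : realType) (n : nat) (phi : nat -> R) (r r' : nat) : (r <= r')%N ->
  \sum_(m < n) \sum_(m' < n) (m + r == m' + r')%N%:R * ec (phi m - phi m') = vdc_corr n phi (r' - r).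
Proof.
move=> rr; rewrite exchange_big /=.
rewrite (eq_bigr (fun m' : 'I_n => (m' + (r' - r) < n)%N%:R * ec (phi (m' + (r' - r))%N - phi m'))).
  rewrite /vdc_corr -(big_mkord xpredT (fun m => (m + (r' - r) < n)%N%:R * ec (phi (m + (r' - r))%N - phi m))).
  rewrite (big_cat_nat (leq0n (n - (r' - r))) (leq_subr (r' - r) n)) /= [X in _ + X](_ : _ = 0).
    rewrite addr0; apply: eq_big_nat => m /andP[_ h].
    have -> : (m + (r' - r) < n)%N by lia.
    by rewrite mul1r.
  rewrite big_nat_cond big1 // => m h.
  have -> : (m + (r' - r) < n)%N = false by lia.
  by rewrite mul0r.
move=> m' _; rewrite -(sum_indic_nat _ _ (fun k => ec (phi k - phi m'))); apply: eq_bigr => m _.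
by congr (_%:R * _); congr nat_of_bool; lia.
Qed.

Lemma vdc_cor (R : realType) (n : nat) (phi : nat -> R) (r r' : nat) :
  \sum_(m < n) \sum_(m' < n) (m + r == m' + r')%N%:R * ec (phi m - phi m') =
  vdc_corr n phi (maxn r r' - minn r r').
Proof.
case: (leqP r r') => rr; first by rewrite vdc_shift.
rewrite -(@vdc_shift _ _ _ r' r (ltnW rr)) exchange_big /=.
apply: eq_bigr => m _; apply: eq_bigr => m' _; rewrite eq_sym; congr (_ * _).
by rewrite -ecN opprB.
Qed.

(** A distance t > 0 from r is reached only at r + t and r - t. Truncated subtraction can only add
    nonnegative terms. *)
Lemma vdc_count (R : realType) (Y r : nat) (g : nat -> R) : (forall t, 0 <= g t) -> (r < Y)%N ->
  \sum_(r' < Y) g (maxn r r' - minn r r')%N <= g 0%N + 2 * \sum_(1 <= t < Y) g t.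
Proof.
move=> g0 rY.
apply: (@le_trans _ _ (\sum_(r' < Y) ((r' == r :> nat)%:R * g 0%N +
   \sum_(1 <= t < Y) ((r' == (r + t)%N :> nat)%:R + (r' == (r - t)%N :> nat)%:R) * g t))).
  apply: ler_sum => r' _.
  have p t : 0 <= ((r' == (r + t)%N :> nat)%:R + (r' == (r - t)%N :> nat)%:R) * g t.
    by rewrite mulr_ge0 // addr_ge0.
  set d := (maxn r r' - minn r r')%N.
  have [e|ne] := eqVneq (r' : nat) r.
    have -> : d = 0%N by rewrite /d e; lia.
    by rewrite mul1r lerDl sumr_ge0.
  rewrite mul0r add0r.
  have d1 : (d \in index_iota 1 Y)%N.
    by rewrite mem_index_iota /d; have := ltn_ord r'; move: ne rY; lia.
  rewrite (bigD1_seq d) ?iota_uniq //= -[leLHS]addr0 lerD ?sumr_ge0 //.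
  apply: le_trans (_ : 1 * g d <= _); first by rewrite mul1r.
  apply: ler_wpM2r => //.
  have : (r' == (r + d)%N :> nat) || (r' == (r - d)%N :> nat) by rewrite /d; lia.
  by case/orP => ->; rewrite ?lerDl ?lerDr.
rewrite big_split /= -mulr_suml exchange_big /= lerD //.
  by rewrite -[leRHS]mul1r ler_wpM2r // sum_indic_le.
rewrite mulr_sumr; apply: ler_sum => t _; rewrite -mulr_suml ler_wpM2r //.
have -> : (2 : R) = 1 + 1 by [].
by rewrite big_split lerD // sum_indic_le.
Qed.

(** Writing j = m + r with r < Y covers each m exactly Y times, so Y times the sum is the sum of
    [u j] over n + Y windows. Cauchy-Schwarz over the windows leaves correlations at distance |r -
    r'|. *)
Lemma vdc0 (R : realType) (n Y : nat) (phi : nat -> R) : (0 < Y)%N ->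
  (\sum_(m < n) ec (phi m)) ^+ 2 <= (n + Y)%:R / Y%:R *
    (n%:R + 2 * \sum_(1 <= r < Y) `|vdc_corr n phi r|).
Proof.
move=> Y0.
have Yp : 0 < Y%:R :> R by rewrite ltr0n.
pose I := ('I_n * 'I_Y)%type.
pose w j (p : I) : R := ((p.1 + p.2)%N == j)%:R.
pose u j := \sum_(p : I) w j p * ec (phi p.1).
(* The sine parts are added only to complete [u j] to a squared modulus, which expands into cosines
   of differences. *)
pose v j := \sum_(p : I) w j p * es (phi p.1).
have hu : \sum_(j < n + Y) u j = Y%:R * \sum_(m < n) ec (phi m).
  rewrite /u exchange_big /=.
  rewrite (eq_bigr (fun p : I => ec (phi p.1))); last first.
    move=> p _; rewrite -mulr_suml (eq_bigr (fun j : 'I_(n + Y) => (j == (p.1 + p.2)%N :> nat)%:R * 1)).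
      rewrite (sum_indic_nat _ _ (fun=> 1)) mulr1.
      by have -> : (p.1 + p.2 < n + Y)%N; rewrite ?mul1r //; have := ltn_ord p.1; have := ltn_ord p.2; lia.
    by move=> j _; rewrite mulr1 /w eq_sym.
  rewrite -(pair_bigA _ (fun (m : 'I_n) (r : 'I_Y) => ec (phi m))) /= mulr_sumr.
  by apply: eq_bigr => m _; rewrite sumr_const card_ord mulr_natl.
have h1 : (\sum_(j < n + Y) u j) ^+ 2 <= (n + Y)%:R * \sum_(j < n + Y) (u j ^+ 2 + v j ^+ 2).
  apply: le_trans (sqr_sum_le _ _) _; rewrite card_ord.
  rewrite ler_wpM2l // ler_sum // => j _; by rewrite lerDl sqr_ge0.
have h2 : \sum_(j < n + Y) (u j ^+ 2 + v j ^+ 2) =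
   \sum_(r < Y) \sum_(r' < Y) vdc_corr n phi (maxn r r' - minn r r').
  rewrite (eq_bigr (fun j : 'I_(n + Y) => \sum_(p : I) \sum_(p' : I) w j p * w j p' * ec (phi p.1 - phi p'.1))); last first.
    by move=> j _; rewrite /u /v sqr_sum_trig.
  rewrite exchange_big /=.
  rewrite (eq_bigr (fun p : I => \sum_(p' : I) ((p.1 + p.2 == p'.1 + p'.2)%N)%:R * ec (phi p.1 - phi p'.1))); last first.
    move=> p _; rewrite exchange_big /=; apply: eq_bigr => p' _.
    rewrite -mulr_suml; congr (_ * _).
    rewrite (eq_bigr (fun j : 'I_(n + Y) => (j == (p.1 + p.2)%N :> nat)%:R * w j p')).
      rewrite (sum_indic_nat _ _ (fun j => w j p')) /w.
      have -> : (p.1 + p.2 < n + Y)%N by have := ltn_ord p.1; have := ltn_ord p.2; lia.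
      by rewrite mul1r eq_sym.
    by move=> j _; rewrite /w eq_sym.
  rewrite -(pair_bigA _ (fun (m : 'I_n) (r : 'I_Y) => \sum_(p' : I) ((m + r == p'.1 + p'.2)%N)%:R * ec (phi m - phi p'.1))) /=.
  rewrite exchange_big /=; apply: eq_bigr => r _.
  under eq_bigr => m _.
    rewrite -(pair_bigA _ (fun (m' : 'I_n) (r' : 'I_Y) => ((m + r == m' + r')%N)%:R * ec (phi m - phi m'))) /=.
    rewrite exchange_big /=; over.
  by rewrite exchange_big /=; apply: eq_bigr => r' _; rewrite vdc_cor.
have h3 : \sum_(r < Y) \sum_(r' < Y) vdc_corr n phi (maxn r r' - minn r r') <=
   Y%:R * (n%:R + 2 * \sum_(1 <= r < Y) `|vdc_corr n phi r|).
  apply: le_trans (_ : \sum_(r < Y) (n%:R + 2 * \sum_(1 <= r < Y) `|vdc_corr n phi r|) <= _); last first.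
    by rewrite sumr_const card_ord -[leLHS]mulr_natl.
  apply: ler_sum => r _.
  apply: le_trans (_ : \sum_(r' < Y) `|vdc_corr n phi (maxn r r' - minn r r')| <= _).
    by apply: ler_sum => r' _; exact: ler_norm.
  apply: le_trans (@vdc_count _ Y r (fun t => `|vdc_corr n phi t|) _ _) _ => //.
  rewrite lerD2r /vdc_corr subn0; apply: le_trans (sum_ec_trivial _ _ _) _; by rewrite subn0.
rewrite hu h2 in h1.
have h4 : (Y%:R * \sum_(m < n) ec (phi m)) ^+ 2 <=
   (n + Y)%:R * (Y%:R * (n%:R + 2 * \sum_(1 <= r < Y) `|vdc_corr n phi r|)).
  by apply: le_trans h1 _; rewrite ler_wpM2l.
rewrite -(ler_pM2l (exprn_gt0 2 Yp)) -exprMn; apply: le_trans h4 _.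
by apply: le_of_eq; field; rewrite gt_eqF.
Qed.

Lemma vdc (R : realType) (phi : nat -> R) (a b Y : nat) : (0 < Y)%N ->
  (\sum_(a <= m < b) ec (phi m)) ^+ 2 <= ((b - a) + Y)%:R / Y%:R *
    ((b - a)%:R + 2 * \sum_(1 <= r < Y)
       `|\sum_(a <= m < b - r) ec (phi (m + r)%N - phi m)|).
Proof.
move=> Y0; have := @vdc0 R (b - a) Y (fun m => phi (m + a)%N) Y0.
rewrite -(big_mkord xpredT (fun m => ec (phi (m + a)%N))).
rewrite -[X in \sum_(X <= m < b) ec (phi m)]add0n big_addn.
congr (_ <= _ * (_ + 2 * _)); apply: eq_bigr => r _.
rewrite /vdc_corr -[X in _ = `|\sum_(X <= m < b - r) _|]add0n big_addn subnAC.
by congr `|_|; apply: eq_bigr => m _; rewrite addnAC.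
Qed.

(** * Successive differences of real powers, and differenced phases *)

Lemma mvt_step (R : realType) (f f' : R -> R) (x r : R) : 0 <= r ->
  (forall z, x <= z <= x + r -> is_derive z 1 f (f' z)) ->
  exists2 z, x <= z <= x + r & f (x + r) - f x = r * f' z.
Proof.
move=> r0 h.
have [|||z /[!in_itv]/= hz e] := @MVT_segment R f f' x (x + r).
- by rewrite lerDl.
- by move=> z; rewrite in_itv /= => /andP[h1 h2]; apply: h; rewrite !ltW.
- apply: derivable_within_continuous => z /[!in_itv]/= hz.
  by have [] := h z hz.
by exists z => //; rewrite e addrAC subrr add0r mulrC.
Qed.

Lemma powR_diff1 (R : realType) (c x r : R) : 0 < x -> 0 <= r ->
  exists2 z, x <= z <= x + r & (x + r) `^ c - x `^ c = r * (c * z `^ (c - 1)).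
Proof.
move=> x0 r0; apply: (@mvt_step R (fun z => z `^ c) (fun z => c * z `^ (c - 1))) => //.
by move=> z /andP[h _]; apply: is_derive1_powR; exact: lt_le_trans h.
Qed.

Lemma is_derive_powR_shift (R : realType) (c r z : R) : 0 < z + r ->
  is_derive z 1 (fun y => (y + r) `^ c) (c * (z + r) `^ (c - 1)).
Proof.
move=> h.
have h1 : is_derive z (1 : R) (fun y : R => y + r) (1 + 0) by exact: is_deriveD.
have h2 : is_derive (z + r) (1 : R) (fun y : R => y `^ c) (c * (z + r) `^ (c - 1)).
  exact: is_derive1_powR.
have := is_derive1_comp (f := fun y => y `^ c) (g := fun y => y + r) (x := z) h2 h1.
by rewrite addr0 mulr1.
Qed.

(** The mean value theorem on a unit step of (y + r)^c - y^c, followed by [powR_diff1] at exponent c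
    - 1. [powR_diff3] repeats the scheme once more. The second difference gives the size of the
    perturbation of the slope and the third its rate of growth. *)
Lemma powR_diff2 (R : realType) (c x r : R) : 0 < x -> 0 <= r ->
  exists2 z, x <= z <= x + r + 1 &
    ((x + 1 + r) `^ c - (x + 1) `^ c) - ((x + r) `^ c - x `^ c) =
    r * (c * (c - 1) * z `^ (c - 2)).
Proof.
move=> x0 r0.
have [||z /andP[z1 z2] ->] := @mvt_step R (fun y => (y + r) `^ c - y `^ c)
  (fun y => c * (y + r) `^ (c - 1) - c * y `^ (c - 1)) x 1 => //.
  move=> z /andP[h _]; have z0 : 0 < z by exact: lt_le_trans h.
  apply: is_deriveB; first by apply: is_derive_powR_shift; rewrite ltr_wpDr.
  exact: is_derive1_powR.
have z0 : 0 < z by exact: lt_le_trans z1.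
have [y /andP[y1 y2] e] := powR_diff1 (c - 1) z0 r0.
exists y; first by apply/andP; split; lra.
rewrite mul1r -mulrBr e (_ : c - 1 - 1 = c - 2); last by ring.
by ring.
Qed.

Lemma powR_diff3 (R : realType) (c x r : R) : 0 < x -> 0 <= r ->
  exists2 z, x <= z <= x + r + 2 &
    (((x + 1 + 1 + r) `^ c - (x + 1 + 1) `^ c) - ((x + 1 + r) `^ c - (x + 1) `^ c)) -
    (((x + 1 + r) `^ c - (x + 1) `^ c) - ((x + r) `^ c - x `^ c)) =
    r * (c * (c - 1) * (c - 2) * z `^ (c - 3)).
Proof.
move=> x0 r0; rewrite -!(addrA _ 1 r).
have [||z /andP[z1 z2] e] := @mvt_step R
  (fun y => ((y + (1 + r)) `^ c - (y + 1) `^ c) - ((y + r) `^ c - y `^ c))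
  (fun y => c * (y + (1 + r)) `^ (c - 1) - c * (y + 1) `^ (c - 1)
       - (c * (y + r) `^ (c - 1) - c * y `^ (c - 1))) x 1 => //.
  move=> z /andP[h _]; have z0 : 0 < z by exact: lt_le_trans h.
  apply: is_deriveB; apply: is_deriveB; try exact: is_derive1_powR.
  - by apply: is_derive_powR_shift; rewrite ltr_wpDr // addr_ge0.
  - by apply: is_derive_powR_shift; rewrite ltr_wpDr.
  - by apply: is_derive_powR_shift; rewrite ltr_wpDr.
rewrite -!(addrA _ 1 r) in e; rewrite e.
have z0 : 0 < z by exact: lt_le_trans z1.
have [y /andP[y1 y2]] := powR_diff2 (c - 1) z0 r0.
rewrite -!(addrA _ 1 r) => e'.
exists y; first by apply/andP; split; lra.
rewrite mul1r -!mulrBr e' (_ : c - 1 - 1 = c - 2); last by ring.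
rewrite (_ : c - 1 - 2 = c - 3); last by ring.
by ring.
Qed.

Lemma powR_antitone (R : realType) (e x y : R) : e <= 0 -> 0 < x -> x <= y -> y `^ e <= x `^ e.
Proof.
move=> e0 x0 xy; have y0 := lt_le_trans x0 xy.
rewrite -[e]opprK !(powRN _ (- e)) lef_pV2 ?posrE ?powR_gt0 //.
by apply: ge0_ler_powR; rewrite ?nnegrE ?oppr_ge0 // ltW.
Qed.

Lemma powR_scale_ge (R : realType) (e K M : R) (n : nat) : 1 <= K -> 0 < M -> - n%:R <= e ->
  K ^- n * M `^ e <= (K * M) `^ e.
Proof.
move=> K1 M0 hn; have K0 : 0 <= K by lra.
rewrite powRM ?(ltW M0) // ler_wpM2r ?powR_ge0 //.
by rewrite -powR_invn // ler_powR.
Qed.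

(** What differencing A n^gamma + B n^2 by [r] leaves: a linear phase of slope t = 2 B r, a
    constant, and a slowly varying part. *)
Definition corr_sum (R : realType) (gamma A t c : R) (r a b : nat) : R :=
  \sum_(a <= n < b) ec (A * ((n + r)%:R `^ gamma - n%:R `^ gamma) + t * n%:R + c).

(** The perturbation of the slope lies between -nu and -nu / 35^2 and grows by at least nu / (35^3
    M) per step. The 35 is 32 + 1 + 2: intermediate points are at most n + r + 2, with n <= 32 M, r
    <= M and 1 <= M. The three clauses come from [inner_far], [inner_near] and [inner_zero]. *)
Lemma corr_sum_bounds (R : realType) (gamma M A t c : R) (r a b : nat)
    (nu := A * r%:R * (gamma * (1 - gamma) * M `^ (gamma - 2))) :
  0 < gamma < 1 -> 1 <= M -> 0 <= A -> r%:R <= M -> (a <= b)%N ->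
  (forall n, (a <= n < b)%N -> M <= n%:R <= 32 * M) -> (b - a)%:R <= 32 * M ->
  [/\ 2 * nu <= nd t -> nd t * `|corr_sum gamma A t c r a b| <= 10,
      nu <= 8^-1 -> nd t * (corr_sum gamma A t c r a b) ^+ 2 <= 2048 * 35 ^+ 3 * (32 * M) &
      t = 0 -> 0 < nu <= 2^-1 -> `|corr_sum gamma A t c r a b| <= 5 * 35 ^+ 2 / nu].
Proof.
case/andP=> g0 g1 M1 A0 rM ab hM hab.
pose psi (n : nat) : R := A * ((n + r)%:R `^ gamma - n%:R `^ gamma) + t * n%:R + c.
pose d2 (x : R) := ((x + 1 + r%:R) `^ gamma - (x + 1) `^ gamma) - ((x + r%:R) `^ gamma - x `^ gamma).
pose x (n : nat) : R := A * d2 n%:R.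
have nu0 : 0 <= nu by rewrite !mulr_ge0 ?powR_ge0 //; lra.
have p3 : 0 <= A * r%:R * (gamma * (1 - gamma)).
  by rewrite !mulr_ge0 // ?subr_ge0 ltW.
have incr n : psi n.+1 - psi n = t + x n.
  by rewrite /psi /x /d2 !natrD -[n.+1]addn1 natrD; ring.
have hx n : (a <= n < b)%N -> - nu <= x n <= - (nu / 35 ^+ 2).
  move=> h; have /andP[h1 h2] := hM n h.
  have n0 : 0 < n%:R :> R by lra.
  have [z /andP[z1 z2] e] := powR_diff2 gamma n0 (ler0n R r).
  have z0 : 0 < z by lra.
  have p1 : z `^ (gamma - 2) <= M `^ (gamma - 2) by apply: powR_antitone; lra.
  have p2 : (35 ^+ 2)^-1 * M `^ (gamma - 2) <= z `^ (gamma - 2).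
    apply: le_trans (@powR_scale_ge R (gamma - 2) 35 M 2 _ _ _) _; try lra.
    by apply: powR_antitone; lra.
  have -> : x n = - (A * r%:R * (gamma * (1 - gamma)) * z `^ (gamma - 2)).
    by rewrite /x /d2 e; ring.
  rewrite !lerN2; apply/andP; split.
    by rewrite /nu [leRHS]mulrA ler_wpM2l.
  have -> : nu / 35 ^+ 2 = A * r%:R * (gamma * (1 - gamma)) * ((35 ^+ 2)^-1 * M `^ (gamma - 2)).
    by rewrite /nu; field.
  by rewrite ler_wpM2l.
have hx' n : (a <= n < b)%N -> - nu <= x n <= 0.
  move=> /hx /andP[-> h] /=; apply: le_trans h _.
  by rewrite oppr_le0 divr_ge0 // exprn_ge0.
have hm n : (a <= n)%N -> (n.+1 < b)%N -> x n + nu / (35 ^+ 3 * M) <= x n.+1.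
  move=> an nb.
  have /andP[h1 h2] : M <= n%:R <= 32 * M by apply: hM; rewrite an ltnW.
  have n0 : 0 < n%:R :> R by lra.
  have [z /andP[z1 z2] e] := powR_diff3 gamma n0 (ler0n R r).
  have z0 : 0 < z by lra.
  have p2 : (35 ^+ 3)^-1 * M `^ (gamma - 3) <= z `^ (gamma - 3).
    apply: le_trans (@powR_scale_ge R (gamma - 3) 35 M 3 _ _ _) _; try lra.
    by apply: powR_antitone; lra.
  have -> : x n.+1 = x n + A * r%:R * (gamma * (1 - gamma)) * ((2 - gamma) * z `^ (gamma - 3)).
    have ee : d2 n.+1%:R = d2 n%:R + r%:R * (gamma * (gamma - 1) * (gamma - 2) * z `^ (gamma - 3)).
      by rewrite /d2 -[n.+1]addn1 natrD -e; ring.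
    by rewrite /x ee; ring.
  rewrite lerD2l.
  have -> : nu / (35 ^+ 3 * M) = A * r%:R * (gamma * (1 - gamma)) * ((35 ^+ 3)^-1 * M `^ (gamma - 3)).
    have -> : gamma - 3 = gamma - 2 - 1 by ring.
    rewrite [in RHS]powRB; last by apply/implyP => _; rewrite gt_eqF //; lra.
    rewrite powRr1 /nu; last lra.
    by field; rewrite gt_eqF //; lra.
  rewrite ler_wpM2l //; have q := powR_ge0 z (gamma - 3).
  apply: le_trans p2 _; rewrite -[leLHS]mul1r ler_wpM2r //; lra.
have hm0 n : (a <= n)%N -> (n.+1 < b)%N -> x n <= x n.+1.
  move=> an nb; apply: le_trans (hm n an nb); rewrite lerDl divr_ge0 // mulr_ge0 ?exprn_ge0 //; lra.
split.
- move=> h; apply: (@inner_far R psi x t nu) => //.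
- move=> h; apply: (@inner_near R psi x t nu (nu / (35 ^+ 3 * M))) => //; try lra.
  + by rewrite divr_ge0 // mulr_ge0 ?exprn_ge0 //; lra.
  + have -> : 35 ^+ 3 * (nu / (35 ^+ 3 * M)) * (32 * M) = 32 * nu by field; rewrite gt_eqF //; lra.
    by lra.
- move=> t0 /andP[h1 h2].
  have -> : 5 * 35 ^+ 2 / nu = 5 / (nu / 35 ^+ 2) by field; rewrite gt_eqF.
  apply: (@inner_zero R psi x) => //; try lra.
  + by move=> n _; rewrite incr t0 add0r.
  + by move=> n hn; have /andP[? ?] := hx n hn; apply/andP; split; lra.
Qed.

Lemma corr_trivial (R : realType) (gamma A t c : R) (r a b : nat) :
  `|corr_sum gamma A t c r a b| <= (b - a)%:R.
Proof. exact: sum_ec_trivial. Qed.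

(** Differencing turns B n^2 into 2 B r n + B r^2, whence the slope and the constant of [corr_sum].
    The 33 is 32 + 1, from Y <= M. *)
Lemma weyl_step (R : realType) (gamma M A B c : R) (a b Y : nat) :
  1 <= M -> (0 < Y)%N -> Y%:R <= M -> (b - a)%:R <= 32 * M ->
  (\sum_(a <= n < b) ec (A * n%:R `^ gamma + B * n%:R ^+ 2 + c)) ^+ 2 <=
  33 * M / Y%:R * (32 * M + 2 * \sum_(1 <= r < Y)
     `|corr_sum gamma A (2 * B * r%:R) (B * r%:R ^+ 2) r a (b - r)|).
Proof.
move=> M1 Y0 YM hab.
have Yp : 0 < Y%:R :> R by rewrite ltr0n.
apply: le_trans (@vdc R (fun n => A * n%:R `^ gamma + B * n%:R ^+ 2 + c) a b Y Y0) _.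
have -> : \sum_(1 <= r < Y)
  `|\sum_(a <= m < b - r) ec (A * (m + r)%:R `^ gamma + B * (m + r)%:R ^+ 2 + c -
      (A * m%:R `^ gamma + B * m%:R ^+ 2 + c))| =
  \sum_(1 <= r < Y) `|corr_sum gamma A (2 * B * r%:R) (B * r%:R ^+ 2) r a (b - r)|.
  apply: eq_bigr => r _; congr `|_|; apply: eq_bigr => m _; congr ec.
  by rewrite natrD; ring.
apply: ler_pM.
- by rewrite divr_ge0.
- by rewrite addr_ge0 // mulr_ge0 // sumr_ge0.
- by rewrite ler_pM2r ?invr_gt0 // natrD; lra.
- by rewrite lerD2r.
Qed.

(** * Diophantine approximation *)

(* The last clause, minimality of the denominator, plays the part of coprimality. *)
Definition good_approx (R : realType) (th : R) (a : int) (q : nat) : Prop :=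
  [/\ (0 < q)%N, `|th - a%:~R / q%:R| <= q%:R ^- 2 &
      forall (j : nat) (m : int), (0 < j < q)%N -> a * j%:Z != m * q%:Z].

(** Pigeonhole: Q + 1 fractional parts fall into Q boxes of length 1 / Q. *)
Lemma dirichlet (R : realType) (th : R) (Q : nat) : (0 < Q)%N ->
  exists (q : nat) (a : int), (0 < q <= Q)%N /\ `|q%:R * th - a%:~R| <= Q%:R^-1.
Proof.
move=> Q0; have Qp : 0 < Q%:R :> R by rewrite ltr0n.
pose fr (n : nat) : R := n%:R * th - (Num.floor (n%:R * th))%:~R.
have fr0 n : 0 <= fr n by rewrite subr_ge0 floor_le.
have fr1 n : fr n < 1.
  by have := lt_succ_floor (n%:R * th); rewrite /fr intrD; lra.
have kb n : (Num.trunc (Q%:R * fr n) < Q)%N.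
  rewrite truncn_lt_nat; last by rewrite mulr_ge0.
  by rewrite gtr_pMr.
pose f (i : 'I_Q.+1) := Ordinal (kb i).
have /injectivePn [x [y xy e]] : ~~ injectiveb f.
  apply/negP => /injectiveP /leq_card; by rewrite !card_ord ltnn.
wlog lt : x y xy e / (x < y)%N => [hw|].
  case: (ltngtP x y) => [h|h|h]; [exact: (hw x y)| |].
    by apply: (hw y x) => //; rewrite eq_sym.
  by move: xy; rewrite -val_eqE /= h eqxx.
exists (y - x)%N, (Num.floor (y%:R * th) - Num.floor (x%:R * th)); split.
  by have := ltn_ord y; lia.
have {}e : Num.trunc (Q%:R * fr x) = Num.trunc (Q%:R * fr y) by case: e.
have /andP[x1 x2] := truncn_itv (mulr_ge0 (ler0n R Q) (fr0 x)).
have /andP[y1 y2] := truncn_itv (mulr_ge0 (ler0n R Q) (fr0 y)).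
rewrite natrB ?(ltnW lt) // intrB.
have -> : (y%:R - x%:R) * th - ((Num.floor (y%:R * th))%:~R - (Num.floor (x%:R * th))%:~R) = fr y - fr x.
  by rewrite /fr; ring.
rewrite -[leRHS]mul1r ler_pdivlMr // -[X in _ * X](gtr0_norm Qp) -normrM.
rewrite -e in y1 y2; rewrite -natr1 in x2 y2.
by rewrite ler_norml mulrBl !(mulrC _ Q%:R); apply/andP; split; lra.
Qed.

Lemma irrational_nd_gt0 (R : realType) (th : R) (B : nat) :
  (forall (n : nat) (m : int), (0 < n)%N -> n%:R * th != m%:~R) ->
  exists2 e : R, 0 < e & forall (n : nat) (m : int), (0 < n <= B)%N -> e <= `|n%:R * th - m%:~R|.
Proof.
move=> irr; elim: B => [|B [e e0 he]]; first by exists 1 => // n m; lia.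
exists (Num.min e (nd (B.+1%:R * th))).
  rewrite lt_min e0 /=; have [m -> _] := nd_ex (B.+1%:R * th).
  by rewrite normr_gt0 subr_eq0 irr.
move=> n m /andP[n0]; rewrite leq_eqVlt => /predU1P[->|nB].
  by rewrite ge_min nd_min orbT.
by rewrite ge_min he // n0.
Qed.

(** q is the least positive denominator with error at most 1 / Q. If a j = m q with 0 < j < q, then
    m / j is the same fraction and j would do as well. Irrationality keeps the errors of all
    denominators up to B above some e, so Q > 1 / e forces q > B. *)
Lemma good_approx_large (R : realType) (th : R) (B : nat) :
  (forall (n : nat) (m : int), (0 < n)%N -> n%:R * th != m%:~R) ->
  exists q a, (B < q)%N /\ good_approx th a q.
Proof.
move=> irr; have [e e0 he] := irrational_nd_gt0 B irr.
pose Q := (Num.trunc (e^-1)).+1.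
have Qe : Q%:R^-1 < e.
  by rewrite invf_plt ?posrE ?ltr0n //; exact: truncnS_gt.
have ex : exists q, (0 < q)%N && `[< exists a : int, `|q%:R * th - a%:~R| <= Q%:R^-1 >].
  by have [q [a [/andP[q0 _] h]]] := @dirichlet R th Q isT; exists q; rewrite q0; apply/asboolP; exists a.
case: (ex_minnP ex) => q /andP[q0 /asboolP[a ha]] qmin.
have qQ : (q <= Q)%N.
  have [q' [a' [/andP[q0' qQ'] h]]] := @dirichlet R th Q isT.
  by apply: leq_trans qQ'; apply: qmin; rewrite q0' /=; apply/asboolP; exists a'.
have qp : 0 < q%:R :> R by rewrite ltr0n.
have ea : `|th - a%:~R / q%:R| = `|q%:R * th - a%:~R| / q%:R.
  have -> : th - a%:~R / q%:R = (q%:R * th - a%:~R) / q%:R by field; rewrite gt_eqF.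
  by rewrite normf_div (gtr0_norm qp).
exists q, a; split.
  rewrite ltnNge; apply/negP => qB.
  by have := he q a; rewrite q0 qB => /(_ isT); move: ha Qe; lra.
split=> //.
  rewrite ea expr2 invfM ler_wpM2r ?invr_ge0 //.
  by apply: le_trans ha _; rewrite lef_pV2 ?posrE ?ltr0n // ler_nat.
move=> j m /andP[j0 jq]; apply/eqP => E.
have jp : 0 < j%:R :> R by rewrite ltr0n.
have ER : a%:~R * j%:R = m%:~R * q%:R :> R by have := congr1 (fun z : int => z%:~R : R) E; rewrite !intrM.
have : (q <= j)%N; last by rewrite leqNgt jq.
apply: qmin; rewrite j0; apply/asboolP; exists m.
have -> : j%:R * th - m%:~R = (j%:R / q%:R) * (q%:R * th - a%:~R).
  have -> : m%:~R = a%:~R * j%:R / q%:R :> R by rewrite ER mulfK // gt_eqF.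
  by field; rewrite gt_eqF.
rewrite normrM (le_trans _ ha) // -[leRHS]mul1r ler_wpM2r // ger0_norm ?divr_ge0 //.
by rewrite ler_pdivrMr // mul1r ler_nat ltnW.
Qed.

(** The rational j a / q is at least 1 / q away from the integers, and replacing it by j th costs at
    most j / q^2 <= 1 / (2 q). *)
Lemma good_approx_sep (R : realType) (th : R) (a : int) (q j : nat) :
  good_approx th a q -> (0 < j)%N -> (j.*2 <= q)%N -> (2 * q%:R)^-1 <= nd (j%:R * th).
Proof.
case=> q0 h1 h2 j0 jq; have qp : 0 < q%:R :> R by rewrite ltr0n.
have [m -> _] := nd_ex (j%:R * th).
have jp : 0 < j%:R :> R by rewrite ltr0n.
have j2 : 2 * j%:R <= q%:R :> R by rewrite -natrM ler_nat mul2n.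
have k1 : q%:R^-1 <= `|j%:R * (a%:~R / q%:R) - m%:~R| :> R.
  have -> : j%:R * (a%:~R / q%:R) - m%:~R = (a * j%:Z - m * q%:Z)%:~R / q%:R :> R.
    by rewrite intrB !intrM; field; rewrite gt_eqF.
  rewrite normf_div (gtr0_norm qp) -[leLHS]mul1r ler_wpM2r ?invr_ge0 // -intr_norm -[1]/(1%:~R) ler_int.
  have : a * j%:Z != m * q%:Z by apply: h2; lia.
  by lia.
have k2 : `|j%:R * (th - a%:~R / q%:R)| <= (2 * q%:R)^-1.
  rewrite normrM (gtr0_norm jp).
  apply: le_trans (_ : j%:R * q%:R ^- 2 <= _); first by rewrite ler_pM2l.
  rewrite ler_pdivrMr ?exprn_gt0 // invfM expr2 -mulrA mulKf ?gt_eqF //; lra.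
have -> : j%:R * th - m%:~R = (j%:R * (a%:~R / q%:R) - m%:~R) + j%:R * (th - a%:~R / q%:R) by ring.
have k3 : q%:R^-1 = (2 * q%:R)^-1 + (2 * q%:R)^-1 :> R by field; rewrite gt_eqF.
have := lerB_normD (j%:R * (a%:~R / q%:R) - m%:~R) (j%:R * (th - a%:~R / q%:R)).
by lra.
Qed.

(** Two indices of a block differ by at most q / 2, so their signed remainders are 1 / (2 q) apart
    by [good_approx_sep]. Rounding 2 q (e n + eta) down is therefore injective, with values between
    0 and 4 q eta. *)
Lemma count_close_block (R : realType) (th : R) (a : int) (q n0 : nat) (eta : R) :
  good_approx th a q -> 0 <= eta ->
  \sum_(n0 <= n < n0 + q.+1./2) (nd (n%:R * th) <= eta)%R%:R <= 1 + 4 * q%:R * eta.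
Proof.
move=> ga e0; have [q0 _ _] := ga; have qp : 0 < q%:R :> R by rewrite ltr0n.
pose s := [seq n <- index_iota n0 (n0 + q.+1./2) | nd (n%:R * th) <= eta].
have -> : \sum_(n0 <= n < n0 + q.+1./2) (nd (n%:R * th) <= eta)%R%:R = (size s)%:R :> R.
  rewrite /s size_filter -sum1_count natr_sum [RHS]big_mkcond /=.
  by apply: eq_bigr => n _; case: (nd _ <= _).
pose e (n : nat) : R := n%:R * th - (Num.floor (n%:R * th + 2^-1))%:~R.
have hs n : n \in s -> - eta <= e n <= eta.
  by rewrite mem_filter => /andP[h _]; rewrite -ler_norml.
pose key n := Num.trunc (2 * q%:R * (e n + eta)).
have hk n : n \in s -> (key n)%:R <= 2 * q%:R * (e n + eta) < (key n).+1%:R.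
  by move=> /hs /andP[h1 h2]; apply: truncn_itv; rewrite !mulr_ge0 //; lra.
have inj : {in s &, injective key}.
  move=> x y; wlog xy : x y / (x < y)%N => [hw xs ys exy|].
    case: (ltngtP x y) => // h; first exact: hw.
    by apply/esym/hw.
  move=> xs ys exy; exfalso.
  have /andP[x1 x2] := hk x xs; have /andP[y1 y2] := hk y ys.
  have d : ((y - x).*2 <= q)%N.
    move: xs ys; rewrite !mem_filter !mem_index_iota; clear -xy.
    by move=> /andP[_ h1] /andP[_ h2]; move: h1 h2; rewrite -divn2; lia.
  have := good_approx_sep ga _ d; rewrite subn_gt0 => /(_ xy).
  have [m em] : exists m : int, (y - x)%:R * th - m%:~R = e y - e x.
    exists (Num.floor (y%:R * th + 2^-1) - Num.floor (x%:R * th + 2^-1)).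
    by rewrite natrB ?(ltnW xy) // intrB /e; ring.
  have := nd_min ((y - x)%:R * th) m; rewrite em => k1 k2.
  have k3 : (2 * q%:R)^-1 <= `|e y - e x| by lra.
  have : 1 <= `|2 * q%:R * (e y - e x)|.
    have qq : 0 < 2 * q%:R :> R by rewrite mulr_gt0.
    by rewrite normrM (gtr0_norm qq) -ler_pdivrMl // mulr1.
  rewrite -exy in y1 y2; rewrite -natr1 in x2 y2.
  by rewrite ler_normr => /orP[]; lra.
have us : uniq (map key s).
  by rewrite map_inj_in_uniq // filter_uniq // iota_uniq.
have sub : {subset map key s <= iota 0 (Num.trunc (4 * q%:R * eta)).+1}.
  move=> _ /mapP[n ns ->]; rewrite mem_iota add0n ltnS /=.
  apply: le_truncn; have /andP[h1 h2] := hs n ns.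
  have : 2 * q%:R * (e n + eta) <= 2 * q%:R * (2 * eta) by rewrite ler_wpM2l ?mulr_ge0 //; lra.
  by lra.
have := uniq_leq_size us sub; rewrite size_map size_iota => h.
apply: le_trans (_ : (Num.trunc (4 * q%:R * eta)).+1%:R <= _); first by rewrite ler_nat.
by rewrite -natr1 addrC lerD2l truncn_le !mulr_ge0.
Qed.

Lemma count_close (R : realType) (th : R) (a : int) (q X : nat) (eta : R) :
  good_approx th a q -> 0 <= eta ->
  \sum_(1 <= n < X.+1) (nd (n%:R * th) <= eta)%R%:R <=
    (2 * X%:R / q%:R + 1) * (1 + 4 * q%:R * eta).
Proof.
move=> ga e0; have [q0 _ _] := ga; have qp : 0 < q%:R :> R by rewrite ltr0n.
pose l := q.+1./2; have l0 : (0 < l)%N by rewrite /l; move: q0; clear; rewrite -divn2; lia.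
have hk k : \sum_(1 <= n < 1 + k * l) (nd (n%:R * th) <= eta)%R%:R <= k%:R * (1 + 4 * q%:R * eta) :> R.
  elim: k => [|k IH]; first by rewrite mul0n addn0 big_geq // mul0r.
  rewrite (@big_cat_nat _ _ _ (1 + k * l)) /=; [|lia|lia].
  rewrite -natr1 mulrDl mul1r lerD //.
  have -> : (1 + k.+1 * l = 1 + k * l + l)%N by rewrite mulSn; lia.
  exact: count_close_block ga e0.
pose k := (X %/ l).+1.
have Xk : (X.+1 <= 1 + k * l)%N by rewrite add1n ltnS ltnW // /k ltn_ceil.
apply: le_trans (_ : k%:R * (1 + 4 * q%:R * eta) <= _).
  apply: le_trans (hk k); rewrite [leRHS](@big_cat_nat _ _ _ X.+1) //= lerDl.
  exact: sumr_ge0.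
rewrite ler_wpM2r //; first by rewrite addr_ge0 // !mulr_ge0.
rewrite /k -natr1 lerD2r.
have lq : q%:R <= 2 * l%:R :> R by rewrite -natrM ler_nat /l; clear; rewrite -divn2; lia.
rewrite ler_pdivlMr //.
have h : (X %/ l)%:R * l%:R <= X%:R :> R by rewrite -natrM ler_nat leq_trunc_div.
have p : 0 <= (X %/ l)%:R :> R by [].
nra.
Qed.

(** * Dyadic layers of slopes close to an integer *)

Lemma ex_pow4 (R : realType) (x : R) : 1 <= x -> exists J : nat, 4 ^+ J <= x < 4 ^+ J.+1.
Proof.
move=> x1.
have ex : exists n : nat, x < 4 ^+ n.
  exists (Num.trunc x).+1; apply: lt_trans (truncnS_gt x) _.
  by rewrite -natrX ltr_nat ltn_expl.
case: (ex_minnP ex) => [[|J]]; first by rewrite expr0; lra.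
move=> h hmin; exists J; rewrite h andbT leNgt; apply/negP => h'.
by have := hmin _ h'; rewrite ltnn.
Qed.

(* Dyadic majorant of a quantity bounded both by [32 * M] and by
   [c * sqrt (M / nd (n * th))], linear in indicators of [nd (n * th)] being small. *)
Definition layer (R : realType) (th eta c M : R) (J n : nat) : R :=
  \sum_(j < J) (nd (n%:R * th) <= eta / 4 ^+ j)%R%:R * (2 ^+ j.+1 * (c * Num.sqrt (M / eta)))
  + (nd (n%:R * th) <= eta / 4 ^+ J)%R%:R * (32 * M).

Lemma layer_ge0 (R : realType) (th eta c M : R) (J n : nat) :
  0 <= c -> 0 <= M -> 0 <= layer th eta c M J n.
Proof.
move=> c0 M0; rewrite addr_ge0 ?mulr_ge0 // sumr_ge0 // => j _.
by rewrite !mulr_ge0 ?sqrtr_ge0 // exprn_ge0.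
Qed.

(** Below [eta], take the first j for which the distance exceeds eta / 4^(j+1). Then T^2 <= c^2 M /
    nd < 4^(j+1) c^2 M / eta, which is layer j. If no j < J qualifies, the last layer holds the
    trivial bound 32 M. *)
Lemma le_layer (R : realType) (th eta c M T : R) (J n : nat) :
  0 < eta -> 0 <= c -> 0 < M -> 0 <= T -> T <= 32 * M ->
  nd (n%:R * th) * T ^+ 2 <= c ^+ 2 * M ->
  (eta < nd (n%:R * th) -> T <= 10 / eta) ->
  T <= 10 / eta + layer th eta c M J n.
Proof.
move=> e0 c0 M0 T0 TM hT2 hT1.
have l0 := layer_ge0 th eta J n c0 (ltW M0).
have p0 : 0 <= 10 / eta by rewrite divr_ge0 // ltW.
set t := nd _ in hT2 hT1.
case: (ltP eta t) => h1; first by have := hT1 h1; lra.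
case: (leP t (eta / 4 ^+ J)) => h2.
  rewrite /layer -/t h2 mul1r.
  apply: le_trans TM _; rewrite addrA lerDr addr_ge0 // sumr_ge0 // => j _.
  by rewrite !mulr_ge0 ?sqrtr_ge0 // exprn_ge0.
have ex : exists i : nat, eta / 4 ^+ i < t by exists J.
case: (ex_minnP ex) => [[|j]]; first by rewrite expr0 divr1; lra.
move=> hj hmin.
have jJ : (j < J)%N by exact: hmin.
have tj : t <= eta / 4 ^+ j.
  by rewrite leNgt; apply/negP => /hmin; rewrite ltnn.
have t0 : 0 < t by apply: le_lt_trans hj; rewrite divr_ge0 ?exprn_ge0 // ltW.
have q0 : 0 <= 2 ^+ j.+1 * (c * Num.sqrt (M / eta)).
  by rewrite !mulr_ge0 ?sqrtr_ge0 // exprn_ge0.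
have k : T <= 2 ^+ j.+1 * (c * Num.sqrt (M / eta)).
  rewrite -(@ler_pXn2r _ 2) ?nnegrE // !exprMn sqr_sqrtr; last by rewrite divr_ge0 // ltW.
  have -> : (2 ^+ j.+1) ^+ 2 = 4 ^+ j.+1 :> R.
    by rewrite -exprM mulnC exprM; congr (_ ^+ _); ring.
  rewrite -(ler_pM2l t0); apply: le_trans hT2 _.
  move: hj; rewrite ltr_pdivrMr ?exprn_gt0 // => hj.
  have -> : t * (4 ^+ j.+1 * (c ^+ 2 * (M / eta))) = (c ^+ 2 * M) * (t * 4 ^+ j.+1 / eta).
    by field; rewrite gt_eqF.
  rewrite -[leLHS]mulr1 ler_wpM2l ?mulr_ge0 ?sqr_ge0 ?(ltW M0) //.
  by rewrite ler_pdivlMr // mul1r ltW.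
apply: le_trans k _; rewrite /layer -/t (bigD1 (Ordinal jJ)) //= tj mul1r.
set A := 2 ^+ j.+1 * _ in q0 *; set B := \sum_(_ | _) _; set C := _ * (32 * M).
have B0 : 0 <= B.
  by apply: sumr_ge0 => i _; rewrite !mulr_ge0 ?sqrtr_ge0 // exprn_ge0.
have C0 : 0 <= C by rewrite !mulr_ge0 // ltW.
lra.
Qed.

Lemma sum_pow2_le (R : realType) (J : nat) : \sum_(j < J) 2 ^+ j.+1 <= 2 * 2 ^+ J :> R.
Proof.
have : \sum_(j < J) 2 ^+ j.+1 + 2 = 2 * 2 ^+ J :> R.
  elim: J => [|J IH]; first by rewrite big_ord0 expr0; ring.
  by rewrite big_ord_recr /= addrAC IH !exprS; ring.
by lra.
Qed.

Lemma sum_pow24_le (R : realType) (J : nat) : \sum_(j < J) 2 ^+ j.+1 / 4 ^+ j <= 4 :> R.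
Proof.
have : \sum_(j < J) 2 ^+ j.+1 / 4 ^+ j + 4 / 2 ^+ J = 4 :> R.
  elim: J => [|J IH]; first by rewrite big_ord0 expr0; field.
  rewrite big_ord_recr /= -[RHS]IH -addrA; congr (_ + _).
  have -> : 4 ^+ J = 2 ^+ J * 2 ^+ J :> R by rewrite -expr2 -exprM mulnC exprM; congr (_ ^+ _); ring.
  rewrite !exprS; field; by rewrite expf_neq0.
have : 0 <= 4 / 2 ^+ J :> R by rewrite divr_ge0 // exprn_ge0.
by lra.
Qed.

(** By [count_close] layer j has at most (2 X / q + 1)(1 + 4 q eta / 4^j) members, each of weight
    about 2^j c r with r = sqrt(M / eta). The 1 sums to 2^J c r <= c M and the other part to q eta c
    r = q c w, where w = sqrt(M eta). Stopping at 4^J close to M eta keeps the last layer of size M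
    + q. *)
Lemma sum_layer (R : realType) (th eta c M : R) (a : int) (q X J : nat) :
  good_approx th a q -> 0 < eta -> 32 <= c -> 1 <= M ->
  4 ^+ J <= M * eta < 4 ^+ J.+1 ->
  \sum_(1 <= n < X.+1) layer th eta c M J n <=
  (2 * X%:R / q%:R + 1) * (32 * c * (M + q%:R * Num.sqrt (M * eta))).
Proof.
move=> ga e0 c32 M1 /andP[J1 J2].
have [q0 _ _] := ga; have qp : 1 <= q%:R :> R by rewrite ler1n.
set Bk := 2 * X%:R / q%:R + 1.
have Bk0 : 0 <= Bk by rewrite addr_ge0 // divr_ge0 // mulr_ge0.
set w := Num.sqrt (M * eta).
have Me : 1 <= M * eta by apply: le_trans J1; rewrite exprn_ege1 // ler1n.
have w2 : w ^+ 2 = M * eta by rewrite sqr_sqrtr //; lra.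
have w0 : 0 <= w by exact: sqrtr_ge0.
have w1 : 1 <= w by rewrite -(@ler_pXn2r _ 2) ?nnegrE // expr1n w2.
set r := Num.sqrt (M / eta).
have r0 : 0 <= r by exact: sqrtr_ge0.
have wr : w * r = M.
  rewrite /w /r -sqrtrM ?(le_trans _ Me) //.
  have -> : M * eta * (M / eta) = M ^+ 2 by field; rewrite gt_eqF.
  by rewrite sqrtr_sqr ger0_norm //; lra.
have er : eta * r = w.
  apply: (mulfI (_ : w != 0)); first by rewrite gt_eqF //; lra.
  by rewrite mulrCA wr -expr2 w2 mulrC.
have J2w : 2 ^+ J <= w.
  rewrite -(@ler_pXn2r _ 2) ?nnegrE // ?exprn_ge0 // w2; apply: le_trans J1.
  by rewrite -exprM mulnC exprM; apply: le_of_eq; congr (_ ^+ _); ring.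
have p4 j : 0 < 4 ^+ j :> R by rewrite exprn_gt0.
rewrite /layer big_split /= exchange_big /=.
have h1 : \sum_(j < J) \sum_(1 <= n < X.+1) (nd (n%:R * th) <= eta / 4 ^+ j)%R%:R * (2 ^+ j.+1 * (c * r))
   <= Bk * (2 * w * (c * r) + 16 * q%:R * (c * w)).
  apply: (@le_trans _ _ (\sum_(j < J) Bk * (c * r) * (2 ^+ j.+1 + 4 * q%:R * eta * (2 ^+ j.+1 / 4 ^+ j)))).
    apply: ler_sum => j _; rewrite -mulr_suml.
    have := @count_close R th a q X (eta / 4 ^+ j) ga (divr_ge0 (ltW e0) (ltW (p4 j))).
    rewrite -/Bk => h.
    have p : 0 <= 2 ^+ j.+1 * (c * r) by rewrite !mulr_ge0 ?exprn_ge0 //; lra.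
    apply: le_trans (ler_wpM2r p h) _; apply: le_of_eq; field; exact: lt0r_neq0.
  rewrite -mulr_sumr big_split /= -mulr_sumr -mulrA ler_wpM2l //.
  have -> : 2 * w * (c * r) + 16 * q%:R * (c * w) = (c * r) * (2 * w + 4 * q%:R * eta * 4).
    have -> : 16 * q%:R * (c * w) = 16 * q%:R * c * (eta * r) by rewrite er; ring.
    by ring.
  rewrite ler_wpM2l ?mulr_ge0 //; first lra.
  rewrite lerD //.
    by apply: le_trans (sum_pow2_le R J) _; rewrite ler_pM2l.
  by rewrite ler_wpM2l ?sum_pow24_le // !mulr_ge0 //; lra.
have h2 : \sum_(1 <= n < X.+1) (nd (n%:R * th) <= eta / 4 ^+ J)%R%:R * (32 * M)
   <= Bk * (32 * M + 512 * q%:R).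
  rewrite -mulr_suml.
  have := @count_close R th a q X (eta / 4 ^+ J) ga (divr_ge0 (ltW e0) (ltW (p4 J))).
  rewrite -/Bk => h.
  have p : 0 <= 32 * M by lra.
  apply: le_trans (ler_wpM2r p h) _; rewrite -[leLHS]mulrA ler_wpM2l //.
  rewrite [leLHS]mulrDl mul1r lerD2l.
  have : M * eta / 4 ^+ J <= 4 by rewrite ler_pdivrMr // -exprS ltW.
  have -> : 4 * q%:R * (eta / 4 ^+ J) * (32 * M) = 128 * q%:R * (M * eta / 4 ^+ J) by ring.
  have -> : 512 * q%:R = 128 * q%:R * 4 :> R by ring.
  by move=> h'; rewrite ler_wpM2l //; lra.
apply: le_trans (lerD h1 h2) _; rewrite -mulrDr ler_wpM2l //.
have -> : 2 * w * (c * r) = 2 * c * (w * r) by ring.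
rewrite wr.
have -> : 32 * c * (M + q%:R * w) = 32 * c * M + 32 * c * (q%:R * w) by ring.
have -> : 16 * q%:R * (c * w) = 16 * c * (q%:R * w) by ring.
have qw : q%:R <= q%:R * w by rewrite ler_peMr //; lra.
have : 0 <= (c - 32) * (q%:R * w) by rewrite mulr_ge0 //; lra.
have : 0 <= (c - 32) * M by rewrite mulr_ge0 //; lra.
by lra.
Qed.

(** * Linear sums and averages over pairs *)

(** An integer n is a product x y in at most as many ways as it has divisors x. *)
Lemma sum_mult_divisors (R : realType) (f : nat -> R) (A B D : nat) :
  (forall n, 0 <= f n) -> (forall n, (0 < n <= A * B)%N -> (size (divisors n) <= D)%N) ->
  \sum_(1 <= x < A.+1) \sum_(1 <= y < B.+1) f (x * y)%N <=
  D%:R * \sum_(1 <= n < (A * B).+1) f n.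
Proof.
move=> f0 hD.
have e x y : (x \in index_iota 1 A.+1) -> (y \in index_iota 1 B.+1) ->
    f (x * y)%N = \sum_(1 <= n < (A * B).+1) (n == x * y)%N%:R * f n.
  rewrite !mem_index_iota !ltnS => /andP[x0 xA] /andP[y0 yB].
  have h : (x * y)%N \in index_iota 1 (A * B).+1.
    by rewrite mem_index_iota muln_gt0 x0 y0 ltnS leq_mul.
  rewrite (bigD1_seq (x * y)%N) ?iota_uniq //= eqxx mul1r big1 ?addr0 // => i /negPf->.
  by rewrite mul0r.
rewrite (eq_big_seq (fun x => \sum_(1 <= n < (A * B).+1) \sum_(1 <= y < B.+1) (n == x * y)%N%:R * f n)).
  rewrite exchange_big mulr_sumr /=; apply: ler_sum_nat => n /andP[n0 nAB].
  rewrite -(eq_bigr _ (fun i _ => mulr_suml _ _ _ _)) -mulr_suml ler_wpM2r //.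
  apply: le_trans (_ : (size (divisors n))%:R <= _); last by rewrite ler_nat hD // n0.
  apply: le_trans (_ : \sum_(1 <= x < A.+1) (x \in divisors n)%:R <= _).
    apply: ler_sum_nat => x /andP[x0 _]; rewrite -dvdn_divisors //.
    case: (boolP (x %| n)%N) => xn; last first.
      rewrite big1 // => y _; case: eqP => // ee; by move: xn; rewrite ee dvdn_mulr.
    apply: le_trans (_ : \sum_(1 <= y < B.+1) (y == n %/ x)%N%:R <= _).
      apply: ler_sum => y _; case: eqP => // ee; by rewrite ee mulKn // eqxx.
    apply: le_trans (_ : \sum_(0 <= y < B.+1) (y == n %/ x)%N%:R <= _).
      by rewrite [leRHS]big_nat_recl // big_add1 /= lerDr.
    by rewrite big_mkord sum_indic_le.
  rewrite -natr_sum ler_nat.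
  have -> : (\sum_(1 <= x < A.+1) (x \in divisors n) =
      size [seq x <- index_iota 1 A.+1 | x \in divisors n])%N.
    rewrite size_filter -sum1_count [RHS]big_mkcond /=.
    by apply: eq_bigr => x _; case: (_ \in _).
  apply: uniq_leq_size; first by rewrite filter_uniq // iota_uniq.
  by move=> x; rewrite mem_filter => /andP[].
move=> x xA; rewrite exchange_big /=; apply: eq_big_seq => y yB; exact: e.
Qed.

Lemma corr_sum_geq (R : realType) (gamma A t c : R) (r a b : nat) :
  (b <= a)%N -> corr_sum gamma A t c r a b = 0.
Proof. by move=> h; rewrite /corr_sum big_geq. Qed.

Lemma corr_sum_far (R : realType) (gamma M A t c nus : R) (r a b : nat) :
  0 < gamma < 1 -> 1 <= M -> 0 <= A -> r%:R <= M ->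
  (forall n, (a <= n < b)%N -> M <= n%:R <= 32 * M) -> (b - a)%:R <= 32 * M ->
  A * r%:R * M `^ (gamma - 2) <= nus -> 2 * nus <= nd t ->
  nd t * `|corr_sum gamma A t c r a (b - r)| <= 10.
Proof.
move=> g01 M1 A0 rM hM hab hn ht.
case: (leqP a (b - r)) => ab; last by rewrite corr_sum_geq ?(ltnW ab) // normr0 mulr0.
have [||h _ _] := @corr_sum_bounds R gamma M A t c r a (b - r) g01 M1 A0 rM ab.
- by move=> n /andP[h1 h2]; apply: hM; rewrite h1 (leq_trans h2) // leq_subr.
- by apply: le_trans hab; rewrite ler_nat leq_sub2r // leq_subr.
apply: h; apply: le_trans ht; rewrite ler_pM2l //; apply: le_trans hn.
rewrite ler_wpM2l ?mulr_ge0 // -[leRHS]mul1r ler_wpM2r ?powR_ge0 //.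
by case/andP: g01 => ? ?; nra.
Qed.

(** The square of 256 * 216 is 2048 * 32 * 36^3, a perfect square just above the constant 2048 *
    35^3 * 32 of [corr_sum_bounds]; its root serves as [c] in [layer]. The factor gamma (1 - gamma)
    <= 1 of nu is dropped in [nus]. *)
Lemma corr_sum_near (R : realType) (gamma M A t c nus : R) (r a b : nat) :
  0 < gamma < 1 -> 1 <= M -> 0 <= A -> r%:R <= M ->
  (forall n, (a <= n < b)%N -> M <= n%:R <= 32 * M) -> (b - a)%:R <= 32 * M ->
  A * r%:R * M `^ (gamma - 2) <= nus -> nus <= 8^-1 ->
  nd t * corr_sum gamma A t c r a (b - r) ^+ 2 <= (256 * 216) ^+ 2 * M.
Proof.
move=> g01 M1 A0 rM hM hab hn ht.
case: (leqP a (b - r)) => ab; last first.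
  have M0 : 0 <= M by exact: le_trans M1.
  by rewrite corr_sum_geq ?(ltnW ab) // expr0n mulr0 mulr_ge0 ?M0 ?exprn_ge0 ?mulr_ge0 ?ler0n.
have [||_ h _] := @corr_sum_bounds R gamma M A t c r a (b - r) g01 M1 A0 rM ab.
- by move=> n /andP[h1 h2]; apply: hM; rewrite h1 (leq_trans h2) // leq_subr.
- by apply: le_trans hab; rewrite ler_nat leq_sub2r // leq_subr.
apply: le_trans (h _) _; last by lra.
apply: le_trans ht; apply: le_trans hn.
rewrite ler_wpM2l ?mulr_ge0 // -[leRHS]mul1r ler_wpM2r ?powR_ge0 //.
by case/andP: g01 => ? ?; nra.
Qed.

(** The perturbation is proportional to [r], so the Kusmin-Landau bound decays like 1 / r and
    summing over the shifts costs only a harmonic sum. *)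
Lemma corr_sum_zero (R : realType) (gamma M A c nu1 : R) (r a b : nat) :
  0 < gamma < 1 -> 1 <= M -> 0 <= A -> r%:R <= M -> (0 < r)%N ->
  (forall n, (a <= n < b)%N -> M <= n%:R <= 32 * M) -> (b - a)%:R <= 32 * M ->
  A * r%:R * M `^ (gamma - 2) <= 2^-1 -> 0 < nu1 ->
  nu1 <= A * (gamma * (1 - gamma) * M `^ (gamma - 2)) ->
  `|corr_sum gamma A 0 c r a (b - r)| <= 5 * 35 ^+ 2 / nu1 / r%:R.
Proof.
move=> g01 M1 A0 rM r0 hM hab hn n0 hn1.
have rp : 0 < r%:R :> R by rewrite ltr0n.
have c0 : 0 <= 5 * 35 ^+ 2 :> R by rewrite mulr_ge0 // exprn_ge0.
case: (leqP a (b - r)) => ab; last first.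
  by rewrite corr_sum_geq ?(ltnW ab) // normr0 !divr_ge0 // ltW.
have [||_ _ h] := @corr_sum_bounds R gamma M A 0 c r a (b - r) g01 M1 A0 rM ab.
- by move=> n /andP[h1 h2]; apply: hM; rewrite h1 (leq_trans h2) // leq_subr.
- by apply: le_trans hab; rewrite ler_nat leq_sub2r // leq_subr.
have e : A * r%:R * (gamma * (1 - gamma) * M `^ (gamma - 2)) = r%:R * (A * (gamma * (1 - gamma) * M `^ (gamma - 2))) by ring.
have k : r%:R * nu1 <= A * r%:R * (gamma * (1 - gamma) * M `^ (gamma - 2)).
  by rewrite e ler_pM2l.
have k0 : 0 < r%:R * nu1 by rewrite mulr_gt0.
apply: le_trans (h erefl _) _.
  rewrite (lt_le_trans k0 k) /=; apply: le_trans hn.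
  rewrite ler_wpM2l ?mulr_ge0 // -[leRHS]mul1r ler_wpM2r ?powR_ge0 //.
  by case/andP: g01 => ? ?; nra.
have -> : 5 * 35 ^+ 2 / nu1 / r%:R = 5 * 35 ^+ 2 / (r%:R * nu1) by field; rewrite !gt_eqF.
rewrite ler_wpM2l // lef_pV2 ?posrE //.
exact: lt_le_trans k0 k.
Qed.

(** After differencing, a shift whose slope is farther than [eta] from the integers contributes at
    most 10 / eta, and any other shift the trivial 32 M. *)
Lemma type_one_far (R : realType) (gamma M A B c eta : R) (a b Y : nat) :
  0 < gamma < 1 -> 1 <= M -> 0 <= A -> (0 < Y)%N -> Y%:R <= M ->
  (forall n, (a <= n < b)%N -> M <= n%:R <= 32 * M) -> (b - a)%:R <= 32 * M ->
  0 < eta -> 2 * (A * Y%:R * M `^ (gamma - 2)) <= eta ->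
  (\sum_(a <= n < b) ec (A * n%:R `^ gamma + B * n%:R ^+ 2 + c)) ^+ 2 <=
  33 * M / Y%:R * (32 * M + 20 * Y%:R / eta +
    64 * M * \sum_(1 <= r < Y) (nd (2 * B * r%:R) <= eta)%R%:R).
Proof.
move=> g01 M1 A0 Y0 YM hM hab e0 he.
apply: le_trans (weyl_step gamma A B c M1 Y0 YM hab) _.
have Yp : 0 < Y%:R :> R by rewrite ltr0n.
have p : 0 <= 33 * M / Y%:R by rewrite divr_ge0 //; lra.
rewrite ler_wpM2l // -[leRHS]addrA lerD2l.
have -> : 20 * Y%:R / eta + 64 * M * \sum_(1 <= r < Y) (nd (2 * B * r%:R) <= eta)%R%:R =
   2 * (Y%:R * (10 / eta) + \sum_(1 <= r < Y) (nd (2 * B * r%:R) <= eta)%R%:R * (32 * M)).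
  by rewrite -mulr_suml; ring.
rewrite ler_pM2l //.
apply: le_trans (_ : \sum_(1 <= r < Y) (10 / eta + (nd (2 * B * r%:R) <= eta)%R%:R * (32 * M)) <= _).
  apply: ler_sum_nat => r /andP[r0 rY].
  have rY' : r%:R <= Y%:R :> R by rewrite ler_nat ltnW.
  have t0 := corr_trivial gamma A (2 * B * r%:R) (B * r%:R ^+ 2) r a (b - r).
  have t1 : (b - r - a)%:R <= 32 * M by apply: le_trans hab; rewrite ler_nat leq_sub2r // leq_subr.
  have e10 : 0 <= 10 / eta by rewrite divr_ge0 // ltW.
  case: (leP (nd (2 * B * r%:R)) eta) => h; rewrite ?mul1r ?mul0r ?addr0.
    by apply: le_trans t0 _; lra.
  have h0 := lt_trans e0 h.
  have h10 : nd (2 * B * r%:R) * `|corr_sum gamma A (2 * B * r%:R) (B * r%:R ^+ 2) r a (b - r)| <= 10.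
    apply: (@corr_sum_far R gamma M A _ _ (A * Y%:R * M `^ (gamma - 2))) => //; [lra| |lra].
    by rewrite ler_wpM2r ?powR_ge0 // ler_wpM2l.
  rewrite ler_pdivlMr // mulrC; apply: le_trans h10; rewrite ler_wpM2r //; exact: ltW.
rewrite big_split /= lerD2r sumr_const_nat -[leLHS]mulr_natl ler_wpM2r //.
  by rewrite divr_ge0 // ltW.
by rewrite ler_nat leq_subr.
Qed.

Definition harm (R : realType) (n : nat) : R := \sum_(1 <= r < n) r%:R^-1.

Lemma type_one_zero (R : realType) (gamma M A c nu1 : R) (a b Y : nat) :
  0 < gamma < 1 -> 1 <= M -> 0 <= A -> (0 < Y)%N -> Y%:R <= M ->
  (forall n, (a <= n < b)%N -> M <= n%:R <= 32 * M) -> (b - a)%:R <= 32 * M ->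
  A * Y%:R * M `^ (gamma - 2) <= 2^-1 -> 0 < nu1 ->
  nu1 <= A * (gamma * (1 - gamma) * M `^ (gamma - 2)) ->
  (\sum_(a <= n < b) ec (A * n%:R `^ gamma + 0 * n%:R ^+ 2 + c)) ^+ 2 <=
  33 * M / Y%:R * (32 * M + 2 * (5 * 35 ^+ 2 / nu1 * harm R Y)).
Proof.
move=> g01 M1 A0 Y0 YM hM hab hA n0 hn1.
apply: le_trans (weyl_step gamma A 0 c M1 Y0 YM hab) _.
have Yp : 0 < Y%:R :> R by rewrite ltr0n.
have p : 0 <= 33 * M / Y%:R by rewrite divr_ge0 //; lra.
rewrite ler_wpM2l // lerD2l ler_pM2l // /harm mulr_sumr.
apply: ler_sum_nat => r /andP[r0 rY].
have rY' : r%:R <= Y%:R :> R by rewrite ler_nat ltnW.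
rewrite mulr0 mul0r; apply: (@corr_sum_zero R gamma M) => //; first exact: le_trans rY' YM.
by apply: le_trans hA; rewrite ler_wpM2r ?powR_ge0 // ler_wpM2l.
Qed.

(* The final [+ 0] gives the summand the shape expected by [weyl_step]. *)
Definition pair_sum (R : realType) (gamma h beta : R) (N l l' : nat) : R :=
  \sum_((N %/ l').+1 <= m < (16 * N %/ l).+1)
    ec (h * (l%:R `^ gamma - l'%:R `^ gamma) * m%:R `^ gamma
        + beta * (l%:R ^+ 2 - l'%:R ^+ 2) * m%:R ^+ 2 + 0).

(** N < l' m with l' < 2 L bounds m below by N / (2 L), and l m <= 16 N with l > L bounds it above
    by 16 N / L; the ratio is 32. *)
Lemma pair_range (R : realType) (N L l l' : nat) (M := N%:R / (2 * L%:R) : R) :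
  (0 < L)%N -> (L < l')%N -> (l' < l)%N -> (l <= L.*2)%N ->
  (forall m, ((N %/ l').+1 <= m < (16 * N %/ l).+1)%N -> M <= m%:R <= 32 * M) /\
  ((16 * N %/ l).+1 - (N %/ l').+1)%:R <= 32 * M.
Proof.
move=> L0 Ll' ll' lL.
have Lp : 0 < L%:R :> R by rewrite ltr0n.
have up m : (m <= 16 * N %/ l)%N -> m%:R <= 32 * M.
  move=> h; have -> : 32 * M = 16 * N%:R / L%:R by rewrite /M; field; rewrite gt_eqF.
  rewrite ler_pdivlMr // -!natrM ler_nat.
  apply: leq_trans (leq_trunc_div (16 * N) l).
  by rewrite leq_mul // ltnW // (ltn_trans Ll').
split=> [m /andP[h1 h2]|]; last by apply: up; rewrite subSS leq_subr.
rewrite up // andbT /M ler_pdivrMr ?mulr_gt0 // -!natrM ler_nat.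
have : (N < (N %/ l').+1 * l')%N by rewrite ltn_ceil // (leq_trans _ Ll').
move=> h; apply: ltnW; apply: leq_trans h _.
by rewrite leq_mul // mul2n ltnW // (leq_trans ll').
Qed.

Lemma amplitude_bounds (R : realType) (gamma : R) (L l l' : nat) :
  0 < gamma < 1 -> (0 < L)%N -> (L < l')%N -> (l' < l)%N -> (l <= L.*2)%N ->
  (l - l')%:R * (gamma * (2 * L%:R) `^ (gamma - 1)) <= l%:R `^ gamma - l'%:R `^ gamma
    <= (l - l')%:R * L%:R `^ (gamma - 1).
Proof.
move=> /andP[g0 g1] L0 Ll' ll' lL.
have Lp : 0 < L%:R :> R by rewrite ltr0n.
have l'p : 0 < l'%:R :> R by rewrite ltr0n (leq_trans _ Ll').
have [z /andP[z1 z2]] := powR_diff1 gamma l'p (ler0n R (l - l')).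
have el : l'%:R + (l - l')%:R = l%:R :> R by rewrite -natrD subnKC // ltnW.
rewrite el in z2 * => ->.
have Lz : L%:R <= z by apply: le_trans z1; rewrite ler_nat ltnW.
have z2L : z <= 2 * L%:R by apply: le_trans z2 _; rewrite -natrM ler_nat mul2n.
have p1 : z `^ (gamma - 1) <= L%:R `^ (gamma - 1) by apply: powR_antitone => //; lra.
have p2 : (2 * L%:R) `^ (gamma - 1) <= z `^ (gamma - 1).
  by apply: powR_antitone => //; lra.
have p3 := powR_ge0 z (gamma - 1).
apply/andP; split; rewrite ler_wpM2l // ?ler_pM2l //.
by nra.
Qed.

Lemma pair_sum_weyl (R : realType) (gamma h beta : R) (N L Y l l' : nat)
    (M := N%:R / (2 * L%:R) : R) :
  1 <= M -> (0 < Y)%N -> Y%:R <= M ->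
  (0 < L)%N -> (L < l')%N -> (l' < l)%N -> (l <= L.*2)%N ->
  pair_sum gamma h beta N l l' ^+ 2 <= 33 * M / Y%:R * (32 * M + 2 * \sum_(1 <= r < Y)
   `|corr_sum gamma (h * (l%:R `^ gamma - l'%:R `^ gamma))
      (2 * (beta * (l%:R ^+ 2 - l'%:R ^+ 2)) * r%:R)
      (beta * (l%:R ^+ 2 - l'%:R ^+ 2) * r%:R ^+ 2) r (N %/ l').+1 ((16 * N %/ l).+1 - r)|).
Proof.
move=> M1 Y0 YM L0 Ll' ll' lL.
by apply: weyl_step => //; exact: (pair_range _ _ L0 Ll' ll' lL).2.
Qed.

(** The slope is 2 beta times r (l - l')(l + l'). For beta = k alpha it is the multiple k r (l -
    l')(l + l') of th = 2 alpha, so [layer] is evaluated at that integer whatever k is. *)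
Lemma pair_corr_far (R : realType) (gamma h beta th eta : R) (k N L Q Y J l l' r : nat)
    (M := N%:R / (2 * L%:R) : R) :
  0 < gamma < 1 -> 0 <= h -> 1 <= M -> (0 < Y)%N -> Y%:R <= M ->
  (0 < L)%N -> (L < l')%N -> (l' < l)%N -> (l <= L.*2)%N -> (l - l' <= Q)%N -> (r <= Y)%N ->
  (forall x : nat, nd (2 * beta * x%:R) = nd ((k * x)%:R * th)) ->
  0 < eta -> eta <= 4^-1 ->
  2 * (h * Q%:R * Y%:R * (L%:R * M) `^ (gamma - 1) / M) <= eta ->
  `|corr_sum gamma (h * (l%:R `^ gamma - l'%:R `^ gamma))
      (2 * (beta * (l%:R ^+ 2 - l'%:R ^+ 2)) * r%:R)
      (beta * (l%:R ^+ 2 - l'%:R ^+ 2) * r%:R ^+ 2) r (N %/ l').+1 ((16 * N %/ l).+1 - r)|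
  <= 10 / eta + layer th eta (256 * 216) M J (k * (r * ((l - l') * (l + l')))).
Proof.
move=> g01 h0 M1 Y0 YM L0 Ll' ll' lL lQ rY hb e0 e4 he.
have [hM hab] := pair_range R N L0 Ll' ll' lL; rewrite -/M in hM hab.
have /andP[a1 a2] := amplitude_bounds g01 L0 Ll' ll' lL.
have Mp : 0 < M by lra.
have Lp : 0 < L%:R :> R by rewrite ltr0n.
set A := h * _; set t := 2 * _ * r%:R; set b := (16 * N %/ l).+1; set a := (N %/ l').+1.
have A0 : 0 <= A.
  rewrite mulr_ge0 //; apply: le_trans a1; rewrite !mulr_ge0 ?powR_ge0 //.
  by case/andP: g01 => /ltW.
have rM : r%:R <= M by apply: le_trans YM; rewrite ler_nat.
have et : nd t = nd ((k * (r * ((l - l') * (l + l'))))%:R * th).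
  rewrite -hb; congr nd; rewrite /t !natrM natrD natrB ?(ltnW ll') //; ring.
have An : A * r%:R * M `^ (gamma - 2) <= h * Q%:R * Y%:R * (L%:R * M) `^ (gamma - 1) / M.
  have -> : M `^ (gamma - 2) = M `^ (gamma - 1) / M.
    have -> : gamma - 2 = gamma - 1 - 1 by ring.
    rewrite [LHS]powRB; last by apply/implyP => _; rewrite gt_eqF.
    by rewrite powRr1 // ltW.
  rewrite powRM ?(ltW Lp) ?(ltW Mp) //.
  have -> : h * Q%:R * Y%:R * (L%:R `^ (gamma - 1) * M `^ (gamma - 1)) / M =
     (h * (Q%:R * L%:R `^ (gamma - 1))) * Y%:R * (M `^ (gamma - 1) / M) by ring.
  rewrite ler_wpM2r ?divr_ge0 ?powR_ge0 ?(ltW Mp) //.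
  rewrite ler_pM // ?ler_nat // ler_wpM2l //; apply: le_trans a2 _.
  by rewrite ler_wpM2r ?powR_ge0 // ler_nat.
apply: le_layer; rewrite ?mulr_ge0 ?ler0n ?normr_ge0 //.
- apply: le_trans (corr_trivial _ _ _ _ _ _ _) _; apply: le_trans hab.
  by rewrite ler_nat leq_sub2r // leq_subr.
- rewrite -et real_normK ?num_real //.
  by apply: (@corr_sum_near R gamma M A _ _ _ r a b g01 M1 A0 rM hM hab An); lra.
- rewrite -et => het; have tp := lt_trans e0 het.
  have h10 := @corr_sum_far R gamma M A t (beta * (l%:R ^+ 2 - l'%:R ^+ 2) * r%:R ^+ 2)
     _ r a b g01 M1 A0 rM hM hab An.
  have {}h10 := h10 (ltW (le_lt_trans he het)).
  rewrite ler_pdivlMr // mulrC; apply: le_trans h10.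
  by rewrite ler_wpM2r //; exact: ltW.
Qed.

(** The amplitude is at least of order l - l' by [amplitude_bounds], so the bound decays in l - l'
    as well as in [r]. *)
Lemma pair_corr_zero (R : realType) (gamma h : R) (N L Q Y l l' r : nat)
    (M := N%:R / (2 * L%:R) : R) :
  0 < gamma < 1 -> 0 < h -> 1 <= M -> (0 < Y)%N -> Y%:R <= M ->
  (0 < L)%N -> (L < l')%N -> (l' < l)%N -> (l <= L.*2)%N -> (l - l' <= Q)%N ->
  (0 < r <= Y)%N ->
  h * Q%:R * Y%:R * (L%:R * M) `^ (gamma - 1) / M <= 2^-1 ->
  `|corr_sum gamma (h * (l%:R `^ gamma - l'%:R `^ gamma))
      (2 * (0 * (l%:R ^+ 2 - l'%:R ^+ 2)) * r%:R)
      (0 * (l%:R ^+ 2 - l'%:R ^+ 2) * r%:R ^+ 2) r (N %/ l').+1 ((16 * N %/ l).+1 - r)|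
  <= 5 * 35 ^+ 2 * M / (h * (gamma ^+ 2 * (1 - gamma)) * N%:R `^ (gamma - 1))
       / (l - l')%:R / r%:R.
Proof.
move=> g01 h0 M1 Y0 YM L0 Ll' ll' lL lQ /andP[r0 rY] he.
have [hM hab] := pair_range R N L0 Ll' ll' lL; rewrite -/M in hM hab.
have /andP[a1 a2] := amplitude_bounds g01 L0 Ll' ll' lL.
have Mp : 0 < M by lra.
have Lp : 0 < L%:R :> R by rewrite ltr0n.
have qp : 0 < (l - l')%:R :> R by rewrite ltr0n subn_gt0.
have rM : r%:R <= M by apply: le_trans YM; rewrite ler_nat.
have Np : 0 < N%:R :> R.
  by rewrite lt_neqAle ler0n andbT; apply/eqP => e; move: M1; rewrite /M -e mul0r; lra.
have eNM : N%:R = 2 * L%:R * M by rewrite /M; field; rewrite gt_eqF.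
have eM : M `^ (gamma - 2) = M `^ (gamma - 1) / M.
  have -> : gamma - 2 = gamma - 1 - 1 by ring.
  rewrite [LHS]powRB; last by apply/implyP => _; rewrite gt_eqF.
  by rewrite powRr1 // ltW.
set A := h * _.
have A0 : 0 <= A.
  rewrite mulr_ge0 //; first exact: ltW. apply: le_trans a1; rewrite !mulr_ge0 ?powR_ge0 //.
  by case/andP: g01 => /ltW.
case/andP: (g01) => g0 g1.
pose nu1 := (l - l')%:R * (h * (gamma ^+ 2 * (1 - gamma)) * N%:R `^ (gamma - 1)) / M.
have nu10 : 0 < nu1.
  by rewrite /nu1 divr_gt0 // !mulr_gt0 ?powR_gt0 ?exprn_gt0 // subr_gt0.
have -> : 5 * 35 ^+ 2 * M / (h * (gamma ^+ 2 * (1 - gamma)) * N%:R `^ (gamma - 1))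
       / (l - l')%:R / r%:R = 5 * 35 ^+ 2 / nu1 / r%:R.
  rewrite /nu1; move: (N%:R `^ (gamma - 1)) (powR_gt0 (gamma - 1) Np) => u u0.
  have v0 : 0 < 1 - gamma by rewrite subr_gt0.
  by field; rewrite !gt_eqF // ltr0n.
rewrite !mul0r mulr0 mul0r; apply: (@corr_sum_zero R gamma M) => //.
- apply: le_trans he.
  rewrite eM powRM ?(ltW Lp) ?(ltW Mp) //.
  have -> : h * Q%:R * Y%:R * (L%:R `^ (gamma - 1) * M `^ (gamma - 1)) / M =
     (h * (Q%:R * L%:R `^ (gamma - 1))) * Y%:R * (M `^ (gamma - 1) / M) by ring.
  rewrite ler_wpM2r ?divr_ge0 ?powR_ge0 ?(ltW Mp) //.
  rewrite ler_pM // ?ler_nat // ler_pM2l //; apply: le_trans a2 _.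
  by rewrite ler_wpM2r ?powR_ge0 // ler_nat.
- rewrite /nu1 eNM powRM ?mulr_ge0 ?(ltW Lp) ?(ltW Mp) // eM.
  have -> : (l - l')%:R * (h * (gamma ^+ 2 * (1 - gamma)) * ((2 * L%:R) `^ (gamma - 1) * M `^ (gamma - 1))) / M
    = (h * ((l - l')%:R * (gamma * (2 * L%:R) `^ (gamma - 1)))) * (gamma * (1 - gamma) * (M `^ (gamma - 1) / M)) by ring.
  rewrite ler_wpM2r ?ler_pM2l // !mulr_ge0 ?powR_ge0 ?invr_ge0 ?(ltW Mp) ?(ltW g0) //; lra.
Qed.

(** With l' = L + 1 + i and l = l' + q, this encodes L < l' < l <= 2 L. *)
Definition pair_ok (L q i : nat) : bool := (0 < q)%N && (i + q < L)%N.

Lemma pair_avg (R : realType) (gamma h beta W : R) (N L Q Y : nat)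
    (M := N%:R / (2 * L%:R) : R) :
  1 <= M -> (0 < Y)%N -> Y%:R <= M -> (0 < L)%N ->
  \sum_(q < Q) \sum_(i < L) (pair_ok L q i)%:R * \sum_(1 <= r < Y)
   `|corr_sum gamma (h * ((L.+1 + i + q)%:R `^ gamma - (L.+1 + i)%:R `^ gamma))
      (2 * (beta * ((L.+1 + i + q)%:R ^+ 2 - (L.+1 + i)%:R ^+ 2)) * r%:R)
      (beta * ((L.+1 + i + q)%:R ^+ 2 - (L.+1 + i)%:R ^+ 2) * r%:R ^+ 2) r
      (N %/ (L.+1 + i)).+1 ((16 * N %/ (L.+1 + i + q)).+1 - r)| <= W ->
  (\sum_(q < Q) \sum_(i < L) (pair_ok L q i)%:R *
     `|pair_sum gamma h beta N (L.+1 + i + q) (L.+1 + i)|) ^+ 2 <=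
  Q%:R * L%:R * (33 * M / Y%:R * (32 * Q%:R * L%:R * M + 2 * W)).
Proof.
move=> M1 Y0 YM L0 hW.
have Yp : 0 < Y%:R :> R by rewrite ltr0n.
have p : 0 <= 33 * M / Y%:R by rewrite divr_ge0 //; lra.
have s1 (f : nat -> nat -> R) : (\sum_(q < Q) \sum_(i < L) f q i) ^+ 2 <=
    Q%:R * L%:R * \sum_(q < Q) \sum_(i < L) f q i ^+ 2.
  apply: le_trans (@sqr_sum_le R _ xpredT _) _; rewrite card_ord -mulrA ler_wpM2l //.
  rewrite mulr_sumr; apply: ler_sum => q _.
  by apply: le_trans (@sqr_sum_le R _ xpredT _) _; rewrite card_ord.
apply: le_trans (s1 (fun q i => (pair_ok L q i)%:R * `|pair_sum gamma h beta N (L.+1 + i + q) (L.+1 + i)|)) _.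
rewrite ler_wpM2l ?mulr_ge0 //.
apply: (@le_trans _ _ (\sum_(q < Q) \sum_(i < L) 33 * M / Y%:R * (32 * M + 2 * ((pair_ok L q i)%:R * \sum_(1 <= r < Y)
   `|corr_sum gamma (h * ((L.+1 + i + q)%:R `^ gamma - (L.+1 + i)%:R `^ gamma))
      (2 * (beta * ((L.+1 + i + q)%:R ^+ 2 - (L.+1 + i)%:R ^+ 2)) * r%:R)
      (beta * ((L.+1 + i + q)%:R ^+ 2 - (L.+1 + i)%:R ^+ 2) * r%:R ^+ 2) r
      (N %/ (L.+1 + i)).+1 ((16 * N %/ (L.+1 + i + q)).+1 - r)|)))).
  apply: ler_sum => q _; apply: ler_sum => i _.
  case: (boolP (pair_ok L q i)) => [/andP[q0 iq]|_]; last first.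
    by rewrite !mul0r expr0n mulr0 addr0 mulr_ge0 //; lra.
  rewrite !mul1r real_normK ?num_real //.
  by apply: pair_sum_weyl => //; move: q0 iq; clear; lia.
under eq_bigr => q _ do rewrite -mulr_sumr big_split /= sumr_const card_ord -mulr_sumr.
rewrite -mulr_sumr ler_wpM2l // big_split /= sumr_const card_ord -mulr_sumr lerD //.
  by rewrite -mulrnA -[leLHS]mulr_natl natrM; apply: le_of_eq; ring.
by rewrite ler_pM2l.
Qed.

(** For a fixed difference q the sum l + l' = 2 (L + 1 + i) + q determines i, and it is at most 4
    L. *)
Lemma pair_sums_indices (R : realType) (F : nat -> R) (L q : nat) : (forall n, 0 <= F n) ->
  \sum_(i < L) (pair_ok L q i)%:R * F (L.+1 + i + q + (L.+1 + i))%N <=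
  \sum_(1 <= y < (4 * L).+1) F y.
Proof.
move=> F0.
apply: (@le_trans _ _ (\sum_(i < L) \sum_(1 <= y < (4 * L).+1)
    (i == (y - L.+1 - L.+1 - q)./2 :> nat)%:R * F y)).
  apply: ler_sum => i _; case: (boolP (pair_ok L q i)) => [/andP[q0 iq]|_]; last first.
    by rewrite mul0r sumr_ge0 // => y _; rewrite mulr_ge0.
  set y := (_ + _ + q + _)%N.
  have yin : y \in index_iota 1 (4 * L).+1.
    by rewrite mem_index_iota /y; move: q0 iq; clear; lia.
  have e : (i = (y - L.+1 - L.+1 - q)./2 :> nat).
    have -> : (y - L.+1 - L.+1 - q)%N = i.*2 by rewrite /y; clear; lia.
    by rewrite doubleK.
  rewrite (bigD1_seq y) ?iota_uniq //= -e eqxx lerDl sumr_ge0 // => z _.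
  by rewrite mulr_ge0.
rewrite exchange_big /=; apply: ler_sum => y _; rewrite -mulr_suml.
by rewrite -[leRHS]mul1r ler_wpM2r // sum_indic_le.
Qed.

Lemma sum_dilate_le (R : realType) (f : nat -> R) (k X : nat) : (0 < k)%N ->
  (forall n, 0 <= f n) ->
  \sum_(1 <= n < X.+1) f (k * n)%N <= \sum_(1 <= n < (k * X).+1) f n.
Proof.
move=> k0 f0.
apply: (@le_trans _ _ (\sum_(1 <= n < X.+1) \sum_(1 <= z < (k * X).+1)
    (n == z %/ k)%N%:R * f z)).
  apply: ler_sum_nat => n /andP[n0 nX].
  have zin : (k * n)%N \in index_iota 1 (k * X).+1.
    by rewrite mem_index_iota muln_gt0 k0 n0 ltnS leq_mul.
  rewrite (bigD1_seq (k * n)%N) ?iota_uniq //= mulKn // eqxx mul1r lerDl sumr_ge0 // => z _.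
  by rewrite mulr_ge0.
rewrite exchange_big /=; apply: ler_sum => y _; rewrite -mulr_suml.
rewrite -[leRHS]mul1r ler_wpM2r //.
apply: le_trans (_ : \sum_(0 <= n < X.+1) (n == y %/ k)%N%:R <= _).
  by rewrite [leRHS]big_nat_recl // big_add1 /= lerDr.
by rewrite big_mkord sum_indic_le.
Qed.

(** With k fixed, an integer k r (l - l')(l + l') is counted by two divisor choices: one splits off
    r, the other separates the difference from the sum. Each costs a factor D. *)
Lemma sum_four_factors (R : realType) (f : nat -> R) (k L Q Y D : nat) : (0 < k)%N -> (0 < Y)%N ->
  (forall n, 0 <= f n) ->
  (forall n, (0 < n <= Y * (Q * (4 * L)))%N -> (size (divisors n) <= D)%N) ->
  \sum_(q < Q) \sum_(i < L) (pair_ok L q i)%:R * \sum_(1 <= r < Y)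
     f (k * (r * (((L.+1 + i + q) - (L.+1 + i)) * (L.+1 + i + q + (L.+1 + i)))))%N <=
  D%:R ^+ 2 * \sum_(1 <= n < (k * (Y * (Q * (4 * L)))).+1) f n.
Proof.
move=> k0 Y0 f0 hD.
pose F z := \sum_(1 <= r < Y.+1) f (k * (r * z))%N.
have F0 z : 0 <= F z by apply: sumr_ge0.
apply: (@le_trans _ _ (\sum_(1 <= q < Q.+1) \sum_(1 <= y < (4 * L).+1) F (q * y)%N)).
  apply: (@le_trans _ _ (\sum_(q < Q.+1) (0 < q)%N%:R * \sum_(1 <= y < (4 * L).+1) F (q * y)%N)).
    rewrite big_ord_recr /=; apply: ler_wpDr.
      by rewrite mulr_ge0 // sumr_ge0.
    apply: ler_sum => q _; case: (posnP q) => [->|q0].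
      by rewrite mul0r big1 // => i _; rewrite mul0r.
    rewrite mul1r; apply: le_trans (@pair_sums_indices R (fun y => F (q * y)%N) L q _) => //.
    apply: ler_sum => i _; rewrite ler_wpM2l // /F.
    by rewrite addKn [leRHS]big_nat_recr //= lerDl.
  rewrite big_ord_recl mul0r add0r big_add1 /= big_mkord.
  by apply: ler_sum => i _; rewrite mul1r.
apply: le_trans (_ : D%:R * \sum_(1 <= z < (Q * (4 * L)).+1) F z <= _).
  apply: sum_mult_divisors => // n /andP[n0 nn].
  by apply: hD; rewrite n0 (leq_trans nn) // leq_pmull.
rewrite expr2 -mulrA ler_wpM2l // /F exchange_big /=.
apply: le_trans (@sum_mult_divisors R (fun n => f (k * n)%N) Y (Q * (4 * L)) D _ hD) _ => //.
by rewrite ler_wpM2l // sum_dilate_le.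
Qed.

Lemma pair_avg_far (R : realType) (gamma h beta th eta : R) (a0 : int)
    (q0 k N L Q Y D : nat) (M := N%:R / (2 * L%:R) : R) (X := (k * (Y * (Q * (4 * L))))%N) :
  0 < gamma < 1 -> 0 <= h -> 1 <= M -> (0 < Y)%N -> Y%:R <= M -> (0 < L)%N ->
  good_approx th a0 q0 -> (0 < k)%N ->
  (forall x : nat, nd (2 * beta * x%:R) = nd ((k * x)%:R * th)) ->
  (forall n, (0 < n <= Y * (Q * (4 * L)))%N -> (size (divisors n) <= D)%N) ->
  eta <= 4^-1 -> 1 <= M * eta ->
  2 * (h * Q%:R * Y%:R * (L%:R * M) `^ (gamma - 1) / M) <= eta ->
  (\sum_(q < Q) \sum_(i < L) (pair_ok L q i)%:R *
     `|pair_sum gamma h beta N (L.+1 + i + q) (L.+1 + i)|) ^+ 2 <=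
  Q%:R * L%:R * (33 * M / Y%:R * (32 * Q%:R * L%:R * M + 2 *
    (Q%:R * L%:R * Y%:R * (10 / eta) + D%:R ^+ 2 * ((2 * X%:R / q0%:R + 1) *
      (32 * (256 * 216) * (M + q0%:R * Num.sqrt (M * eta))))))).
Proof.
move=> g01 h0 M1 Y0 YM L0 ga k0 hb hD e4 Me he.
have Mp : 0 < M by lra.
have e0 : 0 < eta by rewrite -(pmulr_rgt0 _ Mp); lra.
have [J hJ] := ex_pow4 Me.
have c32 : 32 <= 256 * 216 :> R by lra.
have c0 : 0 <= 256 * 216 :> R by lra.
have l0 n : 0 <= layer th eta (256 * 216) M J n by apply: layer_ge0 => //; exact: ltW.
apply: pair_avg => //; rewrite -/M.
apply: (@le_trans _ _ (\sum_(q < Q) \sum_(i < L) (Y%:R * (10 / eta) +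
  (pair_ok L q i)%:R * \sum_(1 <= r < Y) layer th eta (256 * 216) M J
    (k * (r * (((L.+1 + i + q) - (L.+1 + i)) * (L.+1 + i + q + (L.+1 + i)))))%N))).
  apply: ler_sum => q _; apply: ler_sum => i _.
  have e10 : 0 <= Y%:R * (10 / eta) by rewrite mulr_ge0 // divr_ge0 // ltW.
  case: (boolP (pair_ok L q i)) => [/andP[q1 iq]|_]; last by rewrite !mul0r addr0.
  rewrite !mul1r.
  apply: (@le_trans _ _ (\sum_(1 <= r < Y) (10 / eta + layer th eta (256 * 216) M J
    (k * (r * (((L.+1 + i + q) - (L.+1 + i)) * (L.+1 + i + q + (L.+1 + i)))))%N))).
    apply: ler_sum_nat => r /andP[r0 rY].
    apply: (@pair_corr_far R gamma h beta th eta k N L Q Y) => //.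
    - by rewrite addSn ltnS leq_addr.
    - by rewrite -[X in (X < _)%N]addn0 ltn_add2l.
    - by move: iq; clear; lia.
    - by rewrite addKn ltnW.
    - exact: ltnW.
  rewrite big_split /= lerD2r sumr_const_nat -[leLHS]mulr_natl ler_wpM2r //.
    by rewrite divr_ge0 // ltW.
  by rewrite ler_nat leq_subr.
under eq_bigr => q _ do rewrite big_split /= sumr_const card_ord.
rewrite big_split /= sumr_const card_ord lerD //.
  by rewrite -mulrnA -[leLHS]mulr_natl natrM; apply: le_of_eq; ring.
apply: le_trans (@sum_four_factors R (layer th eta (256 * 216) M J) k L Q Y D k0 Y0 l0 hD) _.
rewrite ler_wpM2l ?exprn_ge0 //.
exact: sum_layer ga e0 c32 M1 hJ.
Qed.

Lemma pair_avg_zero (R : realType) (gamma h : R)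
    (N L Q Y : nat) (M := N%:R / (2 * L%:R) : R) :
  0 < gamma < 1 -> 0 < h -> 1 <= M -> (0 < Y)%N -> Y%:R <= M -> (0 < L)%N ->
  h * Q%:R * Y%:R * (L%:R * M) `^ (gamma - 1) / M <= 2^-1 ->
  (\sum_(q < Q) \sum_(i < L) (pair_ok L q i)%:R *
     `|pair_sum gamma h 0 N (L.+1 + i + q) (L.+1 + i)|) ^+ 2 <=
  Q%:R * L%:R * (33 * M / Y%:R * (32 * Q%:R * L%:R * M + 2 *
    (L%:R * (5 * 35 ^+ 2 * M / (h * (gamma ^+ 2 * (1 - gamma)) * N%:R `^ (gamma - 1)))
      * harm R Q * harm R Y))).
Proof.
move=> g01 h0 M1 Y0 YM L0 he.
have Mp : 0 < M by lra.
set C := 5 * 35 ^+ 2 * M / _.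
have C0 : 0 <= C.
  case/andP: g01 => g0 g1.
  by rewrite divr_ge0 // !mulr_ge0 ?powR_ge0 ?exprn_ge0 ?subr_ge0 // ltW.
apply: pair_avg => //; rewrite -/M.
have hY0 : 0 <= harm R Y by apply: sumr_ge0 => r _; rewrite invr_ge0.
apply: (@le_trans _ _ (\sum_(q < Q) \sum_(i < L) (0 < q)%N%:R * q%:R^-1 * (C * harm R Y))).
  apply: ler_sum => q _; apply: ler_sum => i _.
  case: (boolP (pair_ok L q i)) => [/andP[q1 iq]|_]; last first.
    by rewrite [leLHS]mul0r; apply: mulr_ge0; [exact: divr_ge0|exact: mulr_ge0].
  rewrite [leLHS]mul1r q1 mul1r.
  apply: (@le_trans _ _ (\sum_(1 <= r < Y) C / q%:R / r%:R)).
    apply: ler_sum_nat => r /andP[r0 rY].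
    have := @pair_corr_zero R gamma h N L Q Y (L.+1 + i + q) (L.+1 + i) r g01 h0 M1 Y0 YM L0.
    rewrite -/M -/C addKn => k; apply: k => //.
    - by rewrite addSn ltnS leq_addr.
    - by rewrite -[X in (X < _)%N]addn0 ltn_add2l.
    - by move: iq; clear; lia.
    - exact: ltnW.
    - by rewrite r0 ltnW.
  rewrite -mulr_sumr; apply: le_of_eq; rewrite /harm; ring.
under eq_bigr => q _ do rewrite sumr_const card_ord -(mulr_natl _ L).
rewrite -mulr_sumr -mulr_suml.
have -> : \sum_(q < Q) (0 < q)%N%:R * q%:R^-1 = harm R Q.
  rewrite /harm -(big_mkord xpredT (fun q => (0 < q)%N%:R * q%:R^-1)).
  case: (posnP Q) => [->|Q0]; first by rewrite !big_geq.
  rewrite big_ltn // mul0r add0r; apply: eq_big_nat => q /andP[q1 _].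
  by rewrite q1 mul1r.
by apply: le_of_eq; ring.
Qed.

(** Two indices in one block of length Q differ by less than Q. As G is nonnegative, the block
    condition can be relaxed to that; symmetry supplies the factor 2. *)
Lemma same_block_sum (R : realType) (G : nat -> nat -> R) (L Q : nat) : (0 < Q)%N ->
  (forall i j, 0 <= G i j) -> (forall i j, G i j = G j i) ->
  \sum_(i < L) \sum_(j < L) ((i %/ Q)%N == (j %/ Q)%N)%:R * G i j <=
  \sum_(i < L) G i i + 2 * \sum_(q < Q) \sum_(i < L) (pair_ok L q i)%:R * G (i + q)%N i.
Proof.
move=> Q0 G0 Gs.
pose H := \sum_(q < Q) \sum_(i < L) (pair_ok L q i)%:R * G (i + q)%N i.
have hH : H = \sum_(i < L) \sum_(j < L) \sum_(q < Q) ((0 < q)%N && (i == j + q :> nat)%N)%:R * G i j.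
  rewrite /H exchange_big /= [RHS]exchange_big /=; apply: eq_bigr => j _.
  rewrite [RHS]exchange_big /=; apply: eq_bigr => q _.
  rewrite (eq_bigr (fun i : 'I_L => (i == (j + q)%N :> nat)%:R * ((0 < q)%N%:R * G i j))); last first.
    by move=> i _; rewrite mulrA -natrM mulnb andbC.
  rewrite (sum_indic_nat _ _ (fun i => (0 < q)%N%:R * G i j)) mulrA -natrM mulnb /pair_ok.
  by rewrite andbC.
have -> : \sum_(i < L) G i i = \sum_(i < L) \sum_(j < L) (j == i :> nat)%:R * G i j.
  by apply: eq_bigr => i _; rewrite (sum_indic_nat _ _ (fun j => G i j)) ltn_ord mul1r.
have -> : 2 * H = H + \sum_(i < L) \sum_(j < L) \sum_(q < Q) ((0 < q)%N && (j == i + q :> nat)%N)%:R * G i j.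
  rewrite [X in _ = _ + X]exchange_big /= mulr_natl mulr2n {2}hH; congr (_ + _).
  by apply: eq_bigr => i _; apply: eq_bigr => j _; apply: eq_bigr => q _; rewrite Gs.
rewrite {}hH -!big_split /=; apply: ler_sum => i _; rewrite -!big_split /=; apply: ler_sum => j _.
have p1 : 0 <= \sum_(q < Q) ((0 < q)%N && (i == j + q :> nat)%N)%:R * G i j.
  by apply: sumr_ge0 => q _; rewrite mulr_ge0.
have p2 : 0 <= \sum_(q < Q) ((0 < q)%N && (j == i + q :> nat)%N)%:R * G i j.
  by apply: sumr_ge0 => q _; rewrite mulr_ge0.
have p3 : 0 <= (j == i :> nat)%:R * G i j by rewrite mulr_ge0.
case: eqP => [e|_]; last by rewrite mul0r; lra.
have dm : forall x y : nat, (x %/ Q = y %/ Q)%N -> (x < y)%N -> (y - x < Q)%N.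
  move=> x y exy xy; have := divn_eq x Q; have := divn_eq y Q.
  have := ltn_pmod x Q0; have := ltn_pmod y Q0; rewrite exy.
  move: (_ * Q)%N (x %% Q)%N (y %% Q)%N => u v w; move: xy; clear; lia.
rewrite mul1r.
case: (ltngtP (i : nat) j) => ij.
- have d := dm _ _ e ij.
  have : G i j <= \sum_(q < Q) ((0 < q)%N && (j == i + q :> nat)%N)%:R * G i j.
    rewrite (bigD1 (Ordinal d)) //= subn_gt0 ij subnKC ?(ltnW ij) // eqxx mul1r lerDl.
    by apply: sumr_ge0 => q _; rewrite mulr_ge0.
  by rewrite [false%:R * _]mul0r => h; lra.
- have d := dm _ _ (esym e) ij.
  have : G i j <= \sum_(q < Q) ((0 < q)%N && (i == j + q :> nat)%N)%:R * G i j.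
    rewrite (bigD1 (Ordinal d)) //= subn_gt0 ij subnKC ?(ltnW ij) // eqxx mul1r lerDl.
    by apply: sumr_ge0 => q _; rewrite mulr_ge0.
  by rewrite [false%:R * _]mul0r => h; lra.
- by rewrite mul1r; lra.
Qed.

Definition phase (R : realType) (gamma h beta c : R) (n : nat) : R :=
  h * n%:R `^ gamma + beta * n%:R ^+ 2 + c.

(** The factor 16 is wide enough for the elementary Chebyshev bounds to give this range a mass of at
    least 2 N. *)
Definition in_range (N n : nat) : bool := (N < n)%N && (n <= 16 * N)%N.

Lemma sum_indic_itv (R : realType) (F : nat -> R) (a b n : nat) : (b <= n)%N ->
  \sum_(m < n) ((a <= m)%N && (m < b)%N)%:R * F m = \sum_(a <= m < b) F m.
Proof.
move=> bn; rewrite -(big_mkord xpredT (fun m => ((a <= m)%N && (m < b)%N)%:R * F m)).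
case: (leqP a b) => ab; last first.
  rewrite [RHS]big_geq ?(ltnW ab) // big1 // => m _.
  have -> : ((a <= m)%N && (m < b)%N) = false by move: ab; clear; lia.
  by rewrite [LHS]mul0r.
rewrite (big_cat_nat (leq0n a) (leq_trans ab bn)) /= (big_cat_nat ab bn) /=.
rewrite [X in X + _](_ : _ = 0); last first.
  rewrite big_nat_cond big1 // => m /andP[/andP[_ h] _].
  by rewrite leqNgt h [LHS]mul0r.
rewrite [X in _ + (_ + X)](_ : _ = 0); last first.
  rewrite big_nat_cond big1 // => m /andP[/andP[h _] _].
  by rewrite andbC ltnNge h [LHS]mul0r.
rewrite add0r addr0; apply: eq_big_nat => m ->; exact: mul1r.
Qed.

Lemma pair_sumE (R : realType) (gamma h beta c : R) (N l l' n : nat) :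
  (0 < l')%N -> (l' < l)%N -> (16 * N %/ l < n)%N ->
  \sum_(m < n) (in_range N (l * m) && in_range N (l' * m))%:R *
     ec (phase gamma h beta c (l * m) - phase gamma h beta c (l' * m)) =
  pair_sum gamma h beta N l l'.
Proof.
move=> l0 ll hn; rewrite /pair_sum -(sum_indic_itv _ _ hn).
apply: eq_bigr => m _; congr (_ * ec _).
  congr (_%:R); congr nat_of_bool; rewrite /in_range.
  have lp : (0 < l)%N by apply: ltn_trans ll.
  rewrite ltn_divLR // [in RHS]ltnS leq_divRL // ![(m * _)%N]mulnC.
  case: (posnP m) => [->|m0]; first by rewrite !muln0 !ltn0.
  have : (l' * m < l * m)%N by rewrite ltn_pmul2r.
  by move: (l' * m)%N (l * m)%N => u v; clear; lia.
rewrite /phase !natrM !powRM //; ring.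
Qed.

(** Cauchy-Schwarz over m, and then over blocks of Q consecutive l, so that only pairs with l - l' <
    Q arise. Such close pairs have a small amplitude h (l^gamma - l'^gamma), as the differencing
    step requires. There are n <= 32 N / L values of m and at most 2 L / Q blocks, whence 64 N /
    Q. *)
Lemma bilinear_cauchy (R : realType) (gamma h beta c A0 B0 : R) (N L Q : nat)
    (u v : nat -> R) :
  (0 < Q)%N -> (Q <= L)%N -> (L <= 16 * N)%N ->
  (forall m, `|u m| <= A0) -> (forall l, `|v l| <= B0) ->
  (\sum_(i < L) \sum_(m < (16 * N %/ L).+1) (in_range N ((L.+1 + i) * m))%:R *
     (v (L.+1 + i)%N * u m * ec (phase gamma h beta c ((L.+1 + i) * m)))) ^+ 2 <=
  A0 ^+ 2 * B0 ^+ 2 * (64 * N%:R / Q%:R) * (16 * N%:R + 2 *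
    \sum_(q < Q) \sum_(i < L) (pair_ok L q i)%:R *
     `|pair_sum gamma h beta N (L.+1 + i + q) (L.+1 + i)|).
Proof.
move=> Q0 QL LN hu hv.
have L0 : (0 < L)%N by exact: leq_trans QL.
have Lp : 0 < L%:R :> R by rewrite ltr0n.
have Qp : 0 < Q%:R :> R by rewrite ltr0n.
pose n := (16 * N %/ L).+1; pose l i := (L.+1 + i)%N.
pose ph i m := phase gamma h beta c (l i * m).
pose w (i m : nat) : R := (in_range N (l i * m))%:R * v (l i).
pose J := (L %/ Q).+1.
pose G i j := `|\sum_(m < n) (in_range N (l i * m) && in_range N (l j * m))%:R * ec (ph i m - ph j m)|.
have G0 i j : 0 <= G i j by exact: normr_ge0.
have Gs i j : G i j = G j i.
  congr `|_|; apply: eq_bigr => m _; rewrite andbC; congr (_ * _).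
  by rewrite -ecN opprB.
have A2 m : u m ^+ 2 <= A0 ^+ 2.
  by rewrite -(real_normK (num_real (u m))) ler_pXn2r ?nnegrE // (le_trans _ (hu m)).
have B00 : 0 <= B0 by apply: le_trans (hv 0%N).
pose U m := \sum_(i < L) w i m * ec (ph i m).
have eS : \sum_(i < L) \sum_(m < n) (in_range N (l i * m))%:R *
     (v (l i) * u m * ec (ph i m)) = \sum_(m < n) u m * U m.
  rewrite exchange_big /=; apply: eq_bigr => m _; rewrite mulr_sumr.
  by apply: eq_bigr => i _; rewrite /w; ring.
rewrite -/n -/(l _) eS.
have h1 : (\sum_(m < n) u m * U m) ^+ 2 <= n%:R * (A0 ^+ 2 * \sum_(m < n) U m ^+ 2).
  apply: le_trans (@sqr_sum_le R _ xpredT _) _; rewrite card_ord ler_wpM2l //.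
  rewrite mulr_sumr; apply: ler_sum => m _; rewrite exprMn ler_wpM2r ?sqr_ge0 //.
have h2 m : U m ^+ 2 <= J%:R * \sum_(i < L) \sum_(j < L)
    ((i %/ Q)%N == (j %/ Q)%N)%:R * (w i m * w j m * ec (ph i m - ph j m)).
  (* Grouping by the block number i / Q prepares Cauchy-Schwarz over the J blocks. *)
  have -> : U m = \sum_(k < J) \sum_(i < L) ((i %/ Q)%N == k)%:R * w i m * ec (ph i m).
    rewrite exchange_big /=; apply: eq_bigr => i _.
    rewrite (eq_bigr (fun k : 'I_J => (k == (i %/ Q)%N :> nat)%:R * (w i m * ec (ph i m)))).
      rewrite (sum_indic_nat _ _ (fun=> w i m * ec (ph i m))).
      have -> : (i %/ Q < J)%N by rewrite /J ltnS leq_div2r // ltnW.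
      by rewrite mul1r.
    by move=> k _; rewrite mulrA eq_sym.
  apply: le_trans (@sqr_sum_le R _ xpredT _) _; rewrite card_ord ler_wpM2l //.
  apply: (@le_trans _ _ (\sum_(k < J) \sum_(i < L) \sum_(j < L)
     (((i %/ Q)%N == k)%:R * w i m) * (((j %/ Q)%N == k)%:R * w j m) * ec (ph i m - ph j m))).
    apply: ler_sum => k _.
    rewrite -(sqr_sum_trig (fun i : 'I_L => ((i %/ Q)%N == k)%:R * w i m) (fun i => ph i m)).
    by rewrite lerDl sqr_ge0.
  rewrite exchange_big /=; apply: ler_sum => i _; rewrite exchange_big /=; apply: ler_sum => j _.
  rewrite (eq_bigr (fun k : 'I_J => (k == (i %/ Q)%N :> nat)%:R *
     (((j %/ Q)%N == k)%:R * (w i m * w j m * ec (ph i m - ph j m))))); last first.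
    by move=> k _; rewrite eq_sym; ring.
  rewrite (sum_indic_nat _ _ (fun k => ((j %/ Q)%N == k)%:R * (w i m * w j m * ec (ph i m - ph j m)))).
  have -> : (i %/ Q < J)%N by rewrite /J ltnS leq_div2r // ltnW.
  by rewrite mul1r eq_sym.
have h3 : \sum_(m < n) U m ^+ 2 <= J%:R * (B0 ^+ 2 *
   \sum_(i < L) \sum_(j < L) ((i %/ Q)%N == (j %/ Q)%N)%:R * G i j).
  apply: le_trans (ler_sum _ (fun (m : 'I_n) _ => h2 m)) _.
  rewrite -mulr_sumr ler_wpM2l // exchange_big /= mulr_sumr; apply: ler_sum => i _.
  rewrite exchange_big /= mulr_sumr; apply: ler_sum => j _.
  rewrite -mulr_sumr mulrCA ler_wpM2l //.
  rewrite (eq_bigr (fun m : 'I_n => (v (l i) * v (l j)) * ((in_range N (l i * m) && in_range N (l j * m))%:R * ec (ph i m - ph j m)))).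
    rewrite -mulr_sumr; apply: le_trans (ler_norm _) _; rewrite normrM ler_wpM2r //.
    by rewrite normrM expr2 ler_pM.
  by move=> m _; rewrite /w -mulnb natrM; ring.
have h4 : \sum_(i < L) G i i <= 16 * N%:R.
  apply: (@le_trans _ _ (\sum_(i < L) (16 * N %/ L)%:R)).
    apply: ler_sum => i _; apply: le_trans (ler_norm_sum _ _ _) _.
    rewrite big_ord_recl /= [X in X + _](_ : _ = 0); last first.
      by rewrite muln0 /in_range ltn0 [_ * ec _]mul0r normr0.
    rewrite add0r; apply: (@le_trans _ _ (\sum_(m < 16 * N %/ L) 1)).
      apply: ler_sum => m _; rewrite normrM -[leRHS]mul1r ler_pM // ?ec_max //.
      by case: (_ && _); rewrite ?normr1 ?normr0.
    by rewrite sumr_const card_ord.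
  rewrite sumr_const card_ord -(mulr_natl _ L) -!natrM ler_nat mulnC.
  exact: leq_trunc_div.
have h5 : \sum_(q < Q) \sum_(i < L) (pair_ok L q i)%:R * G (i + q)%N i =
    \sum_(q < Q) \sum_(i < L) (pair_ok L q i)%:R *
     `|pair_sum gamma h beta N (l i + q) (l i)|.
  apply: eq_bigr => q _; apply: eq_bigr => i _.
  case: (boolP (pair_ok L q i)) => [/andP[q1 iq]|_]; last by rewrite [LHS]mul0r [RHS]mul0r.
  congr (_ * `|_|); rewrite -(@pair_sumE R gamma h beta c N (l i + q) (l i) n).
  - by rewrite /ph /l addnA.
  - by rewrite /l.
  - by rewrite -[X in (X < _)%N]addn0 ltn_add2l.
  - rewrite /n ltnS leq_div2l // /l; clear; lia.
have h6 := same_block_sum L Q0 G0 Gs.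
rewrite h5 in h6.
set E := \sum_(q < Q) _ in h6 *.
have E0 : 0 <= E.
  by apply: sumr_ge0 => q _; apply: sumr_ge0 => i _; rewrite mulr_ge0.
have n32 : n%:R * L%:R <= 32 * N%:R :> R.
  rewrite -!natrM ler_nat /n mulSn; have := leq_trunc_div (16 * N) L.
  by move: LN; clear; lia.
have J2 : J%:R * Q%:R <= 2 * L%:R :> R.
  rewrite -!natrM ler_nat /J mulSn; have := leq_trunc_div L Q.
  by move: QL; clear; lia.
apply: le_trans h1 _.
have h7 : \sum_(m < n) U m ^+ 2 <= J%:R * (B0 ^+ 2 * (16 * N%:R + 2 * E)).
  apply: le_trans h3 _; rewrite ler_wpM2l // ler_wpM2l ?exprn_ge0 //.
  by apply: le_trans h6 _; lra.
apply: (@le_trans _ _ (n%:R * (A0 ^+ 2 * (J%:R * (B0 ^+ 2 * (16 * N%:R + 2 * E)))))).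
  by rewrite ler_wpM2l // ler_wpM2l ?sqr_ge0.
have -> : n%:R * (A0 ^+ 2 * (J%:R * (B0 ^+ 2 * (16 * N%:R + 2 * E)))) =
  A0 ^+ 2 * B0 ^+ 2 * (n%:R * J%:R) * (16 * N%:R + 2 * E) by ring.
rewrite ler_wpM2r //; first by rewrite addr_ge0 // mulr_ge0.
apply: ler_wpM2l; first by rewrite mulr_ge0 ?sqr_ge0.
rewrite ler_pdivlMr //.
have nn : 0 <= n%:R :> R by [].
have jj : 0 <= J%:R * Q%:R :> R by rewrite mulr_ge0.
rewrite -(ler_pM2r Lp).
have -> : n%:R * J%:R * Q%:R * L%:R = (n%:R * L%:R) * (J%:R * Q%:R) :> R by ring.
have -> : 64 * N%:R * L%:R = (32 * N%:R) * (2 * L%:R) :> R by ring.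
by rewrite ler_pM // mulr_ge0.
Qed.

(** * Arithmetic functions and Vaughan's identity *)

Lemma perm_divisors_pow_mul (p a m : nat) : prime p -> (0 < m)%N -> ~~ (p %| m)%N ->
  perm_eq (divisors (p ^ a * m)) [seq (p ^ i * d)%N | i <- iota 0 a.+1, d <- divisors m].
Proof.
move=> pp m0 pm; have p0 := prime_gt0 pp.
have pa0 : (0 < p ^ a * m)%N by rewrite muln_gt0 expn_gt0 p0.
have cop d : (d %| m)%N -> coprime p d.
  by move=> dm; rewrite prime_coprime //; apply: contra pm => h; exact: dvdn_trans dm.
apply: uniq_perm; first exact: divisors_uniq.
  apply: allpairs_uniq; [exact: iota_uniq|exact: divisors_uniq|].
  move=> x y hx hy; case/allpairsP: hx => [[i d]] /= [_ hd ->].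
  case/allpairsP: hy => [[j e]] /= [_ he ->] /= e0; move: hd he.
  rewrite -!dvdn_divisors // => hd he.
  have ij : i = j.
    have := congr1 (logn p) e0; rewrite !lognM ?expn_gt0 ?p0 ?(dvdn_gt0 m0 hd) ?(dvdn_gt0 m0 he) // !pfactorK //.
    by rewrite !(logn_coprime (cop _ _)) // !addn0.
  move: e0; rewrite ij => /eqP; rewrite eqn_pmul2l ?expn_gt0 ?p0 // => /eqP ->.
  by [].
move=> x; rewrite -dvdn_divisors //; apply/idP/allpairsP => [hx|]; last first.
  case=> [[i d]] [hi hd ->]; move: hi hd.
  rewrite mem_iota /= add0n ltnS -dvdn_divisors // => hi hd.
  by rewrite dvdn_mul // dvdn_exp2l.
have x0 := dvdn_gt0 pa0 hx.
have [y cy ey] := pfactor_coprime pp x0.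
exists (logn p x, y); split; last by rewrite /= mulnC.
  rewrite mem_iota /= add0n ltnS.
  have := dvdn_leq_log p pa0 hx; rewrite lognM ?expn_gt0 ?p0 // pfactorK //.
  by rewrite (logn_coprime (cop _ (dvdnn m))) addn0.
rewrite -dvdn_divisors //= -(@Gauss_dvdr y (p ^ a)); last first.
  by rewrite coprime_sym coprimeXl.
by apply: dvdn_trans hx; rewrite [X in (_ %| X)%N]ey dvdn_mulr.
Qed.

Lemma sum_divisors_pow_mul (V : nmodType) (F : nat -> V) (p a m : nat) :
  prime p -> (0 < m)%N -> ~~ (p %| m)%N ->
  \sum_(x <- divisors (p ^ a * m)) F x =
  \sum_(i < a.+1) \sum_(d <- divisors m) F (p ^ i * d)%N.
Proof.
move=> pp m0 pm; rewrite (perm_big _ (perm_divisors_pow_mul a pp m0 pm)).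
rewrite big_allpairs_dep.
by rewrite -(big_mkord xpredT (fun i => \sum_(d <- divisors m) F (p ^ i * d)%N)) /index_iota subn0.
Qed.

Lemma size_divisors_pow_mul (p a m : nat) : prime p -> (0 < m)%N -> ~~ (p %| m)%N ->
  size (divisors (p ^ a * m)) = (a.+1 * size (divisors m))%N.
Proof.
move=> pp m0 pm; rewrite (perm_size (perm_divisors_pow_mul a pp m0 pm)).
by rewrite size_allpairs size_iota.
Qed.

(** Each step strips the full power of the least prime divisor, which leaves a coprime cofactor. *)
Lemma prime_part_ind (P : nat -> Prop) : P 1%N ->
  (forall p a m, prime p -> (0 < a)%N -> (0 < m)%N -> ~~ (p %| m)%N -> P m -> P (p ^ a * m)%N) ->
  forall n, (0 < n)%N -> P n.
Proof.
move=> P1 Pm n; elim/ltn_ind: n => n IH n0.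
case: (leqP n 1) => n1; first by have -> : n = 1%N by move: n0 n1; clear; lia.
have pp := pdiv_prime n1.
have [m cm e] := pfactor_coprime pp n0.
have m0 : (0 < m)%N by move: n0; rewrite e muln_gt0 => /andP[].
have a0 : (0 < logn (pdiv n) n)%N by rewrite logn_gt0 mem_primes pp n0 pdiv_dvd.
rewrite e mulnC; apply: Pm => //; first by rewrite -prime_coprime.
apply: IH => //; rewrite [X in (_ < X)%N]e ltn_Pmulr //.
by rewrite -(exp1n (logn (pdiv n) n)) ltn_exp2r // prime_gt1.
Qed.

(** The divisor count of n is the product of a + 1 over its prime powers p^a. Always a + 1 <= K p^(a
    eps), and for p >= P, with P above 2^(1 / eps), even a + 1 <= 2^a <= p^(a eps). So at most P
    primes cost a factor K. *)
Lemma divisor_bound (R : realType) (eps : R) : 0 < eps ->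
  exists2 C : R, 1 <= C & forall n : nat, (0 < n)%N -> (size (divisors n))%:R <= C * n%:R `^ eps.
Proof.
move=> e0.
have ln2 : 0 < ln (2 : R) by rewrite ln_gt0 // ltr1n.
pose K : R := 1 + (eps * ln 2)^-1.
have el : 0 < eps * ln (2 : R) by rewrite mulr_gt0.
have K1 : 1 <= K by rewrite lerDl invr_ge0 ltW.
have K0 : 0 <= K by exact: le_trans K1.
have hK (a : nat) : a.+1%:R <= K * (2 ^+ a) `^ eps.
  have -> : (2 ^+ a : R) `^ eps = expR (a%:R * (eps * ln 2)).
    rewrite /powR gt_eqF ?exprn_gt0 // lnXn // -mulr_natl; congr expR; ring.
  have h := expR_ge1Dx (a%:R * (eps * ln (2 : R))).
  apply: le_trans (_ : K * (1 + a%:R * (eps * ln 2)) <= _); last first.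
    by rewrite ler_wpM2l //; lra.
  have h1 : (eps * ln 2)^-1 * (a%:R * (eps * ln 2)) = a%:R :> R.
    by rewrite mulrCA mulVf ?mulr1 // gt_eqF.
  have -> : K * (1 + a%:R * (eps * ln 2)) = 1 + (eps * ln 2)^-1 + a%:R * (eps * ln 2)
     + (eps * ln 2)^-1 * (a%:R * (eps * ln 2)) by rewrite /K; ring.
  rewrite h1 -natr1.
  have : 0 <= (eps * ln (2 : R))^-1 by rewrite invr_ge0 ltW.
  have : 0 <= a%:R * (eps * ln (2 : R)) by rewrite mulr_ge0 // ltW.
  by lra.
have [P hP] : exists P : nat, forall p a : nat, (P <= p)%N -> a.+1%:R <= (p%:R ^+ a) `^ eps :> R.
  exists (Num.trunc ((2 : R) `^ eps^-1)).+1 => p a Pp.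
  have p2 : (2 : R) `^ eps^-1 <= p%:R.
    by apply: ltW; apply: lt_le_trans (truncnS_gt _) _; rewrite ler_nat.
  have p2' : 2 <= (p%:R : R) `^ eps.
    have := @ge0_ler_powR R eps (ltW e0) ((2 : R) `^ eps^-1) p%:R.
    rewrite !nnegrE powR_ge0 ler0n -powRrM mulVf ?gt_eqF // powRr1 //; exact.
  have -> : (p%:R ^+ a : R) `^ eps = (p%:R `^ eps) ^+ a.
    by rewrite -(powR_mulrn a (ler0n R p)) -(powR_mulrn a (powR_ge0 p%:R eps)) powRAC.
  apply: le_trans (_ : 2 ^+ a <= _); last by rewrite lerXn2r // nnegrE // powR_ge0.
  by rewrite -natrX ler_nat ltn_expl.
clearbody K.
exists (K ^+ P); first by rewrite exprn_ege1.
(* Induction on a strict bound for the prime divisors; the exponent [minn B P] stops growing once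
   only large primes are added. *)
suff claim : forall B n, (0 < n)%N -> (forall p, prime p -> (p %| n)%N -> (p < B)%N) ->
   (size (divisors n))%:R <= K ^+ (minn B P) * n%:R `^ eps.
  move=> n n0; apply: le_trans (claim n.+1 n n0 _) _.
    by move=> p pp pn; rewrite ltnS dvdn_leq.
  by rewrite ler_wpM2r ?powR_ge0 // ler_weXn2l // geq_minr.
elim=> [|B IH] n n0 hn.
  case: (leqP n 1) => n1; last by have := hn _ (pdiv_prime n1) (pdiv_dvd n).
  have -> : n = 1%N by move: n0 n1; clear; lia.
  by rewrite min0n expr0 mul1r powR1.
case: (boolP (prime B && (B %| n)%N)) => [/andP[pB Bn]|nB]; last first.
  apply: le_trans (IH n n0 _) _.
    move=> p pp pn; have := hn p pp pn; rewrite ltnS leq_eqVlt => /predU1P[e|//].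
    by move: nB; rewrite -e pp pn.
  by rewrite ler_wpM2r ?powR_ge0 // ler_weXn2l // leq_min geq_minr geq_min leqnSn.
have [m cm e] := pfactor_coprime pB n0.
have m0 : (0 < m)%N by move: n0; rewrite e muln_gt0 => /andP[].
set a := logn B n in e.
have Bm : ~~ (B %| m)%N by rewrite -prime_coprime.
have IHm : (size (divisors m))%:R <= K ^+ minn B P * m%:R `^ eps.
  apply: IH => // p pp pm.
  have := hn p pp; rewrite e dvdn_mulr // => /(_ isT); rewrite ltnS leq_eqVlt => /predU1P[e'|//].
  by move: Bm; rewrite -e' pm.
rewrite e mulnC size_divisors_pow_mul // natrM [in leRHS]natrM powRM // natrX.
have p1 : 0 <= K ^+ minn B P * m%:R `^ eps by rewrite mulr_ge0 ?powR_ge0 // exprn_ge0.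
have -> : K ^+ minn B.+1 P * ((B%:R ^+ a) `^ eps * m%:R `^ eps) =
  (K ^+ (minn B.+1 P - minn B P) * (B%:R ^+ a) `^ eps) * (K ^+ minn B P * m%:R `^ eps).
  have {1}-> : minn B.+1 P = ((minn B.+1 P - minn B P) + minn B P)%N.
    by rewrite subnK // leq_min geq_minr geq_min leqnSn.
  by rewrite exprD; ring.
rewrite ler_pM //.
case: (leqP P B) => PB.
  apply: le_trans (hP B a PB) _; rewrite -[leLHS]mul1r ler_wpM2r ?powR_ge0 //.
  by rewrite exprn_ege1.
have -> : (minn B.+1 P - B = 1)%N by move: PB; clear; lia.
rewrite expr1; apply: le_trans (hK a) _; rewrite ler_wpM2l //.
apply: ge0_ler_powR; rewrite ?nnegrE ?exprn_ge0 //; first exact: ltW.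
by rewrite lerXn2r // ?nnegrE // ler_nat prime_gt1.
Qed.

(** * The von Mangoldt and Moebius functions *)

Definition mangoldt (R : realType) (n : nat) : R :=
  if primes n is [:: p] then ln p%:R else 0.

Lemma mangoldt1 (R : realType) : mangoldt R 1 = 0.
Proof. by []. Qed.

Lemma mangoldt_ge0 (R : realType) (n : nat) : 0 <= mangoldt R n.
Proof.
rewrite /mangoldt; case e : (primes n) => [|p [|]] //.
have : p \in primes n by rewrite e mem_head.
by rewrite mem_primes => /and3P[/prime_gt0 p0 _ _]; rewrite ln_ge0 // ler1n.
Qed.

Lemma mangoldt_pow (R : realType) (p a : nat) : prime p -> (0 < a)%N ->
  mangoldt R (p ^ a) = ln p%:R.
Proof. by move=> pp a0; rewrite /mangoldt primesX // primes_prime. Qed.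

Lemma primes_pow_mul (p a m : nat) : prime p -> (0 < a)%N -> (0 < m)%N -> ~~ (p %| m)%N ->
  perm_eq (primes (p ^ a * m)) (p :: primes m).
Proof.
move=> pp a0 m0 pm; apply: uniq_perm; first exact: primes_uniq.
  by rewrite /= primes_uniq andbT mem_primes pp m0.
by move=> x; rewrite primesM ?expn_gt0 ?(prime_gt0 pp) // inE primesX // primes_prime // inE.
Qed.

Lemma mangoldt_pow_mul (R : realType) (p a m : nat) :
  prime p -> (0 < a)%N -> (1 < m)%N -> ~~ (p %| m)%N -> mangoldt R (p ^ a * m) = 0.
Proof.
move=> pp a0 m1 pm; have m0 := ltnW m1.
have := perm_size (primes_pow_mul pp a0 m0 pm); rewrite /mangoldt /=.
have : (0 < size (primes m))%N.
  have : pdiv m \in primes m by rewrite mem_primes pdiv_prime // m0 pdiv_dvd.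
  by case: (primes m).
by case: (size (primes m)) => // k _; case: (primes _) => [|? [|]].
Qed.

(** In passing from m to p^a m, a new divisor p^i d with i > 0 contributes only when d = 1; this
    happens a times with value ln p. *)
Lemma sum_mangoldt (R : realType) (n : nat) : (0 < n)%N ->
  \sum_(d <- divisors n) mangoldt R d = ln n%:R.
Proof.
move: n; apply: prime_part_ind; first by rewrite /divisors /= big_seq1 mangoldt1 ln1.
move=> p a m pp a0 m0 pm IH.
rewrite sum_divisors_pow_mul // big_ord_recl /=.
under eq_bigr do rewrite expn0 mul1n.
rewrite IH (eq_bigr (fun=> ln p%:R)); last first.
  move=> i _; rewrite (bigD1_seq 1%N) ?divisors_uniq //=; last first.
    by rewrite -dvdn_divisors // dvd1n.
  rewrite muln1 mangoldt_pow // big1_seq ?addr0 // => d /andP[d1].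
  rewrite -dvdn_divisors // => dm; rewrite mangoldt_pow_mul //.
    by have := dvdn_gt0 m0 dm; move: d1; clear; lia.
  by apply: contra pm => h; exact: dvdn_trans dm.
have p0 := prime_gt0 pp.
rewrite sumr_const card_ord natrM natrX lnM ?posrE ?exprn_gt0 ?ltr0n // lnXn ?ltr0n //.
by rewrite addrC.
Qed.

Lemma mangoldt_le_ln (R : realType) (n : nat) : (0 < n)%N -> mangoldt R n <= ln n%:R.
Proof.
move=> n0; rewrite -sum_mangoldt // (bigD1_seq n) ?divisors_uniq //=; last first.
  by rewrite -dvdn_divisors.
by rewrite lerDl sumr_ge0 // => d _; exact: mangoldt_ge0.
Qed.

Definition moebius (R : realType) (n : nat) : R :=
  if all (fun p => logn p n == 1%N) (primes n) then (-1) ^+ size (primes n) else 0.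

Lemma moebius_norm (R : realType) (n : nat) : `|moebius R n| <= 1.
Proof. by rewrite /moebius; case: all; rewrite ?normr0 // normrX normrN1 expr1n. Qed.

Lemma moebius_pow_mul (R : realType) (p a m : nat) : prime p -> (0 < a)%N -> (0 < m)%N ->
  ~~ (p %| m)%N -> moebius R (p ^ a * m) = if a == 1%N then - moebius R m else 0.
Proof.
move=> pp a0 m0 pm; have pe := primes_pow_mul pp a0 m0 pm.
have pa0 : (0 < p ^ a)%N by rewrite expn_gt0 prime_gt0.
rewrite /moebius (perm_all _ pe) (perm_size pe) /= lognM // pfactorK //.
have -> : logn p m = 0%N by rewrite logn_coprime // prime_coprime.
rewrite addn0; case: eqP => [->|//] /=.
have -> : all (fun q => logn q (p ^ 1 * m) == 1%N) (primes m) =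
    all (fun q => logn q m == 1%N) (primes m).
  apply: eq_in_all => q; rewrite mem_primes => /and3P[qp _ qm].
  rewrite lognM ?expn_gt0 ?(prime_gt0 pp) // expn1 logn_prime //.
  by case: (q =P p) => [e|//]; rewrite e in qm; rewrite qm in pm.
by case: all; rewrite ?oppr0 // exprS mulN1r.
Qed.

Lemma moebius1 (R : realType) : moebius R 1 = 1.
Proof. by rewrite /moebius /= expr0. Qed.

(** Only the exponents 0 and 1 of a chosen prime contribute, with opposite signs. *)
Lemma sum_moebius (R : realType) (n : nat) : (1 < n)%N ->
  \sum_(d <- divisors n) moebius R d = 0.
Proof.
move=> n1; have n0 := ltnW n1.
suff h : (0 < n)%N -> n = 1%N \/ \sum_(d <- divisors n) moebius R d = 0.
  by case: (h n0) => // e; rewrite e in n1.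
move: n {n1 n0}; apply: prime_part_ind; first by left.
move=> p a m pp a0 m0 pm _; right.
rewrite sum_divisors_pow_mul //; case: a a0 => // a _.
rewrite big_ord_recl big_ord_recl /= [X in _ + (_ + X)]big1; last first.
  move=> i _; rewrite big1_seq // => d; rewrite -dvdn_divisors // => /andP[_ dm].
  rewrite moebius_pow_mul ?(dvdn_gt0 m0 dm) //.
  by apply: contra pm => h; exact: dvdn_trans dm.
rewrite addr0 -big_split /= big1_seq // => d; rewrite -dvdn_divisors // => /andP[_ dm].
rewrite expn0 mul1n moebius_pow_mul ?(dvdn_gt0 m0 dm) ?subrr //.
by apply: contra pm => h; exact: dvdn_trans dm.
Qed.

(** * Dirichlet convolution and Vaughan's identity *)

Lemma sum_divisorsE (R : realType) (G : nat -> R) (n X : nat) : (0 < n <= X)%N ->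
  \sum_(d <- divisors n) G d = \sum_(1 <= d < X.+1) (d %| n)%N%:R * G d.
Proof.
move=> /andP[n0 nX].
have pe : perm_eq (divisors n) [seq d <- index_iota 1 X.+1 | (d %| n)%N].
  apply: uniq_perm; [exact: divisors_uniq|by rewrite filter_uniq // iota_uniq|].
  move=> d; rewrite -dvdn_divisors // mem_filter mem_index_iota.
  case: (boolP (d %| n)%N) => // dn.
  by rewrite (dvdn_gt0 n0 dn) ltnS (leq_trans (dvdn_leq n0 dn) nX).
rewrite (perm_big _ pe) big_filter big_mkcond /=; apply: eq_bigr => d _.
by case: (d %| n)%N; rewrite ?mul1r ?mul0r.
Qed.

Lemma sum_multiples (R : realType) (H : nat -> R) (c X : nat) : (0 < c)%N ->
  \sum_(1 <= e < X.+1) (c %| e)%N%:R * H e =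
  \sum_(1 <= d < X.+1) (c * d <= X)%N%:R * H (c * d)%N.
Proof.
move=> c0.
have s1 (F : nat -> R) (k : nat) : \sum_(1 <= e < X.+1) (e == k)%:R * F e = (0 < k <= X)%N%:R * F k.
  case: (boolP (0 < k <= X)%N) => hk; last first.
    rewrite [RHS]mul0r big_nat_cond big1 // => e /andP[he _].
    by case: eqP => [ee|_]; [move: hk; rewrite -ee -ltnS he|rewrite [LHS]mul0r].
  rewrite (bigD1_seq k) ?iota_uniq ?mem_index_iota ?ltnS //= eqxx big1 ?addr0 //.
  by move=> e /negPf ->; rewrite [LHS]mul0r.
rewrite (eq_big_nat _ _ (F2 := fun e => \sum_(1 <= d < X.+1) (d == e %/ c)%N%:R * ((c %| e)%N%:R * H e))).
  rewrite exchange_big /=; apply: eq_big_nat => d /andP[d0 dX].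
  rewrite (eq_bigr (fun e => (e == c * d)%N%:R * H e)).
    by rewrite s1 muln_gt0 c0 d0.
  move=> e _; rewrite mulrA -natrM mulnb; congr (_%:R * _); congr nat_of_bool.
  apply/andP/eqP => [[/eqP -> h]|->]; first by rewrite mulnC divnK.
  by rewrite mulKn // dvdn_mulr.
move=> e /andP[e0 eX]; rewrite (s1 (fun=> (c %| e)%N%:R * H e)).
case: (boolP (c %| e)%N) => ce; last by rewrite mul0r mulr0.
rewrite divn_gt0 // (dvdn_leq e0 ce) /= (leq_trans (leq_div _ _)) ?mul1r //.
Qed.

Lemma sum_hyperbola (R : realType) (F : nat -> nat -> R) (X : nat) :
  \sum_(1 <= n < X.+1) \sum_(d <- divisors n) F d (n %/ d)%N =
  \sum_(1 <= d < X.+1) \sum_(1 <= m < X.+1) (d * m <= X)%N%:R * F d m.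
Proof.
rewrite (eq_big_nat _ _ (F2 := fun n => \sum_(1 <= d < X.+1) (d %| n)%N%:R * F d (n %/ d)%N)).
  rewrite exchange_big /=; apply: eq_big_nat => d /andP[d0 dX].
  rewrite (sum_multiples (fun n => F d (n %/ d)%N) X d0).
  by apply: eq_bigr => m _; rewrite mulKn.
by move=> n nX; rewrite (@sum_divisorsE _ _ n X) // -ltnS.
Qed.

(** The right side runs over pairs with c d dividing n; this form yields the commutativity and
    associativity of Dirichlet convolution below. *)
Lemma sum_divisors_quot (R : realType) (F : nat -> nat -> R) (n : nat) : (0 < n)%N ->
  \sum_(c <- divisors n) \sum_(d <- divisors (n %/ c)) F c d =
  \sum_(1 <= c < n.+1) \sum_(1 <= d < n.+1) (c * d %| n)%N%:R * F c d.
Proof.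
move=> n0; rewrite (@sum_divisorsE _ _ n n) ?n0 ?leqnn //.
apply: eq_big_nat => c /andP[c0 cn]; case: (boolP (c %| n)%N) => h; last first.
  rewrite [LHS]mul0r big1 // => d _; case: (boolP (c * d %| n)%N) => h'; last by rewrite [LHS]mul0r.
  by move: h; rewrite (dvdn_trans _ h') // dvdn_mulr.
rewrite [LHS]mul1r (@sum_divisorsE _ _ (n %/ c) n); last first.
  by rewrite divn_gt0 // (dvdn_leq n0 h) leq_div.
by apply: eq_bigr => d _; rewrite dvdn_divRL // mulnC.
Qed.

Lemma sum_divisors_swap (R : realType) (F : nat -> nat -> R) (n : nat) : (0 < n)%N ->
  \sum_(c <- divisors n) \sum_(d <- divisors (n %/ c)) F c d =
  \sum_(d <- divisors n) \sum_(c <- divisors (n %/ d)) F c d.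
Proof.
move=> n0; rewrite (sum_divisors_quot _ n0) (sum_divisors_quot (fun d c => F c d) n0).
rewrite exchange_big /=; apply: eq_bigr => d _; apply: eq_bigr => c _.
by rewrite mulnC.
Qed.

Lemma sum_divisors_assoc (R : realType) (F : nat -> nat -> R) (n : nat) : (0 < n)%N ->
  \sum_(e <- divisors n) \sum_(c <- divisors e) F c (e %/ c)%N =
  \sum_(c <- divisors n) \sum_(d <- divisors (n %/ c)) F c d.
Proof.
move=> n0; rewrite (sum_divisors_quot _ n0) (@sum_divisorsE _ _ n n) ?n0 ?leqnn //.
rewrite (eq_big_nat _ _ (F2 := fun e => \sum_(1 <= c < n.+1) (c %| e)%N%:R * ((e %| n)%N%:R * F c (e %/ c)%N))).
  rewrite exchange_big /=; apply: eq_big_nat => c /andP[c0 cn].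
  rewrite (sum_multiples (fun e => (e %| n)%N%:R * F c (e %/ c)%N) n c0).
  apply: eq_bigr => d _; rewrite mulKn //.
  case: (boolP (c * d %| n)%N) => h; last by rewrite mul0r mulr0.
  by rewrite (dvdn_leq n0 h) mul1r.
move=> e /andP[e0 en]; rewrite (@sum_divisorsE _ _ e n); last by rewrite e0 -ltnS.
by rewrite mulr_sumr; apply: eq_bigr => c _; ring.
Qed.

(* In terms of Dirichlet convolution: rho = mu 1_(<= U), tau = rho * 1 and
   kappa = (Lambda 1_(<= U)) * rho. *)
Definition vrho (R : realType) (U d : nat) : R := (d <= U)%N%:R * moebius R d.
Definition vtau (R : realType) (U n : nat) : R := \sum_(d <- divisors n) vrho R U d.
Definition vkappa (R : realType) (U e : nat) : R :=
  \sum_(c <- divisors e) (c <= U)%N%:R * mangoldt R c * vrho R U (e %/ c).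

Lemma vrho_norm (R : realType) (U d : nat) : `|vrho R U d| <= 1.
Proof.
rewrite /vrho normrM -[leRHS]mul1r ler_pM ?moebius_norm //.
by case: (_ <= _)%N; rewrite ?normr0 ?normr1.
Qed.

Lemma vtau_norm (R : realType) (U n : nat) : `|vtau R U n| <= (size (divisors n))%:R.
Proof.
apply: le_trans (ler_norm_sum _ _ _) _.
apply: le_trans (_ : \sum_(d <- divisors n) 1 <= _).
  by apply: ler_sum => d _; exact: vrho_norm.
by rewrite big_const_seq count_predT iter_addr_0.
Qed.

Lemma vkappa_norm (R : realType) (U n : nat) : (0 < n)%N -> `|vkappa R U n| <= ln n%:R.
Proof.
move=> n0; rewrite -sum_mangoldt //; apply: le_trans (ler_norm_sum _ _ _) _.
apply: ler_sum => c _; have := vrho_norm R U (n %/ c); have := mangoldt_ge0 R c.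
move: (mangoldt R c) (vrho R U _) => y z y0 z1.
rewrite normrM -[leRHS]mulr1 ler_pM // normrM (ger0_norm y0).
by case: (c <= U)%N; rewrite ?normr0 ?normr1 ?mul0r ?mul1r.
Qed.

Lemma vkappa_eq0 (R : realType) (U n : nat) : (0 < n)%N -> (U * U < n)%N -> vkappa R U n = 0.
Proof.
move=> n0 h; rewrite /vkappa big1_seq // => c /andP[_]; rewrite -dvdn_divisors // => cn.
case: (leqP c U) => cU; last by rewrite !mul0r.
rewrite /vrho; case: (leqP (n %/ c) U) => cU'; last by rewrite mul0r mulr0.
by move: h; rewrite -(divnK cn) ltnNge leq_mul.
Qed.

Lemma vtau1 (R : realType) (U : nat) : (0 < U)%N -> vtau R U 1 = 1.
Proof. by move=> U0; rewrite /vtau /divisors /= big_seq1 /vrho U0 mul1r moebius1. Qed.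

Lemma vtau_small (R : realType) (U n : nat) : (1 < n <= U)%N -> vtau R U n = 0.
Proof.
move=> /andP[n1 nU]; rewrite -(sum_moebius R n1); apply: eq_big_seq => d.
rewrite -dvdn_divisors ?(ltnW n1) // => /(dvdn_leq (ltnW n1)) dn.
by rewrite /vrho (leq_trans dn nU) mul1r.
Qed.

(** Since ln = Lambda * 1, the first sum is Lambda * tau, and the second is (Lambda 1_(<= U)) * tau.
    Their difference is (Lambda 1_(> U)) * tau. As tau(1) = 1 and tau vanishes on (1, U], what
    remains beyond the third sum is the term c = n, namely Lambda(n). *)
Lemma vaughan (R : realType) (U n : nat) : (0 < U)%N -> (U * U < n)%N ->
  mangoldt R n = \sum_(d <- divisors n) vrho R U d * ln (n %/ d)%:R
    - \sum_(e <- divisors n) vkappa R U e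
    - \sum_(c <- divisors n) ((U < c)%N%:R * mangoldt R c) * ((U < n %/ c)%N%:R * vtau R U (n %/ c)).
Proof.
move=> U0 Un; have n0 : (0 < n)%N by exact: leq_ltn_trans Un.
have -> : \sum_(e <- divisors n) vkappa R U e =
    \sum_(c <- divisors n) (c <= U)%N%:R * mangoldt R c * vtau R U (n %/ c).
  rewrite /vkappa (sum_divisors_assoc (fun c d => (c <= U)%N%:R * mangoldt R c * vrho R U d) n0).
  by apply: eq_bigr => c _; rewrite /vtau mulr_sumr.
have -> : \sum_(d <- divisors n) vrho R U d * ln (n %/ d)%:R =
    \sum_(c <- divisors n) mangoldt R c * vtau R U (n %/ c).
  rewrite (eq_big_seq (fun d => \sum_(c <- divisors (n %/ d)) vrho R U d * mangoldt R c)).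
    rewrite sum_divisors_swap //; apply: eq_bigr => c _.
    by rewrite /vtau mulr_sumr; apply: eq_bigr => d _; rewrite mulrC.
  move=> d; rewrite -dvdn_divisors // => dn; rewrite -mulr_sumr sum_mangoldt //.
  by rewrite divn_gt0 ?(dvdn_gt0 n0 dn) // dvdn_leq.
rewrite -!sumrB (bigD1_seq n) ?divisors_uniq -?dvdn_divisors //= divnn n0 vtau1 //.
rewrite big1_seq => [|c /andP[cn]].
  have U1 : (U < 1)%N = false by rewrite ltnNge U0.
  have nU : (n <= U)%N = false.
    by apply/negbTE; rewrite -ltnNge (leq_ltn_trans _ Un) // leq_pmulr.
  by rewrite U1 nU !(mul0r, mulr0, mulr1, subr0, addr0).
rewrite -dvdn_divisors // => dc.
have c0 := dvdn_gt0 n0 dc; have cn' : (c < n)%N by rewrite ltn_neqAle cn dvdn_leq.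
have q1 : (1 < n %/ c)%N by rewrite ltn_divRL // mul1n.
case: (leqP c U) => cU /=; first by ring.
case: (leqP (n %/ c) U) => qU /=; last by ring.
by rewrite vtau_small ?q1 //; ring.
Qed.

Lemma vaughan_sum (R : realType) (w : nat -> R) (U N : nat) : (0 < U)%N -> (U * U <= N)%N ->
  \sum_(1 <= n < (16 * N).+1) (in_range N n)%:R * (mangoldt R n * w n) =
  \sum_(1 <= d < (16 * N).+1) \sum_(1 <= m < (16 * N).+1)
     (in_range N (d * m))%:R * (vrho R U d * ln m%:R * w (d * m)%N)
  - \sum_(1 <= d < (16 * N).+1) \sum_(1 <= m < (16 * N).+1)
     (in_range N (d * m))%:R * (vkappa R U d * w (d * m)%N)
  - \sum_(1 <= d < (16 * N).+1) \sum_(1 <= m < (16 * N).+1)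
     (in_range N (d * m))%:R * (((U < d)%N%:R * mangoldt R d) * ((U < m)%N%:R * vtau R U m) * w (d * m)%N).
Proof.
move=> U0 UN.
have key (F : nat -> nat -> R) :
  \sum_(1 <= n < (16 * N).+1) (in_range N n)%:R * (\sum_(d <- divisors n) F d (n %/ d)%N * w n) =
  \sum_(1 <= d < (16 * N).+1) \sum_(1 <= m < (16 * N).+1) (in_range N (d * m))%:R * (F d m * w (d * m)%N).
  rewrite (eq_big_nat _ _ (F2 := fun n => \sum_(d <- divisors n)
     (in_range N (d * (n %/ d)))%:R * (F d (n %/ d)%N * w (d * (n %/ d))%N))).
    rewrite (sum_hyperbola (fun d m => (in_range N (d * m))%:R * (F d m * w (d * m)%N))).
    apply: eq_bigr => d _; apply: eq_bigr => m _; rewrite mulrA -natrM mulnb /in_range.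
    by rewrite andbCA andbb.
  move=> n /andP[n0 _]; rewrite mulr_sumr; apply: eq_big_seq => d.
  by rewrite -dvdn_divisors // => dn; rewrite [(d * _)%N]mulnC divnK.
rewrite -(key (fun d m => vrho R U d * ln m%:R)) -(key (fun d m => vkappa R U d)).
rewrite -(key (fun d m => ((U < d)%N%:R * mangoldt R d) * ((U < m)%N%:R * vtau R U m))).
rewrite -!sumrB; apply: eq_big_nat => n /andP[n0 _].
case: (boolP (in_range N n)) => [/andP[Nn _]|_]; last by rewrite !mul0r; ring.
rewrite (@vaughan R U n) ?(leq_ltn_trans UN) // -!mulr_suml; ring.
Qed.

(** * Chebyshev's bounds *)

Lemma ln_nat_ge0 (R : realType) (n : nat) : 0 <= ln (n%:R : R).
Proof. by case: n => [|n]; [rewrite ln0|rewrite ln_ge0 // ler1n]. Qed.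

Definition lnfact (R : realType) (n : nat) : R := \sum_(1 <= k < n.+1) ln k%:R.
Definition chebyshev_psi (R : realType) (n : nat) : R := \sum_(1 <= k < n.+1) mangoldt R k.

(** Legendre's formula. Any [X] past [n] may end the sum, so that the expansions of ln (2n)! and ln
    n! can be compared term by term. *)
Lemma lnfactE (R : realType) (n X : nat) : (n <= X)%N ->
  lnfact R n = \sum_(1 <= d < X.+1) (n %/ d)%:R * mangoldt R d.
Proof.
move=> nX; rewrite /lnfact.
rewrite (eq_big_nat _ _ (F2 := fun k => \sum_(1 <= d < X.+1) (d %| k)%N%:R * mangoldt R d)).
  rewrite exchange_big /=; apply: eq_big_nat => d /andP[d0 _].
  rewrite -mulr_suml; congr (_ * _).
  rewrite (eq_bigr (fun k => (d %| k)%N%:R * 1)); last by move=> k _; rewrite mulr1.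
  rewrite (sum_multiples (fun=> 1 : R) n d0).
  rewrite (big_cat_nat (n := (n %/ d).+1)) //=; last by rewrite ltnS leq_div.
  rewrite [X in _ + X](_ : _ = 0) ?addr0; last first.
    rewrite big_nat_cond big1 // => k /andP[/andP[h _] _].
    by rewrite mulnC -leq_divRL // leqNgt h mul0r.
  rewrite (eq_big_nat _ _ (F2 := fun=> 1)).
    by rewrite sumr_const_nat subn1.
  move=> k /andP[_ h]; rewrite mulnC -leq_divRL // -ltnS h; exact: mul1r.
move=> k /andP[k0 kn]; rewrite -sum_mangoldt // (@sum_divisorsE _ _ k X) // k0.
by rewrite ltnS in kn; exact: leq_trans kn nX.
Qed.

Lemma lnfactS (R : realType) (n : nat) : lnfact R n.+1 = lnfact R n + ln n.+1%:R.
Proof. by rewrite /lnfact big_nat_recr. Qed.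

(** The middle term is the logarithm of the central binomial coefficient. Its step from n to n + 1
    is ln 2 + ln (2n + 1) - ln (n + 1), which lies between ln 2 and 2 ln 2. *)
Lemma central_lnfact (R : realType) (n : nat) :
  n%:R * ln 2 <= lnfact R n.*2 - 2 * lnfact R n <= 2 * n%:R * ln 2.
Proof.
elim: n => [|n /andP[IH1 IH2]].
  by rewrite double0 /lnfact !big_geq // !(mulr0, mul0r) subr0 lexx.
rewrite doubleS !lnfactS.
have e1 : ln (n.*2.+2%:R : R) = ln 2 + ln n.+1%:R.
  by rewrite -doubleS -mul2n natrM lnM ?posrE ?ltr0n.
have h1 : ln (n.+1%:R : R) <= ln n.*2.+1%:R.
  by rewrite ler_ln ?posrE ?ltr0n // ler_nat -addnn ltnS leq_addr.
have h2 : ln (n.*2.+1%:R : R) <= ln 2 + ln n.+1%:R.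
  by rewrite -e1 ler_ln ?posrE ?ltr0n // ler_nat.
move: e1 h1 h2 IH1 IH2; move: (ln n.*2.+2%:R) (ln n.+1%:R) (ln n.*2.+1%:R) => a b c.
move=> e1 h1 h2 IH1 IH2; rewrite -natr1.
by rewrite !(mulrDl, mulrDr) mul1r; apply/andP; split; lra.
Qed.

Lemma ln2_ge_half (R : realType) : 2^-1 <= ln (2 : R).
Proof.
have := expR_ge1Dx (- ln (2 : R)); rewrite expRN lnK ?posrE //; lra.
Qed.

(** The coefficient [2n / d] - 2 [n / d] of Lambda(d) is at most 1. *)
Lemma chebyshev_lower (R : realType) (n : nat) : n%:R * ln 2 <= chebyshev_psi R n.*2.
Proof.
have /andP[h _] := central_lnfact R n; apply: le_trans h _.
have n2 : (n <= n.*2)%N by rewrite -addnn leq_addr.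
rewrite (lnfactE R (leqnn n.*2)) (lnfactE R n2) mulr_sumr -sumrB.
apply: ler_sum_nat => d /andP[d0 _]; rewrite mulrA -mulrBl -[leRHS]mul1r.
rewrite ler_wpM2r ?mangoldt_ge0 // lerBlDr -natrM nat1r ler_nat.
have := divn_eq n d; have := divn_eq n.*2 d.
have := ltn_pmod n.*2 d0; have := ltn_pmod n d0.
move: (n %/ d)%N (n.*2 %/ d)%N (n %% d)%N (n.*2 %% d)%N => u v r s hr hs h1 h2.
suff : (v * d < (2 * u + 2) * d)%N by rewrite ltn_pmul2r //; clear; lia.
move: hr hs h1 h2; clear; nia.
Qed.

(** The same coefficient is nonnegative, and it is at least 1 for n < d <= 2n. *)
Lemma chebyshev_step (R : realType) (n : nat) :
  chebyshev_psi R n.*2 <= chebyshev_psi R n + 2 * n%:R * ln 2.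
Proof.
have /andP[_ h] := central_lnfact R n; rewrite -lerBlDl; apply: le_trans h.
have n2 : (n <= n.*2)%N by rewrite -addnn leq_addr.
rewrite (lnfactE R (leqnn n.*2)) (lnfactE R n2) mulr_sumr -sumrB.
rewrite /chebyshev_psi (big_cat_nat (n := n.+1)) //= addrAC subrr add0r.
rewrite [leRHS](big_cat_nat (n := n.+1)) //=.
apply: ler_wpDl.
  rewrite big_nat_cond; apply: sumr_ge0 => d /andP[/andP[d0 _] _].
  rewrite mulrA -mulrBl mulr_ge0 ?mangoldt_ge0 // subr_ge0 -natrM ler_nat.
  by rewrite leq_divRL // -mulnA -muln2 mulnC leq_mul // leq_trunc_div.
apply: ler_sum_nat => d /andP[dn d2]; rewrite mulrA -mulrBl -[leLHS]mul1r.
rewrite ler_wpM2r ?mangoldt_ge0 // (divn_small dn) mulr0 subr0 (ler_nat R 1).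
by rewrite divn_gt0 // (leq_trans _ dn).
Qed.

Lemma chebyshev_pow2 (R : realType) (k : nat) : chebyshev_psi R (2 ^ k) <= 2 * (2 ^ k)%:R * ln 2.
Proof.
elim: k => [|k IH].
  rewrite expn0 /chebyshev_psi big_nat1 mangoldt1 !mulr_ge0 //.
  by have := ln2_ge_half R; lra.
rewrite expnS mul2n; apply: le_trans (chebyshev_step R _) _.
have -> : ((2 ^ k).*2)%:R = 2 * (2 ^ k)%:R :> R by rewrite -mul2n natrM.
by lra.
Qed.

Lemma chebyshev_psi_le (R : realType) (m n : nat) : (m <= n)%N ->
  chebyshev_psi R m <= chebyshev_psi R n.
Proof.
move=> mn; rewrite /chebyshev_psi [leRHS](big_cat_nat (n := m.+1)) //= lerDl.
by apply: sumr_ge0 => d _; exact: mangoldt_ge0.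
Qed.

(** psi(16 N) >= 8 N ln 2, and psi(N) <= 4 N ln 2 by way of a power of 2 between N and 2 N; finally
    ln 2 >= 1/2. *)
Lemma chebyshev_interval (R : realType) (N : nat) : (0 < N)%N ->
  2 * N%:R <= \sum_(1 <= n < (16 * N).+1) (in_range N n)%:R * mangoldt R n.
Proof.
move=> N0.
have h1 := chebyshev_lower R (8 * N).
have h2 : chebyshev_psi R N <= 4 * N%:R * ln 2.
  have /andP[t1 t2] := trunc_log_bounds (isT : 1 < 2)%N N0.
  apply: le_trans (chebyshev_psi_le R (ltnW t2)) _; apply: le_trans (chebyshev_pow2 R _) _.
  rewrite ler_wpM2r //; first by have := ln2_ge_half R; lra.
  have t3 : (2 ^ trunc_log 2 N)%:R <= N%:R :> R by rewrite ler_nat.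
  by rewrite expnS natrM; lra.
have e : \sum_(1 <= n < (16 * N).+1) (in_range N n)%:R * mangoldt R n =
    chebyshev_psi R (16 * N) - chebyshev_psi R N.
  rewrite /chebyshev_psi [X in _ = X - _](big_cat_nat (n := N.+1)) //=; last by rewrite ltnS leq_pmull.
  rewrite (big_cat_nat (n := N.+1)) //=; last by rewrite ltnS leq_pmull.
  rewrite [X in X + _](_ : _ = 0); last first.
    rewrite big_nat_cond big1 // => n /andP[/andP[_ h] _].
    by rewrite /in_range ltnNge -ltnS h [LHS]mul0r.
  rewrite add0r addrAC subrr add0r; apply: eq_big_nat => n /andP[h1' h2'].
  by rewrite /in_range h1' -ltnS h2' mul1r.
rewrite e.
have -> : (16 * N = (8 * N).*2)%N by rewrite -mul2n mulnA.
have := ln2_ge_half R; have : 1 <= N%:R :> R by rewrite ler1n.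
rewrite natrM in h1.
move: h1 h2; move: (N%:R : R) (ln (2 : R)) => x y h1 h2 x1 y1.
have : x * 2^-1 <= x * y by rewrite ler_wpM2l //; lra.
by lra.
Qed.

(** Only p^k with k >= 2 counts: p^2 <= X forces p < s, and 2^k <= X forces k < J. *)
Lemma mangoldt_nonprime_sum (R : realType) (X s J : nat) : (X < s * s)%N -> (X < 2 ^ J)%N ->
  \sum_(1 <= n < X.+1) (~~ prime n)%:R * mangoldt R n <= s%:R * J%:R * ln X%:R.
Proof.
move=> Xs XJ.
apply: (@le_trans _ _ (\sum_(1 <= n < X.+1) \sum_(p < s) \sum_(k < J) (n == p ^ k)%N%:R * ln X%:R)).
  apply: ler_sum_nat => n /andP[n0 nX]; rewrite ltnS in nX.
  have lX := ln_nat_ge0 R X.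
  have nn : 0 <= \sum_(p < s) \sum_(k < J) (n == p ^ k)%N%:R * ln (X%:R : R).
    by apply: sumr_ge0 => p _; apply: sumr_ge0 => k _; rewrite mulr_ge0.
  have [np|np] := boolP (prime n); first by rewrite [leLHS]mul0r.
  rewrite [leLHS]mul1r.
  have [e|ne] := eqVneq (mangoldt R n) 0; first by rewrite e.
  have [p [k [pp k1 e]]] : exists p k, [/\ prime p, (1 < k)%N & n = (p ^ k)%N].
    move: ne; rewrite /mangoldt; case ep : (primes n) => [|p [|]]; rewrite ?eqxx // => _.
    have pin : p \in primes n by rewrite ep mem_head.
    move: pin; rewrite mem_primes => /and3P[pp _ pn].
    have [m cm em] := pfactor_coprime pp n0.
    have m1 : m = 1%N.
      apply/eqP; rewrite eqn_leq; apply/andP; split; last first.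
        by move: n0; rewrite em muln_gt0 => /andP[].
      rewrite leqNgt; apply/negP => m1.
      have : pdiv m \in primes n.
        by rewrite mem_primes pdiv_prime // n0 em dvdn_mulr // pdiv_dvd.
      rewrite ep inE => /eqP e; have := pdiv_dvd m; rewrite e.
      by move: cm; rewrite prime_coprime // => /negPf->.
    have en : n = (p ^ logn p n)%N by rewrite [LHS]em m1 mul1n.
    exists p, (logn p n); split => //.
    case E : (logn p n) => [|[|k]] //; rewrite E in en.
      by move: pn; rewrite en expn0 dvdn1 => /eqP p1; rewrite p1 in pp.
    by move: np; rewrite en expn1 pp.
  have ps : (p < s)%N.
    rewrite ltnNge; apply/negP => sp; have : (s * s <= n)%N; last first.
      by rewrite leqNgt (leq_ltn_trans nX Xs).
    rewrite e; apply: leq_trans (leq_mul sp sp) _.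
    by rewrite mulnn leq_exp2l // prime_gt1.
  have kJ : (k < J)%N.
    rewrite -(@ltn_exp2l 2) // (leq_ltn_trans _ XJ) // (leq_trans _ nX) // e.
    by rewrite leq_exp2r ?prime_gt1 // ltnW.
  rewrite (bigD1 (Ordinal ps)) //= (bigD1 (Ordinal kJ)) //= -e eqxx mul1r -addrA.
  apply: ler_wpDr.
    apply: addr_ge0; first by apply: sumr_ge0 => j _; rewrite mulr_ge0.
    by apply: sumr_ge0 => q _; apply: sumr_ge0 => j _; rewrite mulr_ge0.
  apply: le_trans (mangoldt_le_ln R n0) _.
  by rewrite ler_ln ?posrE ?ltr0n // ?ler_nat // (leq_trans n0).
rewrite exchange_big /=; apply: (@le_trans _ _ (\sum_(p < s) \sum_(k < J) ln (X%:R : R))).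
  apply: ler_sum => p _; rewrite exchange_big /=; apply: ler_sum => k _.
  rewrite -mulr_suml -[leRHS]mul1r ler_wpM2r ?ln_nat_ge0 //.
  apply: le_trans (_ : \sum_(0 <= n < X.+1) (n == p ^ k)%N%:R <= _).
    by rewrite [leRHS]big_nat_recl // big_add1 /= lerDr.
  by rewrite big_mkord sum_indic_le.
rewrite !sumr_const !card_ord -mulrnA -[leLHS]mulr_natl natrM.
by apply: le_of_eq; ring.
Qed.

(** * Detecting a point in a box modulo 1 *)

(* The squared modulus of a trigonometric polynomial, in real form. *)
Definition trig_sq (R : realType) (n : nat) (s : nat -> R) (x : R) : R :=
  (\sum_(j < n) s j * ec (j%:R * x)) ^+ 2 + (\sum_(j < n) s j * es (j%:R * x)) ^+ 2.

Lemma trig_sq_ge0 (R : realType) (n : nat) (s : nat -> R) (x : R) : 0 <= trig_sq n s x.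
Proof. by rewrite addr_ge0 // sqr_ge0. Qed.

Lemma trig_sqE (R : realType) (n : nat) (s : nat -> R) (x : R) :
  trig_sq n s x = \sum_(i < n) \sum_(j < n) s i * s j * ec ((i%:R - j%:R) * x).
Proof.
rewrite /trig_sq (sqr_sum_trig (fun i : 'I_n => s i) (fun i : 'I_n => i%:R * x)).
by apply: eq_bigr => i _; apply: eq_bigr => j _; rewrite mulrBl.
Qed.

Lemma trig_sq_le (R : realType) (n : nat) (s : nat -> R) (x : R) :
  trig_sq n s x <= (\sum_(i < n) `|s i|) ^+ 2.
Proof.
rewrite trig_sqE expr2 mulr_suml; apply: ler_sum => i _; rewrite mulr_sumr.
apply: ler_sum => j _; apply: le_trans (ler_norm _) _; rewrite !normrM -[leRHS]mulr1.
by rewrite ler_wpM2l ?ec_max ?mulr_ge0.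
Qed.

(** Both squares are expanded. The terms with i = j and k = l carry no oscillation and form the main
    term; all others are bounded by [B0]. *)
Lemma trig_sq_product_sum (R : realType) (X n1 n2 : nat) (W x y s t : nat -> R) (B0 : R)
    (Psi := \sum_(1 <= n < X.+1) W n) : 0 <= B0 ->
  (forall i j k l : nat, (i < n1)%N -> (j < n1)%N -> (k < n2)%N -> (l < n2)%N ->
     (i != j) || (k != l) ->
     `|\sum_(1 <= n < X.+1) W n * ec ((i%:R - j%:R) * x n + (k%:R - l%:R) * y n)| <= B0) ->
  `|\sum_(1 <= n < X.+1) W n * (trig_sq n1 s (x n) * trig_sq n2 t (y n))
    - Psi * ((\sum_(i < n1) s i ^+ 2) * (\sum_(k < n2) t k ^+ 2))| <=
  B0 * ((\sum_(i < n1) `|s i|) ^+ 2 * (\sum_(k < n2) `|t k|) ^+ 2).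
Proof.
move=> B00 hB.
pose E (i j k l : nat) := \sum_(1 <= n < X.+1) W n * (ec ((i%:R - j%:R) * x n) * ec ((k%:R - l%:R) * y n)).
have hE (i j : 'I_n1) (k l : 'I_n2) : (i != j) || (k != l) -> `|E i j k l| <= B0.
  move=> h.
  (* A product of two cosines is half the sum of two cosines, the second with k and l
     interchanged. *)
  have -> : E i j k l = 2^-1 * (\sum_(1 <= n < X.+1) W n * ec ((i%:R - j%:R) * x n + (k%:R - l%:R) * y n)
      + \sum_(1 <= n < X.+1) W n * ec ((i%:R - j%:R) * x n + (l%:R - k%:R) * y n)).
    rewrite -big_split /= mulr_sumr; apply: eq_bigr => n _.
    have -> : (l%:R - k%:R) * y n = - ((k%:R - l%:R) * y n) by ring.
    by rewrite ecB ecD; field.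
  have h1 := hB i j k l (ltn_ord i) (ltn_ord j) (ltn_ord k) (ltn_ord l) h.
  have h2 : `|\sum_(1 <= n < X.+1) W n * ec ((i%:R - j%:R) * x n + (l%:R - k%:R) * y n)| <= B0.
    by apply: hB => //; rewrite (eq_sym (l : nat)).
  rewrite normrM ger0_norm ?invr_ge0 //; have := ler_normD (\sum_(1 <= n < X.+1) W n * ec ((i%:R - j%:R) * x n + (k%:R - l%:R) * y n)) (\sum_(1 <= n < X.+1) W n * ec ((i%:R - j%:R) * x n + (l%:R - k%:R) * y n)).
  by lra.
have hE0 i k : E i i k k = Psi.
  by apply: eq_bigr => n _; rewrite !subrr !mul0r ec0 !mulr1.
clearbody Psi.
have -> : \sum_(1 <= n < X.+1) W n * (trig_sq n1 s (x n) * trig_sq n2 t (y n)) =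
  \sum_(i < n1) \sum_(j < n1) \sum_(k < n2) \sum_(l < n2) (s i * s j) * (t k * t l) * E i j k l.
  rewrite (eq_bigr (fun n => \sum_(i < n1) \sum_(j < n1) \sum_(k < n2) \sum_(l < n2)
     (s i * s j) * (t k * t l) * (W n * (ec ((i%:R - j%:R) * x n) * ec ((k%:R - l%:R) * y n))))).
    rewrite exchange_big /=; apply: eq_bigr => i _.
    rewrite exchange_big /=; apply: eq_bigr => j _.
    rewrite exchange_big /=; apply: eq_bigr => k _.
    rewrite exchange_big /=; apply: eq_bigr => l _.
    by rewrite mulr_sumr.
  move=> n _; rewrite !trig_sqE mulr_suml mulr_sumr; apply: eq_bigr => i _.
  rewrite mulr_suml mulr_sumr; apply: eq_bigr => j _.
  rewrite !mulr_sumr; apply: eq_bigr => k _; rewrite !mulr_sumr; apply: eq_bigr => l _; ring.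
have -> : Psi * ((\sum_(i < n1) s i ^+ 2) * (\sum_(k < n2) t k ^+ 2)) =
  \sum_(i < n1) \sum_(j < n1) \sum_(k < n2) \sum_(l < n2)
    (s i * s j) * (t k * t l) * (((i == j) && (k == l))%:R * Psi).
  rewrite mulr_suml mulr_sumr; apply: eq_bigr => i _.
  rewrite [RHS](bigD1 i) //= [X in _ = _ + X]big1 ?addr0; last first.
    move=> j /negPf ji; rewrite big1 // => k _; rewrite big1 // => l _.
    by rewrite eq_sym ji [(false && _)%:R * _]mul0r mulr0.
  rewrite mulr_sumr mulr_sumr; apply: eq_bigr => k _.
  rewrite [RHS](bigD1 k) //= [X in _ = _ + X]big1 ?addr0; last first.
    by move=> l /negPf lk; rewrite eq_sym lk andbF [false%:R * _]mul0r mulr0.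
  by rewrite !eqxx [(true && true)%:R * _]mul1r; ring.
rewrite -sumrB.
have -> : B0 * ((\sum_(i < n1) `|s i|) ^+ 2 * (\sum_(k < n2) `|t k|) ^+ 2) =
  \sum_(i < n1) \sum_(j < n1) \sum_(k < n2) \sum_(l < n2) `|(s i * s j) * (t k * t l)| * B0.
  rewrite !expr2 mulr_suml mulr_suml mulr_sumr; apply: eq_bigr => i _.
  rewrite mulr_sumr mulr_suml mulr_sumr; apply: eq_bigr => j _.
  rewrite mulr_suml !mulr_sumr; apply: eq_bigr => k _.
  rewrite !mulr_sumr; apply: eq_bigr => l _; rewrite !normrM; ring.
apply: le_trans (ler_norm_sum _ _ _) _; apply: ler_sum => i _; rewrite -sumrB.
apply: le_trans (ler_norm_sum _ _ _) _; apply: ler_sum => j _; rewrite -sumrB.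
apply: le_trans (ler_norm_sum _ _ _) _; apply: ler_sum => k _; rewrite -sumrB.
apply: le_trans (ler_norm_sum _ _ _) _; apply: ler_sum => l _; rewrite -mulrBr normrM.
apply: ler_wpM2l => //.
case: (boolP ((i == j) && (k == l))) => [/andP[/eqP -> /eqP ->]|h].
  by rewrite hE0 [true%:R * _]mul1r subrr normr0.
by rewrite [false%:R * _]mul0r subr0 hE // -negb_and.
Qed.

(* [tentd] is the difference sequence of [tent]; differencing the coefficients
   multiplies the kernel by 2 (1 - cos (2 pi x)), which is bounded below when [x] is
   away from the integers. *)
Definition tent (J j : nat) : nat := minn j (J.*2 - j).
Definition tentd (R : realType) (J j : nat) : R :=
  if j is j'.+1 then (tent J j)%:R - (tent J j')%:R else 0.

Lemma tentd_norm (R : realType) (J j : nat) : `|tentd R J j| <= 1.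
Proof.
case: j => [|j]; first by rewrite normr0.
have : ((tent J j.+1 <= (tent J j).+1)%N && (tent J j <= (tent J j.+1).+1)%N).
  by rewrite /tent; clear; lia.
case/andP; rewrite /tentd -!(ler_nat R) -!natr1 => h1 h2.
by rewrite ler_norml; apply/andP; split; lra.
Qed.

Lemma tent_cube (R : realType) (J : nat) :
  J%:R ^+ 3 / 3 <= \sum_(j < J.*2.+1) (tent J j)%:R ^+ 2 :> R.
Proof.
apply: (@le_trans _ _ (\sum_(0 <= j < J.+1) j%:R ^+ 2)).
  elim: J => [|J IH]; first by rewrite expr0n mul0r big_nat1 expr0n.
  rewrite big_nat_recr //=; apply: le_trans (_ : J%:R ^+ 3 / 3 + J.+1%:R ^+ 2 <= _).
    rewrite -natr1; have j0 : 0 <= J%:R :> R by []. nra.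
  by rewrite lerD2r.
rewrite -(big_mkord xpredT (fun j => (tent J j)%:R ^+ 2)).
rewrite [leRHS](big_cat_nat (n := J.+1)) //=; last by rewrite ltnS -addnn leq_addr.
apply: ler_wpDr; first by apply: sumr_ge0 => j _; exact: sqr_ge0.
apply: ler_sum_nat => j /andP[_ h]; rewrite /tent.
by have -> : minn j (J.*2 - j) = j by move: h; clear; lia.
Qed.

Lemma tent_sum (R : realType) (J : nat) : (0 < J)%N ->
  \sum_(j < J.*2.+1) `|(tent J j)%:R : R| <= 3 * J%:R ^+ 2.
Proof.
move=> J0; apply: (@le_trans _ _ (\sum_(j < J.*2.+1) J%:R)).
  apply: ler_sum => j _; rewrite ger0_norm // ler_nat /tent; clear; lia.
rewrite sumr_const card_ord -[leLHS]mulr_natl expr2 mulrA ler_wpM2r //.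
by rewrite -natrM ler_nat; move: J0; clear; lia.
Qed.

Lemma tentd_sum (R : realType) (J : nat) : (0 < J)%N ->
  \sum_(j < J.*2.+1) `|tentd R J j| <= 3 * J%:R.
Proof.
move=> J0; apply: (@le_trans _ _ (\sum_(j < J.*2.+1) 1)).
  by apply: ler_sum => j _; exact: tentd_norm.
by rewrite sumr_const card_ord -natrM ler_nat; move: J0; clear; lia.
Qed.

Lemma tentd_sqr_sum (R : realType) (J : nat) : (0 < J)%N ->
  \sum_(j < J.*2.+1) tentd R J j ^+ 2 <= 3 * J%:R.
Proof.
move=> J0; apply: le_trans (tentd_sum R J0); apply: ler_sum => j _.
rewrite -(real_normK (num_real (tentd R J j))) expr2 -[leRHS]mulr1 ler_wpM2l //.
exact: tentd_norm.
Qed.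

(** Differencing the coefficients multiplies the polynomial by 1 - e(x), of squared modulus 2 (1 -
    cos (2 pi x)). As [tent] vanishes at 0 and 2 J, there are no boundary terms. *)
Lemma trig_sq_tentd (R : realType) (J : nat) (x : R) :
  trig_sq J.*2.+1 (tentd R J) x =
  2 * (1 - ec x) * trig_sq J.*2.+1 (fun j => (tent J j)%:R) x.
Proof.
rewrite /trig_sq.
set C := \sum_(j < _) (tent J j)%:R * ec _; set S := \sum_(j < _) (tent J j)%:R * es _.
have t0 : tent J 0 = 0%N by rewrite /tent min0n.
have tJ : tent J J.*2 = 0%N by rewrite /tent subnn minn0.
have e1 : \sum_(j < J.*2.+1) tentd R J j * ec (j%:R * x) = C - (ec x * C - es x * S).
  have -> : ec x * C - es x * S = \sum_(j < J.*2) (tent J j)%:R * ec (j.+1%:R * x).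
    rewrite /C /S !big_ord_recr /= tJ !mul0r !addr0 !mulr_sumr -sumrB.
    by apply: eq_bigr => j _; rewrite -natr1 mulrDl mul1r ecD; ring.
  rewrite /C !big_ord_recl /= t0 !mul0r !add0r -sumrB.
  by apply: eq_bigr => j _; rewrite /bump /= add1n mulrBl.
have e2 : \sum_(j < J.*2.+1) tentd R J j * es (j%:R * x) = S - (es x * C + ec x * S).
  have -> : es x * C + ec x * S = \sum_(j < J.*2) (tent J j)%:R * es (j.+1%:R * x).
    rewrite /C /S !big_ord_recr /= tJ !mul0r !addr0 !mulr_sumr -big_split /=.
    by apply: eq_bigr => j _; rewrite -natr1 mulrDl mul1r esD; ring.
  rewrite /S !big_ord_recl /= t0 !mul0r !add0r -sumrB.
  by apply: eq_bigr => j _; rewrite /bump /= add1n mulrBl.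
rewrite e1 e2; have := ec2es2 x; move: (ec x) (es x) => c s.
move=> h; clearbody C S.
have hs : s ^+ 2 = 1 - c ^+ 2 by lra.
have -> : (C - (c * C - s * S)) ^+ 2 + (S - (s * C + c * S)) ^+ 2 =
  (1 - 2 * c + c ^+ 2 + s ^+ 2) * (C ^+ 2 + S ^+ 2) by ring.
by rewrite hs; ring.
Qed.

Lemma one_sub_ec_ge (R : realType) (x eta : R) : 0 < eta -> eta <= nd x ->
  eta ^+ 2 <= 2 * (1 - ec x).
Proof.
move=> e0 ex; have [m em /andP[m1 m2]] := nd_ex x.
have -> : ec x = ec (nd x).
  rewrite em -[x in LHS](subrK m%:~R) ecDz.
  case: (leP 0 (x - m%:~R)) => h; first by rewrite ger0_norm.
  by rewrite ltr0_norm // ecN.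
have h2 := nd_le_half x; move: (nd x) ex h2 => t ex h2.
have s1 : eta / 2 <= sin (pi * t).
  by apply: sinpi_ge => //; apply/andP; split; lra.
have -> : ec t = 1 - 2 * sin (pi * t) ^+ 2.
  rewrite /ec (_ : 2 * pi * t = (pi * t) *+ 2); last by rewrite -mulr_natl; ring.
  by rewrite cos_mulr2n cos2sin2; ring.
nra.
Qed.

Lemma tent_weight_ge1 (R : realType) (J eta : R) : 6 <= J * eta -> 1 <= J ^+ 2 / 36 * eta ^+ 2.
Proof.
move=> h; have -> : J ^+ 2 / 36 * eta ^+ 2 = (J * eta) ^+ 2 / 36 by field.
by nra.
Qed.

(** If no good n lies in the box, the weighted sum of [F] is at most the share of the bad n, 81 (J1
    J2)^4 Z. Its main term is at least half of Psi (J1^3 / 3)(J2^3 / 3), which explains 18 = 2 * 9,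
    and the errors come to 81 + 9/4 + 9/4 <= 86 times (J1 J2)^4 B0. *)
Lemma detect (R : realType) (X J1 J2 : nat) (W x y : nat -> R) (G : pred nat)
    (B0 Z eta1 eta2 : R) :
  (0 < J1)%N -> (0 < J2)%N -> 0 <= B0 -> (forall n, 0 <= W n) ->
  (forall h k : int, (h != 0) || (k != 0) ->
     (`|h| <= J1.*2)%N -> (`|k| <= J2.*2)%N ->
     `|\sum_(1 <= n < X.+1) W n * ec (h%:~R * x n + k%:~R * y n)| <= B0) ->
  0 < eta1 -> 0 < eta2 -> 6 <= J1%:R * eta1 -> 6 <= J2%:R * eta2 ->
  \sum_(1 <= n < X.+1) (~~ G n)%:R * W n <= Z ->
  18 * (J1%:R * J2%:R * (86 * B0 + 81 * Z)) < \sum_(1 <= n < X.+1) W n ->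
  exists n, [/\ (0 < n <= X)%N, G n, W n != 0, nd (x n) < eta1 & nd (y n) < eta2].
Proof.
move=> J10 J20 B00 W0 hB e1 e2 he1 he2 hZ hPsi.
apply: contrapT => hno.
have j1 : 0 < J1%:R :> R by rewrite ltr0n.
have j2 : 0 < J2%:R :> R by rewrite ltr0n.
pose s1 j : R := (tent J1 j)%:R; pose s2 j : R := (tent J2 j)%:R.
pose P n := trig_sq J1.*2.+1 s1 (x n); pose P' n := trig_sq J2.*2.+1 s2 (y n).
pose D n := trig_sq J1.*2.+1 (tentd R J1) (x n); pose D' n := trig_sq J2.*2.+1 (tentd R J2) (y n).
pose a : R := J1%:R ^+ 2 / 36; pose b : R := J2%:R ^+ 2 / 36.
have a0 : 0 <= a by rewrite divr_ge0 // sqr_ge0.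
have b0 : 0 <= b by rewrite divr_ge0 // sqr_ge0.
have hB' (n1 n2 : nat) (i j k l : nat) : (n1 <= J1.*2.+1)%N -> (n2 <= J2.*2.+1)%N ->
    (i < n1)%N -> (j < n1)%N -> (k < n2)%N -> (l < n2)%N -> (i != j) || (k != l) ->
    `|\sum_(1 <= n < X.+1) W n * ec ((i%:R - j%:R) * x n + (k%:R - l%:R) * y n)| <= B0.
  move=> hn1 hn2 hi hj hk hl h.
  have := hB (i%:Z - j%:Z) (k%:Z - l%:Z); rewrite !intrB => H; apply: H.
  - by move: h; clear; lia.
  - by move: hn1 hi hj; clear; lia.
  - by move: hn2 hk hl; clear; lia.
have PP0 n : 0 <= P n * P' n by rewrite mulr_ge0 ?trig_sq_ge0.
have T1 := @trig_sq_product_sum R X _ _ W x y s1 s2 B0 B00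
  (fun i j k l => hB' _ _ i j k l (leqnn _) (leqnn _)).
have T2 := @trig_sq_product_sum R X _ _ W x y (tentd R J1) s2 B0 B00
  (fun i j k l => hB' _ _ i j k l (leqnn _) (leqnn _)).
have T3 := @trig_sq_product_sum R X _ _ W x y s1 (tentd R J2) B0 B00
  (fun i j k l => hB' _ _ i j k l (leqnn _) (leqnn _)).
set Psi := \sum_(1 <= n < X.+1) W n in hPsi T1 T2 T3.
have Psi0 : 0 <= Psi by apply: sumr_ge0.
set S := \sum_(i < _) s1 i ^+ 2 in T1 T3; set T := \sum_(k < _) s2 k ^+ 2 in T1 T2.
set S' := \sum_(i < _) tentd R J1 i ^+ 2 in T2; set T' := \sum_(k < _) tentd R J2 k ^+ 2 in T3.
have hS : J1%:R ^+ 3 / 3 <= S := tent_cube R J1.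
have hT : J2%:R ^+ 3 / 3 <= T := tent_cube R J2.
have hS' : S' <= 3 * J1%:R := tentd_sqr_sum R J10.
have hT' : T' <= 3 * J2%:R := tentd_sqr_sum R J20.
have hs1 : (\sum_(i < J1.*2.+1) `|s1 i|) ^+ 2 <= 9 * J1%:R ^+ 4.
  have -> : 9 * J1%:R ^+ 4 = (3 * J1%:R ^+ 2) ^+ 2 :> R by ring.
  by rewrite lerXn2r ?nnegrE ?sumr_ge0 ?mulr_ge0 ?sqr_ge0 // tent_sum.
have hs2 : (\sum_(i < J2.*2.+1) `|s2 i|) ^+ 2 <= 9 * J2%:R ^+ 4.
  have -> : 9 * J2%:R ^+ 4 = (3 * J2%:R ^+ 2) ^+ 2 :> R by ring.
  by rewrite lerXn2r ?nnegrE ?sumr_ge0 ?mulr_ge0 ?sqr_ge0 // tent_sum.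
have hd1 : (\sum_(i < J1.*2.+1) `|tentd R J1 i|) ^+ 2 <= 9 * J1%:R ^+ 2.
  have -> : 9 * J1%:R ^+ 2 = (3 * J1%:R) ^+ 2 :> R by ring.
  by rewrite lerXn2r ?nnegrE ?sumr_ge0 ?mulr_ge0 // tentd_sum.
have hd2 : (\sum_(i < J2.*2.+1) `|tentd R J2 i|) ^+ 2 <= 9 * J2%:R ^+ 2.
  have -> : 9 * J2%:R ^+ 2 = (3 * J2%:R) ^+ 2 :> R by ring.
  by rewrite lerXn2r ?nnegrE ?sumr_ge0 ?mulr_ge0 // tentd_sum.
(* [F n <= 0] unless both coordinates are close to integers. *)
pose F n := P n * P' n - a * (D n * P' n) - b * (P n * D' n).
have Fup : \sum_(1 <= n < X.+1) W n * F n <= 81 * J1%:R ^+ 4 * J2%:R ^+ 4 * Z.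
  apply: (@le_trans _ _ (\sum_(1 <= n < X.+1) 81 * J1%:R ^+ 4 * J2%:R ^+ 4 * ((~~ G n)%:R * W n))).
    apply: ler_sum_nat => n /andP[n0 nX].
    have Fle : F n <= 81 * J1%:R ^+ 4 * J2%:R ^+ 4.
      apply: (@le_trans _ _ (P n * P' n)).
        have : 0 <= a * (D n * P' n) by rewrite !mulr_ge0 ?trig_sq_ge0.
        have : 0 <= b * (P n * D' n) by rewrite !mulr_ge0 ?trig_sq_ge0.
        by rewrite /F; clear; lra.
      have -> : 81 * J1%:R ^+ 4 * J2%:R ^+ 4 = (9 * J1%:R ^+ 4) * (9 * J2%:R ^+ 4) :> R by ring.
      by rewrite ler_pM ?trig_sq_ge0 //; [apply: le_trans (trig_sq_le _ _ _) hs1|apply: le_trans (trig_sq_le _ _ _) hs2].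
    case: (boolP (G n)) => Gn; last by rewrite [_%:R * W n]mul1r mulrC ler_wpM2r.
    rewrite [_%:R * W n]mul0r mulr0.
    have [->|Wn] := eqVneq (W n) 0; first by rewrite mul0r.
    apply: mulr_ge0_le0; first exact: W0.
    case: (ltP (nd (x n)) eta1) => hx; last first.
      have hh := one_sub_ec_ge e1 hx.
      have : P n <= a * D n.
        rewrite /D trig_sq_tentd -/s1 -/(P n) mulrA -[leLHS]mul1r ler_wpM2r ?trig_sq_ge0 //.
        apply: le_trans (tent_weight_ge1 he1) _; by rewrite ler_wpM2l.
      move=> k; have : P n * P' n <= a * D n * P' n by rewrite ler_wpM2r ?trig_sq_ge0.
      have : 0 <= b * (P n * D' n) by rewrite !mulr_ge0 ?trig_sq_ge0.
      by rewrite /F; clear; lra.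
    case: (ltP (nd (y n)) eta2) => hy; last first.
      have hh := one_sub_ec_ge e2 hy.
      have : P' n <= b * D' n.
        rewrite /D' trig_sq_tentd -/s2 -/(P' n) mulrA -[leLHS]mul1r ler_wpM2r ?trig_sq_ge0 //.
        apply: le_trans (tent_weight_ge1 he2) _; by rewrite ler_wpM2l.
      move=> k; have : P n * P' n <= P n * (b * D' n) by rewrite ler_wpM2l ?trig_sq_ge0.
      have : 0 <= a * (D n * P' n) by rewrite !mulr_ge0 ?trig_sq_ge0.
      by rewrite /F; clear; lra.
    by case: hno; exists n; split => //; rewrite n0 -ltnS.
  by rewrite -mulr_sumr ler_wpM2l // !mulr_ge0 // exprn_ge0.
have eF : \sum_(1 <= n < X.+1) W n * F n =
  \sum_(1 <= n < X.+1) W n * (P n * P' n) - a * (\sum_(1 <= n < X.+1) W n * (D n * P' n))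
  - b * (\sum_(1 <= n < X.+1) W n * (P n * D' n)).
  by rewrite !mulr_sumr -!sumrB; apply: eq_bigr => n _; rewrite /F; ring.
have S0 : 0 <= S by apply: sumr_ge0 => i _; exact: sqr_ge0.
have T0 : 0 <= T by apply: sumr_ge0 => i _; exact: sqr_ge0.
have q1 : 0 <= J1%:R ^+ 4 * J2%:R ^+ 4 :> R by rewrite mulr_ge0 // exprn_ge0.
have U1 : B0 * ((\sum_(i < J1.*2.+1) `|s1 i|) ^+ 2 * (\sum_(k < J2.*2.+1) `|s2 k|) ^+ 2) <=
   B0 * (81 * (J1%:R ^+ 4 * J2%:R ^+ 4)).
  rewrite ler_wpM2l //.
  have -> : 81 * (J1%:R ^+ 4 * J2%:R ^+ 4) = (9 * J1%:R ^+ 4) * (9 * J2%:R ^+ 4) :> R by ring.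
  by rewrite ler_pM ?sqr_ge0.
have U2 : a * (B0 * ((\sum_(i < J1.*2.+1) `|tentd R J1 i|) ^+ 2 * (\sum_(k < J2.*2.+1) `|s2 k|) ^+ 2)) <=
   B0 * (9 / 4 * (J1%:R ^+ 4 * J2%:R ^+ 4)).
  rewrite mulrCA ler_wpM2l //.
  have -> : 9 / 4 * (J1%:R ^+ 4 * J2%:R ^+ 4) = a * ((9 * J1%:R ^+ 2) * (9 * J2%:R ^+ 4)) :> R.
    by rewrite /a; field.
  by rewrite ler_wpM2l // ler_pM ?sqr_ge0.
have U3 : b * (B0 * ((\sum_(i < J1.*2.+1) `|s1 i|) ^+ 2 * (\sum_(k < J2.*2.+1) `|tentd R J2 k|) ^+ 2)) <=
   B0 * (9 / 4 * (J1%:R ^+ 4 * J2%:R ^+ 4)).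
  rewrite mulrCA ler_wpM2l //.
  have -> : 9 / 4 * (J1%:R ^+ 4 * J2%:R ^+ 4) = b * ((9 * J1%:R ^+ 4) * (9 * J2%:R ^+ 2)) :> R.
    by rewrite /b; field.
  by rewrite ler_wpM2l // ler_pM ?sqr_ge0.
move: T1 T2 T3; rewrite !ler_norml => /andP[T1 _] /andP[_ T2] /andP[_ T3].
have {}T2 := ler_wpM2l a0 T2; have {}T3 := ler_wpM2l b0 T3.
(* The differenced coefficients have square sum at most 3 J1, and J1^2 / 36 times this is a quarter
   of J1^3 / 3. So each subtracted kernel takes at most a quarter of the main term. *)
have V1 : a * (Psi * (S' * T)) <= 4^-1 * (Psi * (S * T)).
  have -> : a * (Psi * (S' * T)) = (a * S') * (Psi * T) by ring.
  have -> : 4^-1 * (Psi * (S * T)) = (4^-1 * S) * (Psi * T) by ring.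
  rewrite ler_wpM2r ?mulr_ge0 //; apply: le_trans (ler_wpM2l a0 hS') _.
  have -> : a * (3 * J1%:R) = 4^-1 * (J1%:R ^+ 3 / 3) by rewrite /a; field.
  by rewrite ler_wpM2l.
have V2 : b * (Psi * (S * T')) <= 4^-1 * (Psi * (S * T)).
  have -> : b * (Psi * (S * T')) = (b * T') * (Psi * S) by ring.
  have -> : 4^-1 * (Psi * (S * T)) = (4^-1 * T) * (Psi * S) by ring.
  rewrite ler_wpM2r ?mulr_ge0 //; apply: le_trans (ler_wpM2l b0 hT') _.
  have -> : b * (3 * J2%:R) = 4^-1 * (J2%:R ^+ 3 / 3) by rewrite /b; field.
  by rewrite ler_wpM2l.
have V3 : Psi * (J1%:R ^+ 3 * J2%:R ^+ 3 / 9) <= Psi * (S * T).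
  rewrite ler_wpM2l //.
  have -> : J1%:R ^+ 3 * J2%:R ^+ 3 / 9 = (J1%:R ^+ 3 / 3) * (J2%:R ^+ 3 / 3) :> R by field.
  by rewrite ler_pM // divr_ge0 // exprn_ge0.
have q3 : 0 < J1%:R ^+ 3 * J2%:R ^+ 3 :> R by rewrite mulr_gt0 // exprn_gt0.
have := hPsi; rewrite -(ltr_pM2l q3).
have -> : J1%:R ^+ 3 * J2%:R ^+ 3 * (18 * (J1%:R * J2%:R * (86 * B0 + 81 * Z))) =
  18 * (B0 * (86 * (J1%:R ^+ 4 * J2%:R ^+ 4)) + 81 * J1%:R ^+ 4 * J2%:R ^+ 4 * Z) by ring.
have z4 : 0 <= B0 * (J1%:R ^+ 4 * J2%:R ^+ 4) by rewrite mulr_ge0.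
move: U1 U2 U3 T1 T2 T3 V1 V2 V3 Fup; rewrite eF !mulrBr.
move: (\sum_(1 <= n < X.+1) W n * (P n * P' n)) (\sum_(1 <= n < X.+1) W n * (D n * P' n)) (\sum_(1 <= n < X.+1) W n * (P n * D' n)).
move: (\sum_(i < J1.*2.+1) `|s1 i|) (\sum_(i < J2.*2.+1) `|s2 i|) (\sum_(i < J1.*2.+1) `|tentd R J1 i|) (\sum_(i < J2.*2.+1) `|tentd R J2 i|).
clear -z4 => *; lra.
Qed.

(** * Bilinear sums *)

Definition pair_total (R : realType) (gamma h beta : R) (N L Q : nat) : R :=
  \sum_(q < Q) \sum_(i < L) (pair_ok L q i)%:R *
     `|pair_sum gamma h beta N (L.+1 + i + q) (L.+1 + i)|.

Lemma pair_total_ge0 (R : realType) (gamma h beta : R) (N L Q : nat) :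
  0 <= pair_total gamma h beta N L Q.
Proof. by apply: sumr_ge0 => q _; apply: sumr_ge0 => i _; rewrite mulr_ge0. Qed.

Lemma half_powR_le (R : realType) (gamma n : R) : 0 < gamma < 1 -> 0 < n ->
  (n / 2) `^ (gamma - 1) <= 2 * n `^ (gamma - 1).
Proof.
move=> /andP[g0 g1] n0; rewrite mulrC powRM ?invr_ge0 ?(ltW n0) //.
rewrite ler_wpM2r ?powR_ge0 // -powR_inv1 // -powRrM.
by rewrite -[leRHS]powRr1 // ler_powR; lra.
Qed.

(** [W] measures the derivative of h n^gamma, of order h n^(gamma - 1); passing to n / 2 costs a
    factor 2. *)
Lemma phase_scale_le (R : realType) (gamma h n W : R) : 0 < gamma < 1 -> 0 <= h -> 0 < n ->
  h <= W * n `^ (1 - gamma) -> h * (n / 2) `^ (gamma - 1) <= 2 * W.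
Proof.
move=> g01 h0 n0 hW; have e1 := half_powR_le g01 n0.
apply: le_trans (_ : (W * n `^ (1 - gamma)) * (2 * n `^ (gamma - 1)) <= _).
  by rewrite ler_pM // powR_ge0.
have -> : W * n `^ (1 - gamma) * (2 * n `^ (gamma - 1)) =
  2 * W * (n `^ (1 - gamma) * n `^ (gamma - 1)) by ring.
rewrite -powRD; last by apply/implyP => _; rewrite gt_eqF.
by rewrite (_ : 1 - gamma + (gamma - 1) = 0) ?powRr0 ?mulr1 //; ring.
Qed.

(** In [pair_avg_far] the prefactor is at most 33 N / T, so each remaining term has to be of order N
    T. The condition q0 <= X absorbs the + 1 in the count. The two bounds on D^2 k T^2 then treat
    the terms M and q0 sqrt(M eta) of the layers. *)
Lemma pair_total_far (R : realType) : exists2 C : R, 0 < C &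
  forall (gamma h beta th T W : R) (a0 : int) (q0 k N L Q Y D : nat)
    (M := N%:R / (2 * L%:R) : R),
  0 < gamma < 1 -> 0 <= h -> (0 < L)%N -> 1 <= T -> 1 <= W ->
  T <= Q%:R <= 2 * T -> T ^+ 2 <= Y%:R <= 2 * T ^+ 2 ->
  good_approx th a0 q0 -> (0 < k)%N ->
  (forall x : nat, nd (2 * beta * x%:R) = nd ((k * x)%:R * th)) ->
  (forall n, (0 < n <= Y * (Q * (4 * L)))%N -> (size (divisors n) <= D)%N) ->
  h <= W * N%:R `^ (1 - gamma) -> 16 * W * Q%:R * Y%:R <= M ->
  D%:R ^+ 2 * k%:R * T ^+ 2 <= q0%:R ->
  D%:R ^+ 2 * k%:R * T ^+ 2 * L%:R * Num.sqrt (4 * W * Q%:R * Y%:R) <= N%:R ->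
  (q0 <= k * (Y * (Q * (4 * L))))%N ->
  pair_total gamma h beta N L Q ^+ 2 <= C * N%:R ^+ 2.
Proof.
have [c1 c1E c10] : exists2 c1 : R, 32 * (256 * 216) = c1 & 0 < c1.
  by apply: (ex_intro2 _ _ _ erefl); rewrite !mulr_gt0 ?ltr0n.
exists (33 * (35 + 144 * c1)); first by lra.
move=> gamma h beta th T W a0 q0 k N L Q Y D M g01 h0 L0 T1 W1 /andP[Q1 Q2] /andP[Y1 Y2].
have hMdef : N%:R / (2 * L%:R) = M by [].
clearbody M; move=> ga k0 hb hD hW hM hD1 hD2 hX.
have Lp : 0 < L%:R :> R by rewrite ltr0n.
have q0p : 0 < q0%:R :> R by case: ga => ? _ _; rewrite ltr0n.
have Yp : 1 <= Y%:R :> R by nra.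
have Qp : 1 <= Q%:R :> R by lra.
have QY : 1 <= Q%:R * Y%:R :> R by nra.
have WQY : Q%:R * Y%:R <= W * Q%:R * Y%:R.
  by rewrite -mulrA -[leLHS]mul1r ler_wpM2r //; lra.
have YQY : Y%:R <= Q%:R * Y%:R :> R by rewrite -[leLHS]mul1r ler_wpM2r.
have M1 : 1 <= M by lra.
have Mp : 0 < M by lra.
have YM : Y%:R <= M by lra.
have Y0 : (0 < Y)%N by rewrite -(ltr0n R); lra.
have nLM : N%:R = 2 * L%:R * M by rewrite -hMdef; field; rewrite gt_eqF.
have np : 0 < N%:R :> R by rewrite nLM !mulr_gt0.
(* The smallest threshold that [phase_scale_le] permits; it makes M eta free of L. *)
pose eta := 4 * W * Q%:R * Y%:R / M.
have Meta : M * eta = 4 * W * Q%:R * Y%:R by rewrite /eta mulrC divfK // gt_eqF.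
have eta0 : 0 < eta by rewrite /eta divr_gt0 // -!mulrA mulr_gt0 // mulr_gt0 ?(lt_le_trans _ W1) // (lt_le_trans _ QY).
have eta4 : eta <= 4^-1 by rewrite /eta ler_pdivrMr //; lra.
have Meta1 : 1 <= M * eta by rewrite Meta; lra.
have hetac : 2 * (h * Q%:R * Y%:R * (L%:R * M) `^ (gamma - 1) / M) <= eta.
  have e2 : h * (L%:R * M) `^ (gamma - 1) <= 2 * W.
    by rewrite (_ : L%:R * M = N%:R / 2) ?phase_scale_le // nLM; field.
  have -> : 2 * (h * Q%:R * Y%:R * (L%:R * M) `^ (gamma - 1) / M) =
     2 * (Q%:R * Y%:R / M) * (h * (L%:R * M) `^ (gamma - 1)) by ring.
  have -> : eta = 2 * (Q%:R * Y%:R / M) * (2 * W) by rewrite /eta; ring.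
  by rewrite ler_wpM2l // mulr_ge0 // divr_ge0 ?mulr_ge0 // ltW.
have := @pair_avg_far R gamma h beta th eta a0 q0 k N L Q Y D g01 h0.
rewrite hMdef -/(pair_total gamma h beta N L Q) c1E => key.
apply: le_trans (key M1 Y0 YM L0 ga k0 hb hD eta4 Meta1 hetac) _.
set s := Num.sqrt (M * eta).
have s0 : 0 <= s by exact: sqrtr_ge0.
have hs : D%:R ^+ 2 * k%:R * T ^+ 2 * L%:R * s <= N%:R by rewrite /s Meta.
set X := (k * (Y * (Q * (4 * L))))%N in hX *.
have XE : X%:R = 4 * k%:R * Y%:R * Q%:R * L%:R :> R by rewrite /X !natrM; ring.
clearbody X s.
clear key c1E hetac eta4 Meta1 Meta hM hW hb hD ga hD2 h h0 g01 hMdef YQY QY WQY beta th a0 gamma YM Y0 L0 k0.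
have Yp0 : 0 < Y%:R :> R by exact: lt_le_trans Yp.
have Tp : 0 < T by exact: lt_le_trans T1.
have Wp : 0 < W by exact: lt_le_trans W1.
have Qp0 : 0 < Q%:R :> R by exact: lt_le_trans Qp.
have Xq : 2 * X%:R / q0%:R + 1 <= 3 * X%:R / q0%:R :> R.
  have : 1 <= X%:R / q0%:R :> R by rewrite ler_pdivlMr // mul1r ler_nat.
  by rewrite -!mulrA; lra.
have dk0 : 0 <= D%:R ^+ 2 * k%:R :> R by rewrite mulr_ge0 ?exprn_ge0.
have B3 : D%:R ^+ 2 * ((2 * X%:R / q0%:R + 1) * (c1 * (M + q0%:R * s))) <= 72 * c1 * N%:R * T.
  apply: le_trans (_ : D%:R ^+ 2 * (3 * X%:R / q0%:R * (c1 * (M + q0%:R * s))) <= _).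
    by rewrite ler_wpM2l ?exprn_ge0 // ler_wpM2r // mulr_ge0 ?(ltW c10) ?addr_ge0 ?mulr_ge0 ?(ltW Mp).
  have -> : D%:R ^+ 2 * (3 * X%:R / q0%:R * (c1 * (M + q0%:R * s))) =
     12 * c1 * (D%:R ^+ 2 * k%:R * (Y%:R * Q%:R) * (L%:R * M / q0%:R + L%:R * s)).
    by rewrite XE; field; rewrite gt_eqF.
  have -> : L%:R * M = N%:R / 2 by rewrite nLM; field.
  have YQ4 : Y%:R * Q%:R <= 4 * T ^+ 3.
    have -> : 4 * T ^+ 3 = (2 * T ^+ 2) * (2 * T) by ring.
    by rewrite ler_pM.
  have p : 0 <= N%:R / 2 / q0%:R + L%:R * s.
    by rewrite addr_ge0 ?mulr_ge0 // divr_ge0 ?ltW // divr_gt0.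
  apply: le_trans (_ : 12 * c1 * (D%:R ^+ 2 * k%:R * (4 * T ^+ 3) * (N%:R / 2 / q0%:R + L%:R * s)) <= _).
    by rewrite ler_wpM2l ?mulr_ge0 ?(ltW c10) // ler_wpM2r // ler_wpM2l.
  have -> : 12 * c1 * (D%:R ^+ 2 * k%:R * (4 * T ^+ 3) * (N%:R / 2 / q0%:R + L%:R * s)) =
    48 * c1 * T * (N%:R / 2 * (D%:R ^+ 2 * k%:R * T ^+ 2 / q0%:R) + D%:R ^+ 2 * k%:R * T ^+ 2 * L%:R * s) by ring.
  have -> : 72 * c1 * N%:R * T = 48 * c1 * T * (N%:R / 2 * 1 + N%:R) by field.
  rewrite ler_wpM2l ?mulr_ge0 ?(ltW c10) ?(ltW Tp) //.
  rewrite lerD // ler_wpM2l ?divr_ge0 ?(ltW np) //.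
  by rewrite ler_pdivrMr // mul1r.
have B2 : Q%:R * L%:R * Y%:R * (10 / eta) <= 3 / 2 * N%:R * T.
  have -> : Q%:R * L%:R * Y%:R * (10 / eta) = 5 / 4 * N%:R / W.
    by rewrite /eta nLM; field; rewrite !gt_eqF.
  rewrite ler_pdivrMr //.
  have : 1 <= T * W by rewrite mulr_ege1.
  have nn : 0 <= N%:R :> R by exact: ltW.
  move=> tw; have -> : 3 / 2 * N%:R * T * W = 3 / 2 * (N%:R * (T * W)) by ring.
  have : N%:R * 1 <= N%:R * (T * W) by rewrite ler_wpM2l.
  by move: nn; clear; lra.
have B1 : 32 * Q%:R * L%:R * M <= 32 * N%:R * T.
  have -> : 32 * Q%:R * L%:R * M = 16 * N%:R * Q%:R by rewrite nLM; ring.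
  have : N%:R * Q%:R <= N%:R * (2 * T) by rewrite ler_wpM2l // ltW.
  by clear; lra.
have PP : Q%:R * L%:R * (33 * M / Y%:R) <= 33 * N%:R / T.
  have -> : Q%:R * L%:R * (33 * M / Y%:R) = 33 / 2 * N%:R * (Q%:R / Y%:R).
    by rewrite nLM; field; rewrite gt_eqF.
  have -> : 33 * N%:R / T = 33 / 2 * N%:R * (2 / T) by field; rewrite gt_eqF.
  rewrite ler_wpM2l ?mulr_ge0 //.
  rewrite ler_pdivrMr // mulrAC ler_pdivlMr //.
  apply: le_trans (_ : 2 * T * T <= _); first by rewrite ler_wpM2r // ltW.
  by move: Y1; clear; rewrite expr2; lra.
rewrite mulrA.
apply: le_trans (_ : (33 * N%:R / T) * ((35 + 144 * c1) * N%:R * T) <= _).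
  have Ms : 0 <= M + q0%:R * s by rewrite addr_ge0 ?mulr_ge0 // ltW.
  have X0 : 0 <= 2 * X%:R / q0%:R + 1 :> R by rewrite addr_ge0 // divr_ge0 ?mulr_ge0.
  rewrite ler_pM //.
  - by rewrite !mulr_ge0 ?invr_ge0 // ltW.
  - rewrite addr_ge0 ?mulr_ge0 ?(ltW Mp) // addr_ge0 ?mulr_ge0 ?invr_ge0 ?(ltW eta0) ?exprn_ge0 //.
    exact: ltW c10.
  - by move: B1 B2 B3; clear; lra.
by apply: le_of_eq; field; rewrite gt_eqF.
Qed.

(** The Kusmin-Landau bounds carry the inverse derivative N^(1 - gamma) / h with h >= 1. Two
    harmonic sums, over l - l' and over the shifts, complete the factor that has to stay below T. *)
Lemma pair_total_zero (R : realType) (gamma : R) : 0 < gamma < 1 -> exists2 C : R, 0 < C &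
  forall (h T W : R) (N L Q Y : nat) (M := N%:R / (2 * L%:R) : R),
  1 <= h -> (0 < L)%N -> 1 <= T -> 1 <= W ->
  T <= Q%:R <= 2 * T -> T ^+ 2 <= Y%:R <= 2 * T ^+ 2 ->
  h <= W * N%:R `^ (1 - gamma) -> 16 * W * Q%:R * Y%:R <= M ->
  N%:R `^ (1 - gamma) * (harm R Q * harm R Y) <= T ->
  pair_total gamma h 0 N L Q ^+ 2 <= C * N%:R ^+ 2.
Proof.
move=> g01; have /andP[g0 g1] := g01.
have [cg cgE cg0] : exists2 c : R, gamma ^+ 2 * (1 - gamma) = c & 0 < c.
  by apply: (ex_intro2 _ _ _ erefl); rewrite mulr_gt0 ?exprn_gt0 ?subr_gt0.
have [c2 c2E c20] : exists2 c : R, 5 * 35 ^+ 2 = c & 0 < c.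
  by apply: (ex_intro2 _ _ _ erefl); rewrite !mulr_gt0 ?exprn_gt0 ?ltr0n.
exists (33 * (32 + c2 / cg)).
  by rewrite mulr_gt0 ?ltr0n // addr_gt0 ?divr_gt0 ?ltr0n.
move=> h T W N L Q Y M h1 L0 T1 W1 /andP[Q1 Q2] /andP[Y1 Y2].
have hMdef : N%:R / (2 * L%:R) = M by [].
clearbody M; move=> hW hM hT.
have Lp : 0 < L%:R :> R by rewrite ltr0n.
have hp : 0 < h by exact: lt_le_trans h1.
have Tp : 0 < T by exact: lt_le_trans T1.
have Yp : 1 <= Y%:R :> R by apply: le_trans Y1; rewrite exprn_ege1.
have Qp : 1 <= Q%:R :> R by exact: le_trans Q1.
have Yp0 : 0 < Y%:R :> R by exact: lt_le_trans Yp.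
have QY : 1 <= Q%:R * Y%:R :> R by rewrite mulr_ege1.
have WQY : Q%:R * Y%:R <= W * Q%:R * Y%:R.
  by rewrite -mulrA -[leLHS]mul1r ler_wpM2r //; move: QY; clear; lra.
have YQY : Y%:R <= Q%:R * Y%:R :> R by rewrite -[leLHS]mul1r ler_wpM2r.
have M1 : 1 <= M by move: WQY QY hM; clear; rewrite -!(mulrA 16); lra.
have Mp : 0 < M by exact: lt_le_trans M1.
have YM : Y%:R <= M by move: WQY QY YQY hM; clear; rewrite -!(mulrA 16); lra.
have Y0 : (0 < Y)%N by rewrite -(ltr0n R).
have nLM : N%:R = 2 * L%:R * M by rewrite -hMdef; field; rewrite gt_eqF.
have np : 0 < N%:R :> R by rewrite nLM !mulr_gt0.
have LM : L%:R * M = N%:R / 2 by rewrite nLM; field.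
have hc : h * Q%:R * Y%:R * (L%:R * M) `^ (gamma - 1) / M <= 2^-1.
  have e2 : h * (L%:R * M) `^ (gamma - 1) <= 2 * W by rewrite LM phase_scale_le // ltW.
  rewrite ler_pdivrMr //.
  have -> : h * Q%:R * Y%:R * (L%:R * M) `^ (gamma - 1) =
    Q%:R * Y%:R * (h * (L%:R * M) `^ (gamma - 1)) by ring.
  apply: le_trans (_ : Q%:R * Y%:R * (2 * W) <= _).
    by rewrite ler_wpM2l // (le_trans _ QY).
  by move: WQY QY hM; clear; lra.
have := @pair_avg_zero R gamma h N L Q Y g01 hp.
rewrite hMdef -/(pair_total gamma h 0 N L Q) cgE c2E => key.
apply: le_trans (key M1 Y0 YM L0 hc) _.
set H := harm R Q * harm R Y in hT *.
have -> : L%:R * (c2 * M / (h * cg * N%:R `^ (gamma - 1))) * harm R Q * harm R Y =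
   c2 / cg * (L%:R * M) * (N%:R `^ (1 - gamma) * H) / h.
  have -> : 1 - gamma = - (gamma - 1) by ring.
  by rewrite powRN /H; field; rewrite !gt_eqF ?powR_gt0.
rewrite LM.
move: hT; set E := N%:R `^ (1 - gamma) * H => hT.
clear key hMdef hc hW hM WQY YQY cgE c2E g0 g1 g01.
clearbody E; clear H.
have B2 : c2 / cg * (N%:R / 2) * E / h <= c2 / cg * (N%:R / 2) * T.
  rewrite -[leLHS]mulrA ler_wpM2l ?mulr_ge0 ?invr_ge0 ?(ltW c20) ?(ltW cg0) //.
  rewrite ler_pdivrMr //; apply: le_trans hT _.
  by rewrite -[leLHS]mulr1 ler_wpM2l // ltW.
have B1 : 32 * Q%:R * L%:R * M <= 32 * N%:R * T.
  have -> : 32 * Q%:R * L%:R * M = 16 * N%:R * Q%:R by rewrite nLM; ring.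
  have : N%:R * Q%:R <= N%:R * (2 * T) by rewrite ler_wpM2l // ltW.
  by clear; lra.
have PP : Q%:R * L%:R * (33 * M / Y%:R) <= 33 * N%:R / T.
  have -> : Q%:R * L%:R * (33 * M / Y%:R) = 33 / 2 * N%:R * (Q%:R / Y%:R).
    by rewrite nLM; field; rewrite gt_eqF.
  have -> : 33 * N%:R / T = 33 / 2 * N%:R * (2 / T) by field; rewrite gt_eqF.
  rewrite ler_wpM2l ?mulr_ge0 //.
  rewrite ler_pdivrMr // mulrAC ler_pdivlMr //.
  apply: le_trans (_ : 2 * T * T <= _); first by rewrite ler_wpM2r // ltW.
  by move: Y1; clear; rewrite expr2; lra.
rewrite mulrA.
apply: le_trans (_ : (33 * N%:R / T) * ((32 + c2 / cg) * N%:R * T) <= _).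
  apply: le_trans (_ : Q%:R * L%:R * (33 * M / Y%:R) * ((32 + c2 / cg) * N%:R * T) <= _).
    rewrite ler_wpM2l ?mulr_ge0 ?invr_ge0 ?(ltW Mp) //.
    by move: B1 B2; clear; lra.
  have p0 : 0 <= 32 + c2 / cg by apply/ltW; rewrite addr_gt0 ?divr_gt0 ?ltr0n.
  by rewrite ler_wpM2r // mulr_ge0 ?mulr_ge0 // ltW.
by apply: le_of_eq; field; rewrite !gt_eqF.
Qed.

Definition bilinear (R : realType) (gamma h beta c : R) (N : nat) (v u : nat -> R) (a b : nat) : R :=
  \sum_(a <= d < b) \sum_(1 <= m < (16 * N).+1)
    (in_range N (d * m))%:R * (v d * u m * ec (phase gamma h beta c (d * m))).

Lemma bilinear_block (R : realType) (gamma h beta c A0 B0 K T : R) (N L Q : nat)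
    (v u : nat -> R) :
  (Q <= L)%N -> (L <= 16 * N)%N -> 0 < T -> T <= Q%:R ->
  0 <= A0 -> 0 <= B0 ->
  (forall m, `|u m| <= A0) -> (forall l, `|v l| <= B0) ->
  pair_total gamma h beta N L Q <= K * N%:R ->
  bilinear gamma h beta c N v u L.+1 (L + L).+1 ^+ 2 <=
    (A0 * B0 * N%:R) ^+ 2 * (64 * (16 + 2 * K) / T).
Proof.
move=> QL LN Tp TQ A00 B00 hu hv hK.
have Qp : 0 < Q%:R :> R by exact: lt_le_trans TQ.
have Q0 : (0 < Q)%N by rewrite -(ltr0n R).
have L0 : (0 < L)%N by exact: leq_trans QL.
have -> : bilinear gamma h beta c N v u L.+1 (L + L).+1 =
  \sum_(i < L) \sum_(m < (16 * N %/ L).+1) (in_range N ((L.+1 + i) * m))%:R *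
     (v (L.+1 + i)%N * u m * ec (phase gamma h beta c ((L.+1 + i) * m))).
  rewrite /bilinear -{1}[L.+1]add0n big_addn (_ : ((L + L).+1 - L.+1)%N = L); last by clear; lia.
  rewrite big_mkord; apply: eq_bigr => i _; rewrite [(i + _)%N]addnC.
  rewrite -(big_mkord xpredT (fun m => (in_range N ((L.+1 + i) * m))%:R *
     (v (L.+1 + i)%N * u m * ec (phase gamma h beta c ((L.+1 + i) * m))))).
  rewrite [RHS]big_nat_recl // muln0 /in_range ltn0 [X in X + _]mul0r add0r.
  have le16 : ((16 * N %/ L).+1 <= (16 * N).+1)%N by rewrite ltnS leq_div.
  rewrite -(big_add1 _ _ 0 (16 * N %/ L).+1 xpredT (fun m => ((N < (L.+1 + i) * m) && ((L.+1 + i) * m <= 16 * N))%N%:R *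
     (v (L.+1 + i)%N * u m * ec (phase gamma h beta c ((L.+1 + i) * m))))).
  rewrite (@big_cat_nat _ _ _ (16 * N %/ L).+1) //= [X in _ + X]big_nat_cond [X in _ + X]big1 ?addr0 //.
  move=> m /andP[/andP[hm _] _].
  have : (16 * N < (L.+1 + i) * m)%N.
    have Li : (L <= L.+1 + i)%N by rewrite addSn ltnW // ltnS leq_addr.
    by apply: leq_trans (leq_mul Li (leqnn m)); rewrite [(L * m)%N]mulnC -ltn_divLR.
  by rewrite ltnNge => /negbTE ->; rewrite andbF [LHS]mul0r.
apply: le_trans (bilinear_cauchy gamma h beta c Q0 QL LN hu hv) _.
rewrite -/(pair_total gamma h beta N L Q).
have -> : (A0 * B0 * N%:R) ^+ 2 * (64 * (16 + 2 * K) / T) =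
  A0 ^+ 2 * B0 ^+ 2 * (64 * N%:R / T) * (16 * N%:R + 2 * (K * N%:R)) by ring.
have P0 := pair_total_ge0 gamma h beta N L Q.
apply: ler_pM.
- by rewrite mulr_ge0 ?mulr_ge0 ?exprn_ge0 ?invr_ge0 ?mulr_ge0 ?(ltW Qp).
- by rewrite addr_ge0 ?mulr_ge0.
- rewrite ler_wpM2l ?mulr_ge0 ?exprn_ge0 // ler_wpM2l ?mulr_ge0 // lef_pV2 ?posrE //.
- by rewrite lerD2l ler_wpM2l.
Qed.

Lemma bilinear_dyadic (R : realType) (gamma h beta c B : R) (N U I : nat) (v u : nat -> R) :
  (forall d, (d <= U)%N -> v d = 0) ->
  (forall i, (i < I)%N -> `|bilinear gamma h beta c N v u (2 ^ i * U).+1 (2 ^ i * U + 2 ^ i * U).+1| <= B) ->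
  `|bilinear gamma h beta c N v u 1 (2 ^ I * U).+1| <= I%:R * B.
Proof.
move=> hv; elim: I => [|I IH] hB.
  rewrite mul0r expn0 mul1n /bilinear big_nat_cond big1 ?normr0 // => d /andP[/andP[_ dU] _].
  by rewrite big1 // => m _; rewrite hv // !mul0r mulr0.
have -> : bilinear gamma h beta c N v u 1 (2 ^ I.+1 * U).+1 =
  bilinear gamma h beta c N v u 1 (2 ^ I * U).+1 +
  bilinear gamma h beta c N v u (2 ^ I * U).+1 (2 ^ I * U + 2 ^ I * U).+1.
  have -> : (2 ^ I.+1 * U = 2 ^ I * U + 2 ^ I * U)%N by rewrite expnS; ring.
  by rewrite /bilinear -big_cat_nat //= ltnS leq_addr.
rewrite -natr1 mulrDl mul1r; apply: le_trans (ler_normD _ _) _.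
by rewrite lerD ?hB // IH // => i iI; apply: hB; exact: ltnW.
Qed.

Lemma bilinear_swap (R : realType) (gamma h beta c : R) (N : nat) (v u : nat -> R) :
  bilinear gamma h beta c N v u 1 (16 * N).+1 = bilinear gamma h beta c N u v 1 (16 * N).+1.
Proof.
rewrite /bilinear exchange_big_nat /=; apply: eq_bigr => d _; apply: eq_bigr => m _.
by rewrite mulnC [v _ * _]mulrC.
Qed.

(* In the range [d * m <= 16 * N] one of [d], [m] is at most [P]; it becomes the
   first variable. *)
Lemma bilinear_split (R : realType) (gamma h beta c : R) (N P : nat) (v u : nat -> R) :
  (16 * N <= P * P)%N -> (P <= 16 * N)%N ->
  bilinear gamma h beta c N v u 1 (16 * N).+1 =
  bilinear gamma h beta c N v u 1 P.+1 +
  bilinear gamma h beta c N u (fun d => (P < d)%N%:R * v d) 1 P.+1.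
Proof.
move=> h1 h2.
have -> : bilinear gamma h beta c N v u 1 (16 * N).+1 = bilinear gamma h beta c N v u 1 P.+1 +
   bilinear gamma h beta c N v u P.+1 (16 * N).+1 by rewrite /bilinear -big_cat_nat.
congr (_ + _).
have -> : bilinear gamma h beta c N v u P.+1 (16 * N).+1 =
  bilinear gamma h beta c N (fun d => (P < d)%N%:R * v d) u 1 (16 * N).+1.
  rewrite /bilinear [RHS](@big_cat_nat _ _ _ P.+1) //=.
  rewrite [X in _ = X + _]big_nat_cond [X in _ = X + _]big1 ?add0r; last first.
    move=> d /andP[/andP[_ dP] _]; rewrite big1 // => m _.
    by rewrite ltnNge -ltnS dP [_%:R * v d]mul0r !mul0r mulr0.
  by apply: eq_big_nat => d /andP[Pd _]; apply: eq_bigr => m _; rewrite Pd [_%:R * v d]mul1r.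
rewrite bilinear_swap /bilinear (@big_cat_nat _ _ _ P.+1) //= [X in _ + X]big_nat_cond [X in _ + X]big1 ?addr0 //.
move=> m /andP[/andP[Pm _] _]; rewrite big1 // => d _.
case: (ltnP P d) => Pd; last by rewrite [_%:R * v d]mul0r mulr0 mul0r mulr0.
have : (16 * N < m * d)%N by apply: leq_ltn_trans h1 _; exact: ltn_mul.
by rewrite /in_range ltnNge => /negbTE ->; rewrite andbF [LHS]mul0r.
Qed.

(** P = 2^I Q is the first such number with P^2 >= 16 N. The doubling blocks up to P thus start at
    some L with L^2 <= 16 N, where the hypothesis on [pair_total] applies, to both halves of
    [bilinear_split]. *)
Lemma bilinear_total (R : realType) (gamma h beta c A0 B0 K T : R) (N Q J : nat)
    (v u : nat -> R) :
  0 < T -> T <= Q%:R -> (Q <= 16 * N)%N -> (16 * N <= 4 ^ J)%N -> 0 <= K ->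
  (forall m, `|u m| <= A0) -> (forall d, `|v d| <= B0) ->
  (forall m, (m <= Q)%N -> u m = 0) -> (forall d, (d <= Q)%N -> v d = 0) ->
  (forall L, (Q <= L)%N -> (L * L <= 16 * N)%N -> pair_total gamma h beta N L Q <= K * N%:R) ->
  `|bilinear gamma h beta c N v u 1 (16 * N).+1| <=
    2 * J%:R * (A0 * B0 * N%:R * Num.sqrt (64 * (16 + 2 * K) / T)).
Proof.
move=> Tp TQ QN NJ K0 hu hv hu0 hv0 hP.
have Q0 : (0 < Q)%N by rewrite -(ltr0n R); exact: lt_le_trans TQ.
have A00 : 0 <= A0 by apply: le_trans (hu 0%N).
have B00 : 0 <= B0 by apply: le_trans (hv 0%N).
have exI : exists I, (16 * N <= (2 ^ I * Q) * (2 ^ I * Q))%N.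
  exists J; apply: leq_trans NJ _; rewrite (_ : 4 = 2 * 2)%N // expnMn.
  by apply: leq_mul; exact: leq_pmulr.
case: (ex_minnP exI) => I hI Imin.
have IJ : (I <= J)%N.
  apply: Imin; apply: leq_trans NJ _; rewrite (_ : 4 = 2 * 2)%N // expnMn.
  by apply: leq_mul; exact: leq_pmulr.
have small i : (i < I)%N -> ((2 ^ i * Q) * (2 ^ i * Q) < 16 * N)%N.
  by move=> iI; rewrite ltnNge; apply/negP => /Imin; rewrite leqNgt iI.
have PN : (2 ^ I * Q <= 16 * N)%N.
  case: I hI Imin IJ small => [|I] _ _ _ small; first by rewrite mul1n.
  have := small I (ltnSn I); rewrite expnS -[(2 * _ * _)%N]mulnA.
  by move: (2 ^ I * Q)%N => [|[|x]]; clear; [lia|lia|nia].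
have blk1 (v' u' : nat -> R) (a b : R) i : (forall m, `|u' m| <= a) -> (forall d, `|v' d| <= b) ->
    0 <= a -> 0 <= b -> a * b = A0 * B0 -> (i < I)%N ->
    `|bilinear gamma h beta c N v' u' (2 ^ i * Q).+1 (2 ^ i * Q + 2 ^ i * Q).+1| <=
      A0 * B0 * N%:R * Num.sqrt (64 * (16 + 2 * K) / T).
  move=> hu' hv' a0 b0 eab iI.
  have LL := ltnW (small _ iI).
  have QL : (Q <= 2 ^ i * Q)%N by rewrite leq_pmull // expn_gt0.
  have L16 : (2 ^ i * Q <= 16 * N)%N.
    by apply: leq_trans PN; rewrite leq_mul2r leq_exp2l // (ltnW iI) orbT.
  have := bilinear_block c QL L16 Tp TQ a0 b0 hu' hv' (hP _ QL LL).
  rewrite eab => hb; rewrite -sqrtr_sqr.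
  have e : A0 * B0 * N%:R = Num.sqrt ((A0 * B0 * N%:R) ^+ 2).
    by rewrite sqrtr_sqr ger0_norm // !mulr_ge0.
  by rewrite e -sqrtrM ?exprn_ge0 ?mulr_ge0 // ler_wsqrtr.
rewrite (bilinear_split _ _ _ _ _ _ hI PN); apply: le_trans (ler_normD _ _) _.
set B := A0 * B0 * N%:R * _ in blk1 *.
have B_ge0 : 0 <= B by rewrite /B !mulr_ge0 // sqrtr_ge0.
have IB : I%:R * B <= J%:R * B by rewrite ler_wpM2r // ler_nat.
have -> : 2 * J%:R * B = J%:R * B + J%:R * B by ring.
apply: lerD; apply: le_trans IB; apply: bilinear_dyadic => // i iI.
  exact: (blk1 _ _ A0 B0).
apply: (blk1 _ _ B0 A0) => //; last by rewrite mulrC.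
move=> d; rewrite normrM; apply: le_trans (hv d); rewrite -[leRHS]mul1r ler_wpM2r //.
by case: (_ < _)%N; rewrite ?normr0 ?normr1.
Qed.

(** * The sum over primes *)

Lemma phase_dilate (R : realType) (gamma h beta c : R) (d n : nat) :
  phase gamma h beta c (d * n) =
  (h * d%:R `^ gamma) * n%:R `^ gamma + (beta * d%:R ^+ 2) * n%:R ^+ 2 + c.
Proof. by rewrite /phase natrM powRM // exprMn !mulrA. Qed.

Lemma dilated_range (R : realType) (N d b n : nat) : (0 < d)%N ->
  (b <= (16 * N %/ d).+1)%N -> ((N %/ d).+1 <= n < b)%N ->
  N%:R / d%:R <= (n%:R : R) <= 32 * (N%:R / d%:R).
Proof.
move=> d0 hb /andP[h1 h2]; have dp : 0 < d%:R :> R by rewrite ltr0n.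
rewrite ler_pdivrMr // mulrA ler_pdivlMr // -!natrM !ler_nat.
move: h1; rewrite ltn_divLR // => h1; rewrite ltnW //=.
have := leq_trans h2 hb; rewrite ltnS leq_divRL // => h3.
by apply: leq_trans h3 _; rewrite leq_mul2r orbT.
Qed.

Lemma dilated_length (R : realType) (N d b : nat) : (0 < d)%N ->
  (b <= (16 * N %/ d).+1)%N -> (b - (N %/ d).+1)%:R <= 32 * (N%:R / d%:R) :> R.
Proof.
move=> d0 hb; have dp : 0 < d%:R :> R by rewrite ltr0n.
rewrite mulrA ler_pdivlMr // -!natrM ler_nat.
apply: (@leq_trans ((16 * N %/ d) * d)).
  rewrite leq_mul2r; apply/orP; right; move: hb; move: (16 * N %/ d)%N (N %/ d)%N => x y.
  by clear; lia.
by apply: leq_trans (leq_trunc_div _ _) _; rewrite leq_mul2r orbT.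
Qed.

(** This is the size of the second derivative in m of the phase at d m, where m is about n / d. *)
Lemma dilated_amplitude (R : realType) (gamma h W n d : R) : 0 < n -> 0 < d ->
  h <= W * n `^ (1 - gamma) ->
  (h * d `^ gamma) * (n / d) `^ (gamma - 2) <= W * d ^+ 2 / n.
Proof.
move=> n0 d0 hW.
have -> : (h * d `^ gamma) * (n / d) `^ (gamma - 2) = h * (n `^ (gamma - 1) * d ^+ 2 / n).
  rewrite powRM ?invr_ge0 ?ltW // -(powR_inv1 (ltW d0)) -powRrM.
  have -> : h * d `^ gamma * (n `^ (gamma - 2) * d `^ (-1 * (gamma - 2))) =
    h * (n `^ (gamma - 2) * (d `^ gamma * d `^ (-1 * (gamma - 2)))) by ring.
  rewrite -powRD ?(gt_eqF d0) ?implybT //.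
  have -> : gamma + -1 * (gamma - 2) = 2%:R by ring.
  rewrite powR_mulrn ?(ltW d0) //.
  have -> : gamma - 2 = (gamma - 1) + - 1 by ring.
  rewrite powRD ?(gt_eqF n0) ?implybT // powR_inv1 ?(ltW n0) //; ring.
apply: le_trans (_ : W * n `^ (1 - gamma) * (n `^ (gamma - 1) * d ^+ 2 / n) <= _).
  by rewrite ler_wpM2r // divr_ge0 ?mulr_ge0 ?powR_ge0 ?exprn_ge0 ?ltW.
have -> : W * n `^ (1 - gamma) * (n `^ (gamma - 1) * d ^+ 2 / n) =
  W * (n `^ (1 - gamma) * n `^ (gamma - 1)) * d ^+ 2 / n by ring.
rewrite -powRD ?(gt_eqF n0) ?implybT //.
by rewrite (_ : 1 - gamma + (gamma - 1) = 0) ?powRr0 ?mulr1 //; ring.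
Qed.

Lemma scale_facts (R : realFieldType) (T k W n : R) : 1 <= T -> 1 <= k -> 1 <= W ->
  512 * k * W * T ^+ 7 <= n -> 4 * T ^+ 3 <= n /\ 16 * W * T ^+ 4 <= n.
Proof.
move=> T1 k1 W1 h.
have T0 : 0 <= T by exact: le_trans T1.
have W0 : 0 <= W by exact: le_trans W1.
have a1 : T ^+ 3 <= k * W * T ^+ 7.
  rewrite -[leLHS]mul1r ler_pM ?exprn_ge0 ?mulr_ege1 //; exact: ler_weXn2l.
have a2 : W * T ^+ 4 <= k * W * T ^+ 7.
  rewrite ler_pM ?exprn_ge0 //; last exact: ler_weXn2l.
  by rewrite -[leLHS]mul1r ler_wpM2r.
have a3 : 0 <= k * W * T ^+ 7 by apply: le_trans a1; rewrite exprn_ge0.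
have e1 : 512 * k * W * T ^+ 7 = 512 * (k * W * T ^+ 7) by ring.
rewrite e1 in h; rewrite -[16 * W * _]mulrA.
by move: a1 a2 a3 h; move: (k * W * _) (W * _) (T ^+ 3) => x y z; clear; split; lra.
Qed.

(** Expanding the product that bounds Z gives 1 and three other terms, each at most Y / T by one of
    the size conditions, hence Z <= 4 Y / T. The 298 is 32 + 10 + 64 * 4. *)
Lemma type_one_far_arith (R : realType) (M N d T W Y q0 k X Z eta : R) :
  1 <= T -> 1 <= W -> T ^+ 2 <= Y -> Y <= 2 * T ^+ 2 -> 1 <= d -> d <= 2 * T -> 0 < N ->
  M = N / d -> 0 < q0 -> 0 <= k -> X = k * d ^+ 2 * Y -> eta = 2 * (Y * (W * d ^+ 2 / N)) ->
  8 * k * T ^+ 3 <= q0 -> 512 * k * W * T ^+ 7 <= N -> 32 * q0 * W * T ^+ 3 <= N ->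
  0 <= Z -> Z <= (2 * X / q0 + 1) * (1 + 4 * q0 * eta) ->
  33 * M / Y * (32 * M + 20 * Y / eta + 64 * M * Z) <= 33 * 298 * (M ^+ 2 / T).
Proof.
move=> T1 W1 Y1 Y2 d1 d2 N0 ME q00 k0 XE etaE c1 c2 c3 Z0 hZ.
have Tp : 0 < T by exact: lt_le_trans T1.
have Wp : 0 < W by exact: lt_le_trans W1.
have dp : 0 < d by exact: lt_le_trans d1.
have Yp : 0 < Y by apply: lt_le_trans Y1; rewrite exprn_gt0.
have Mp : 0 < M by rewrite ME divr_gt0.
have d4 : d ^+ 2 <= 4 * T ^+ 2.
  have -> : 4 * T ^+ 2 = (2 * T) ^+ 2 by ring.
  by rewrite ler_pXn2r ?nnegrE // ?ltW // mulr_gt0.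
have YT : 1 <= Y / T.
  rewrite ler_pdivlMr // mul1r; apply: le_trans Y1.
  by rewrite expr2 -[leLHS]mul1r ler_wpM2r // ltW.
have E1 : 2 * X / q0 <= Y / T.
  rewrite ler_pdivrMr // mulrAC ler_pdivlMr // XE.
  have -> : 2 * (k * d ^+ 2 * Y) * T = Y * (2 * k * T * d ^+ 2) by ring.
  rewrite ler_wpM2l ?(ltW Yp) //; apply: le_trans c1.
  have -> : 8 * k * T ^+ 3 = 2 * k * T * (4 * T ^+ 2) by ring.
  by rewrite ler_wpM2l // !mulr_ge0 // ltW.
have E2 : 4 * q0 * eta <= Y / T.
  rewrite etaE ler_pdivlMr //.
  have -> : 4 * q0 * (2 * (Y * (W * d ^+ 2 / N))) * T = Y * (8 * q0 * W * T * d ^+ 2) / N by ring.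
  rewrite ler_pdivrMr // ler_wpM2l ?(ltW Yp) //; apply: le_trans c3.
  have -> : 32 * q0 * W * T ^+ 3 = 8 * q0 * W * T * (4 * T ^+ 2) by ring.
  by rewrite ler_wpM2l // !mulr_ge0 // ltW.
have E3 : 2 * X / q0 * (4 * q0 * eta) <= Y / T.
  have -> : 2 * X / q0 * (4 * q0 * eta) = Y * (16 * k * W * (d ^+ 2 * d ^+ 2 * Y)) / N.
    by rewrite XE etaE; field; rewrite !gt_eqF.
  rewrite ler_pdivlMr // mulrAC ler_pdivrMr // -[leLHS]mulrA ler_wpM2l ?(ltW Yp) //.
  apply: le_trans c2.
  have -> : 512 * k * W * T ^+ 7 = 16 * k * W * ((4 * T ^+ 2) * (4 * T ^+ 2) * (2 * T ^+ 2)) * T by ring.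
  rewrite ler_wpM2r ?(ltW Tp) // ler_wpM2l ?mulr_ge0 ?(ltW Wp) //.
  by rewrite ler_pM ?mulr_ge0 ?exprn_ge0 ?(ltW Yp) ?(ltW dp) // ler_pM ?exprn_ge0 ?(ltW dp).
have hZ4 : Z <= 4 * (Y / T).
  apply: le_trans hZ _; move: YT E1 E2 E3; rewrite mulrDl mulrDr mul1r mulr1.
  by move: (2 * X / q0) (4 * q0 * eta) (Y / T) => p q r; clear; lra.
have e20 : 20 * Y / eta <= 10 * M.
  have -> : 20 * Y / eta = 10 * M / (W * d) by rewrite etaE ME; field; rewrite !gt_eqF.
  rewrite ler_pdivrMr ?mulr_gt0 // -[leLHS]mulr1 ler_wpM2l ?mulr_ge0 ?(ltW Mp) //.
  exact: mulr_ege1.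
apply: le_trans (_ : 33 * M / Y * (298 * M * (Y / T)) <= _).
  rewrite ler_wpM2l ?divr_ge0 ?mulr_ge0 ?(ltW Mp) ?(ltW Yp) //.
  have m1 : M * 1 <= M * (Y / T) by rewrite ler_wpM2l // ltW.
  have m2 : M * Z <= M * (4 * (Y / T)) by rewrite ler_wpM2l // ltW.
  by move: e20 m1 m2; move: (20 * Y / eta) (Y / T) => p q; clear; lra.
by apply: le_of_eq; field; rewrite !gt_eqF.
Qed.

(** For the multiples of d the slope at shift r is k d^2 r times [th], so the near shifts are
    counted among the integers up to k d^2 Y. *)
Lemma type_one_sum_far (R : realType) (gamma h beta c th T W : R) (a0 : int) (q0 k N Y d b : nat) :
  0 < gamma < 1 -> 0 <= h -> 1 <= T -> 1 <= W -> T ^+ 2 <= Y%:R <= 2 * T ^+ 2 ->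
  good_approx th a0 q0 -> (0 < k)%N ->
  (forall x : nat, nd (2 * beta * x%:R) = nd ((k * x)%:R * th)) ->
  h <= W * N%:R `^ (1 - gamma) ->
  8 * k%:R * T ^+ 3 <= q0%:R -> 512 * k%:R * W * T ^+ 7 <= N%:R ->
  32 * q0%:R * W * T ^+ 3 <= N%:R ->
  (0 < d)%N -> d%:R <= 2 * T -> (b <= (16 * N %/ d).+1)%N ->
  (\sum_((N %/ d).+1 <= m < b) ec (phase gamma h beta c (d * m))) ^+ 2 <=
   33 * 298 * ((N%:R / d%:R) ^+ 2 / T).
Proof.
move=> g01 h0 T1 W1 /andP[Y1 Y2] ga k0 hb hW c1 c2 c3 d0 d2 hbb.
have Tp : 0 < T by exact: lt_le_trans T1.
have Wp : 0 < W by exact: lt_le_trans W1.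
have dp : 0 < d%:R :> R by rewrite ltr0n.
have kp : 1 <= k%:R :> R by rewrite ler1n.
have N0 : 0 < N%:R :> R.
  by apply: lt_le_trans c2; rewrite !mulr_gt0 ?exprn_gt0 ?ltr0n.
have Y0 : (0 < Y)%N.
  by rewrite -(ltr0n R); apply: lt_le_trans Y1; rewrite exprn_gt0.
have [T3 _] := scale_facts T1 kp W1 c2.
have YM : Y%:R <= N%:R / d%:R :> R.
  rewrite ler_pdivlMr //; apply: le_trans (_ : 2 * T ^+ 2 * (2 * T) <= _).
    by rewrite ler_pM.
  by apply: le_trans T3; apply: le_of_eq; ring.
have M1 : 1 <= N%:R / d%:R :> R by apply: le_trans YM; rewrite ler1n.
set eta := 2 * (Y%:R * (W * d%:R ^+ 2 / N%:R)).
have Yp : 0 < Y%:R :> R by rewrite ltr0n.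
have eta0 : 0 < eta by rewrite /eta !mulr_gt0 ?invr_gt0 ?exprn_gt0.
have A0 : 0 <= h * d%:R `^ gamma by rewrite mulr_ge0 ?powR_ge0.
have hA : 2 * ((h * d%:R `^ gamma) * Y%:R * (N%:R / d%:R) `^ (gamma - 2)) <= eta.
  rewrite /eta ler_wpM2l // mulrAC mulrC ler_wpM2l //.
  exact: dilated_amplitude.
under eq_bigr => m _ do rewrite phase_dilate.
have := @type_one_far R gamma (N%:R / d%:R) (h * d%:R `^ gamma) (beta * d%:R ^+ 2) c eta
  (N %/ d).+1 b Y g01 M1 A0 Y0 YM (fun n => dilated_range R d0 hbb) (dilated_length R d0 hbb) eta0 hA.
set Z := \sum_(1 <= r < Y) _ => key; apply: le_trans key _.
have ga' := ga; case: ga' => q0p _ _.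
apply: (@type_one_far_arith _ _ N%:R d%:R T W Y%:R q0%:R k%:R (k * (d * d) * Y)%:R Z eta) => //.
- by rewrite ler1n.
- by rewrite ltr0n.
- by rewrite !natrM expr2.
- by apply: sumr_ge0.
apply: le_trans (count_close (k * (d * d) * Y) ga (ltW eta0)).
have kd0 : (0 < k * (d * d))%N by rewrite !muln_gt0 k0 d0.
apply: le_trans (@sum_dilate_le R (fun n => (nd (n%:R * th) <= eta)%R%:R) _ Y kd0 (fun n => ler0n _ _)).
rewrite [leRHS](@big_cat_nat _ _ _ Y) //= -[leLHS]addr0 lerD ?sumr_ge0 //.
apply: ler_sum_nat => r _; rewrite le_eqVlt; apply/orP; left; apply/eqP.
have -> : 2 * (beta * d%:R ^+ 2) * r%:R = 2 * beta * (d * d * r)%:R by rewrite !natrM; ring.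
by rewrite hb !mulnA.
Qed.

Lemma type_one_sum_zero (R : realType) (gamma : R) : 0 < gamma < 1 -> exists2 C : R, 0 < C &
  forall (h c T W : R) (N Y d b : nat),
  1 <= h -> 1 <= T -> 1 <= W -> T ^+ 2 <= Y%:R <= 2 * T ^+ 2 ->
  h <= W * N%:R `^ (1 - gamma) -> 512 * W * T ^+ 7 <= N%:R ->
  N%:R `^ (1 - gamma) * harm R Y <= T ->
  (0 < d)%N -> d%:R <= 2 * T -> (b <= (16 * N %/ d).+1)%N ->
  (\sum_((N %/ d).+1 <= m < b) ec (phase gamma h 0 c (d * m))) ^+ 2 <=
   C * ((N%:R / d%:R) ^+ 2 / T).
Proof.
move=> g01; have /andP[g0 g1] := g01.
have [cg cgE cg0] : exists2 c : R, gamma * (1 - gamma) = c & 0 < c.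
  by apply: (ex_intro2 _ _ _ erefl); rewrite mulr_gt0 ?subr_gt0.
have [c2 c2E c20] : exists2 c : R, 5 * 35 ^+ 2 = c & 0 < c.
  by apply: (ex_intro2 _ _ _ erefl); rewrite !mulr_gt0 ?exprn_gt0 ?ltr0n.
exists (33 * (32 + 2 * (c2 / cg))).
  by rewrite mulr_gt0 ?ltr0n // addr_gt0 ?mulr_gt0 ?invr_gt0 ?ltr0n.
move=> h c T W N Y d b h1 T1 W1 /andP[Y1 Y2] hW hN hE d0 d2 hbb.
have h0 : 0 < h by exact: lt_le_trans h1.
have Tp : 0 < T by exact: lt_le_trans T1.
have Wp : 0 < W by exact: lt_le_trans W1.
have dp : 0 < d%:R :> R by rewrite ltr0n.
have d1 : 1 <= d%:R :> R by rewrite ler1n.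
have N0 : 0 < N%:R :> R.
  by apply: lt_le_trans hN; rewrite !mulr_gt0 ?exprn_gt0 ?ltr0n.
have Yp : 0 < Y%:R :> R by apply: lt_le_trans Y1; rewrite exprn_gt0.
have Y0 : (0 < Y)%N by rewrite -(ltr0n R).
have [T3 T4] : 4 * T ^+ 3 <= N%:R /\ 16 * W * T ^+ 4 <= N%:R.
  by apply: (@scale_facts R T 1); rewrite ?mulr1.
have YM : Y%:R <= N%:R / d%:R :> R.
  rewrite ler_pdivlMr //; apply: le_trans (_ : 2 * T ^+ 2 * (2 * T) <= _).
    by rewrite ler_pM.
  by apply: le_trans T3; apply: le_of_eq; ring.
have M1 : 1 <= N%:R / d%:R :> R by apply: le_trans YM; rewrite ler1n.
have A0 : 0 <= h * d%:R `^ gamma by rewrite mulr_ge0 ?powR_ge0 // ltW.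
have hA : h * d%:R `^ gamma * Y%:R * (N%:R / d%:R) `^ (gamma - 2) <= 2^-1.
  rewrite mulrAC; apply: le_trans (_ : W * d%:R ^+ 2 / N%:R * Y%:R <= _).
    by rewrite ler_wpM2r // dilated_amplitude.
  rewrite mulrAC ler_pdivrMr //.
  apply: le_trans (_ : W * (2 * T) ^+ 2 * (2 * T ^+ 2) <= _).
    rewrite ler_pM ?mulr_ge0 ?exprn_ge0 ?(ltW Wp) // ler_wpM2l ?(ltW Wp) //.
    by rewrite ler_pXn2r ?nnegrE // mulr_ge0 // ltW.
  have -> : W * (2 * T) ^+ 2 * (2 * T ^+ 2) = 8 * W * T ^+ 4 by ring.
  by move: T4; clear; lra.
pose nu1 := h * d%:R `^ gamma * (gamma * (1 - gamma) * (N%:R / d%:R) `^ (gamma - 2)).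
have Mp : 0 < N%:R / d%:R :> R by rewrite divr_gt0.
have nu0 : 0 < nu1 by rewrite /nu1 cgE !mulr_gt0 ?powR_gt0.
under eq_bigr => m _ do rewrite phase_dilate mul0r.
have := @type_one_zero R gamma (N%:R / d%:R) (h * d%:R `^ gamma) c nu1
  (N %/ d).+1 b Y g01 M1 A0 Y0 YM (fun n => dilated_range R d0 hbb) (dilated_length R d0 hbb) hA nu0 (lexx _).
move=> key; apply: le_trans key _; rewrite c2E.
have nuE : nu1^-1 = N%:R `^ (1 - gamma) * (N%:R / d%:R) / (cg * h * d%:R).
  rewrite /nu1 cgE.
  have -> : (h * d%:R `^ gamma * (cg * (N%:R / d%:R) `^ (gamma - 2))) =
     cg * h * (d%:R `^ gamma * (N%:R / d%:R) `^ (gamma - 2)) by ring.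
  have -> : d%:R `^ gamma * (N%:R / d%:R) `^ (gamma - 2) = N%:R `^ (gamma - 1) * d%:R ^+ 2 / N%:R.
    rewrite powRM ?invr_ge0 // -(powR_inv1 (ltW dp)) -powRrM.
    rewrite mulrCA -powRD ?(gt_eqF dp) ?implybT //.
    have -> : gamma + -1 * (gamma - 2) = 2%:R by ring.
    rewrite powR_mulrn //.
    have -> : gamma - 2 = (gamma - 1) + - 1 by ring.
    by rewrite powRD ?(gt_eqF N0) ?implybT // powR_inv1 //; ring.
  have -> : 1 - gamma = - (gamma - 1) by ring.
  by rewrite powRN; field; rewrite !gt_eqF ?powR_gt0.
rewrite nuE.
set M := N%:R / d%:R in Mp *; set E := N%:R `^ (1 - gamma) in hE *.
set H := harm R Y in hE *.
have hd1 : 1 <= h * d%:R by rewrite mulr_ege1.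
have hd0 : 0 < h * d%:R by exact: lt_le_trans hd1.
have F : c2 * (E * M / (cg * h * d%:R)) * H <= c2 / cg * M * T.
  have -> : c2 * (E * M / (cg * h * d%:R)) * H = c2 / cg * M * (E * H / (h * d%:R)).
    by field; rewrite !gt_eqF.
  rewrite ler_wpM2l ?mulr_ge0 ?invr_ge0 ?(ltW c20) ?(ltW cg0) ?(ltW Mp) //.
  by rewrite ler_pdivrMr //; apply: le_trans hE _; rewrite -[leLHS]mulr1 ler_wpM2l // ltW.
apply: le_trans (_ : 33 * M / Y%:R * ((32 + 2 * (c2 / cg)) * M * T) <= _).
  rewrite ler_wpM2l ?divr_ge0 ?mulr_ge0 ?(ltW Mp) //.
  have : M * 1 <= M * T by rewrite ler_wpM2l // ltW.
  by move: F; clear; lra.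
have p : 0 <= 32 + 2 * (c2 / cg) by apply/ltW; rewrite addr_gt0 ?mulr_gt0 ?invr_gt0 ?ltr0n.
have -> : 33 * M / Y%:R * ((32 + 2 * (c2 / cg)) * M * T) =
   33 * (32 + 2 * (c2 / cg)) * (M ^+ 2 * (T / Y%:R)) by ring.
rewrite ler_wpM2l ?mulr_ge0 // ler_wpM2l ?exprn_ge0 ?(ltW Mp) //.
by rewrite ler_pdivrMr // mulrC ler_pdivlMr // -expr2.
Qed.

Lemma in_range_mul (N d m : nat) : (0 < d)%N ->
  in_range N (d * m) = ((N %/ d).+1 <= m)%N && (m < (16 * N %/ d).+1)%N.
Proof. by move=> d0; rewrite /in_range ltn_divLR // ltnS leq_divRL // mulnC. Qed.

Lemma sum_in_range_mul (R : realType) (N d : nat) (F : nat -> R) : (0 < d)%N ->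
  \sum_(1 <= m < (16 * N).+1) (in_range N (d * m))%:R * F m =
  \sum_((N %/ d).+1 <= m < (16 * N %/ d).+1) F m.
Proof.
move=> d0.
rewrite -(@sum_indic_itv R F (N %/ d).+1 (16 * N %/ d).+1 (16 * N).+1) ?ltnS ?leq_div //.
rewrite -(big_mkord xpredT (fun m => (((N %/ d).+1 <= m)%N && (m < (16 * N %/ d).+1)%N)%:R * F m)).
rewrite [RHS]big_ltn // [X in X + _]mul0r add0r.
by apply: eq_bigr => m _; rewrite in_range_mul.
Qed.

Lemma ln_natM_le (R : realType) (m n : nat) : (0 < m)%N -> (m <= n)%N -> `|ln m%:R : R| <= ln n%:R.
Proof.
move=> m0 mn; have n0 := leq_trans m0 mn.
by rewrite ger0_norm ?ln_ge0 ?ler1n // ler_ln ?posrE ?ltr0n // ler_nat.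
Qed.

(** Partial summation removes the logarithm; this is why the linear sums are bounded for every upper
    end [b]. *)
Lemma log_weighted_sum (R : realType) (N d : nat) (w : nat -> R) (E : R) : (0 < d)%N ->
  (forall b, (b <= (16 * N %/ d).+1)%N -> `|\sum_((N %/ d).+1 <= m < b) w m| <= E) ->
  `|\sum_(1 <= m < (16 * N).+1) (in_range N (d * m))%:R * (ln m%:R * w m)| <= 4 * ln (16 * N)%:R * E.
Proof.
move=> d0 hE; rewrite sum_in_range_mul //.
have E0 : 0 <= E by apply: le_trans (hE 0%N _).
case: (ltnP (N %/ d).+1 (16 * N %/ d).+1) => ab; last first.
  by rewrite big_geq // normr0 mulr_ge0 ?mulr_ge0 ?ln_nat_ge0.
pose S n := \sum_((N %/ d).+1 <= m < n) w m.
have -> : \sum_((N %/ d).+1 <= m < (16 * N %/ d).+1) ln m%:R * w m =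
   - \sum_((N %/ d).+1 <= m < (16 * N %/ d).+1) (- ln m%:R) * (S m.+1 - S m).
  rewrite -sumrN; apply: eq_big_nat => m /andP[am mb].
  by rewrite /S big_nat_recr //= addrAC subrr add0r mulNr opprK.
rewrite normrN; apply: abel_antitone_bound => //.
- move=> n /andP[an nb]; rewrite normrN ln_natM_le ?(leq_ltn_trans _ an) //.
  by apply: leq_trans (leq_div _ d); rewrite -ltnS.
- move=> n an nb; rewrite lerN2 ler_ln ?posrE ?ltr0n ?(leq_ltn_trans _ an) // ler_nat //.
- by move=> n /andP[_ nb]; apply: hE.
Qed.

(** Vaughan's identity with U = Q. The first sum is linear with a logarithm; the second is linear
    for d <= Q and bilinear for Q < d <= Q^2, beyond which kappa vanishes; the third is bilinear,
    with coefficients at most ln (16 N) and D. *)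
Lemma exp_sum_bound (R : realType) (gamma h beta c T K E D : R) (N Q J : nat) :
  0 < T -> T <= Q%:R -> (0 < Q)%N -> (Q * Q * Q <= N)%N -> (16 * N <= 4 ^ J)%N -> 0 <= K -> 1 <= D ->
  (forall n, (0 < n <= 16 * N)%N -> (size (divisors n))%:R <= D) ->
  (forall L, (Q <= L)%N -> (L * L <= 16 * N)%N -> pair_total gamma h beta N L Q <= K * N%:R) ->
  (forall d b, (0 < d <= Q)%N -> (b <= (16 * N %/ d).+1)%N ->
     `|\sum_((N %/ d).+1 <= m < b) ec (phase gamma h beta c (d * m))| <= E * (N%:R / d%:R)) ->
  `|\sum_(1 <= n < (16 * N).+1) (in_range N n)%:R * (mangoldt R n * ec (phase gamma h beta c n))| <=
  ln (16 * N)%:R * N%:R * (5 * E * harm R Q.+1 + 4 * J%:R * D * Num.sqrt (64 * (16 + 2 * K) / T)).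
Proof.
move=> Tp TQ Q0 Q3 NJ K0 D1 hD hP hE.
have N0 : (0 < N)%N by apply: leq_trans Q3; rewrite !muln_gt0 Q0.
have QQ : (Q * Q <= N)%N by apply: leq_trans Q3; rewrite leq_pmulr.
have QN : (Q <= N)%N by apply: leq_trans QQ; rewrite leq_pmulr.
have Q16 : (Q <= 16 * N)%N by apply: leq_trans QN _; rewrite leq_pmull.
set w := fun n => ec (phase gamma h beta c n).
set lam : R := ln (16 * N)%:R.
have lam0 : 0 <= lam by rewrite /lam ln_ge0 // ler1n muln_gt0.
set sq := Num.sqrt _.
rewrite (vaughan_sum w Q0 QQ).
set S1 := \sum_(1 <= d < _) _; set S2 := \sum_(1 <= d < _) _; set S3 := \sum_(1 <= d < _) _.
have hsum (B : R) (f : nat -> R) : (forall d, (0 < d <= Q)%N -> `|f d| <= B * (N%:R / d%:R)) ->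
    (forall d, (Q < d)%N -> f d = 0) ->
    `|\sum_(1 <= d < (16 * N).+1) f d| <= B * N%:R * harm R Q.+1.
  move=> hf hf0; rewrite (@big_cat_nat _ _ _ Q.+1) //= [X in _ + X]big_nat_cond [X in _ + X]big1 ?addr0.
    apply: le_trans (ler_norm_sum _ _ _) _; rewrite /harm mulr_sumr.
    by apply: ler_sum_nat => d hd; rewrite -mulrA; exact: hf.
  by move=> d /andP[/andP[hd _] _]; exact: hf0.
have b1 : `|S1| <= 4 * lam * E * N%:R * harm R Q.+1.
  apply: hsum => d.
    move=> /andP[d0 dQ].
    have -> : \sum_(1 <= m < (16 * N).+1) (in_range N (d * m))%:R * (vrho R Q d * ln m%:R * w (d * m)%N) =
       vrho R Q d * \sum_(1 <= m < (16 * N).+1) (in_range N (d * m))%:R * (ln m%:R * w (d * m)%N).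
      by rewrite mulr_sumr; apply: eq_bigr => m _; ring.
    rewrite normrM -[leRHS]mul1r ler_pM // ?vrho_norm //.
    rewrite -mulrA; apply: log_weighted_sum => // b hb; apply: hE; rewrite ?d0 //.
  move=> dQ; apply: big1 => m _; rewrite /vrho leqNgt dQ /= [_%:R * moebius _ _]mul0r !mul0r mulr0 //.
have b2 : `|S2| <= lam * E * N%:R * harm R Q.+1 + 2 * J%:R * (1 * lam * N%:R * sq).
  pose v d := (Q < d)%N%:R * ((d <= Q * Q)%N%:R * vkappa R Q d).
  pose u m : R := (Q < m)%N%:R.
  have -> : S2 = \sum_(1 <= d < (16 * N).+1) (d <= Q)%N%:R * (\sum_(1 <= m < (16 * N).+1)
     (in_range N (d * m))%:R * (vkappa R Q d * w (d * m)%N)) +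
     bilinear gamma h beta c N v u 1 (16 * N).+1.
    rewrite /S2 /bilinear -big_split /=; apply: eq_big_nat => d /andP[d0 _].
    case: (leqP d Q) => dQ.
      rewrite [_%:R * _]mul1r [X in _ + X]big1 ?addr0 // => m _.
      by rewrite /v ltnNge dQ /= [_%:R * (_ * vkappa _ _ _)]mul0r !mul0r mulr0.
    rewrite [_%:R * _]mul0r add0r; apply: eq_bigr => m _.
    rewrite /v dQ [_%:R * (_ * vkappa _ _ _)]mul1r.
    case: (leqP d (Q * Q)) => dQQ; last first.
      by rewrite vkappa_eq0 // !mulr0 !mul0r mulr0.
    rewrite [_%:R * vkappa _ _ _]mul1r.
    case: (boolP (in_range N (d * m))) => [/andP[dm _]|_]; last by rewrite [LHS]mul0r [RHS]mul0r.
    (* d <= Q^2 and m <= Q would give d m <= Q^3 <= N, outside the range. *)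
    rewrite /u (_ : (Q < m)%N) ?mulr1 //.
    rewrite ltnNge; apply/negP => mQ; move: dm; rewrite ltnNge => /negP; apply.
    by apply: leq_trans Q3; exact: leq_mul.
  apply: le_trans (ler_normD _ _) _; apply: lerD.
    apply: hsum => d.
      move=> /andP[d0 dQ]; rewrite dQ [_%:R * _]mul1r.
      have -> : \sum_(1 <= m < (16 * N).+1) (in_range N (d * m))%:R * (vkappa R Q d * w (d * m)%N) =
         vkappa R Q d * \sum_(1 <= m < (16 * N).+1) (in_range N (d * m))%:R * w (d * m)%N.
        by rewrite mulr_sumr; apply: eq_bigr => m _; rewrite mulrCA.
      rewrite normrM -mulrA ler_pM //.
        apply: le_trans (vkappa_norm _ _ d0) _; rewrite ler_ln ?posrE ?ltr0n ?muln_gt0 // ler_nat.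
        exact: leq_trans dQ Q16.
      by rewrite sum_in_range_mul //; apply: hE; rewrite ?d0.
    by move=> dQ; rewrite leqNgt dQ [LHS]mul0r.
  apply: (@bilinear_total R gamma h beta c _ _ K T N Q J) => //.
  - by move=> m; rewrite /u; case: (_ < _)%N; rewrite ?normr0 ?normr1.
  - move=> d; rewrite /v; case: (ltnP Q d) => dQ; last by rewrite [_%:R * _]mul0r normr0.
    rewrite [_%:R * _]mul1r; case: (leqP d (Q * Q)) => dQQ; last by rewrite [_%:R * _]mul0r normr0.
    have d0 : (0 < d)%N by exact: leq_ltn_trans dQ.
    rewrite [_%:R * _]mul1r; apply: le_trans (vkappa_norm _ _ d0) _.
    rewrite ler_ln ?posrE ?ltr0n ?muln_gt0 // ler_nat.
    by apply: leq_trans dQQ (leq_trans QQ _); rewrite leq_pmull.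
  - by move=> m mQ; rewrite /u ltnNge mQ.
  - by move=> d dQ; rewrite /v ltnNge dQ [LHS]mul0r.
have b3 : `|S3| <= 2 * J%:R * (D * lam * N%:R * sq).
  (* The cut-offs at 16 N change nothing in the range of summation and make the coefficient bounds
     valid at every index. *)
  pose v d := (d <= 16 * N)%N%:R * ((Q < d)%N%:R * mangoldt R d).
  pose u m := (0 < m <= 16 * N)%N%:R * ((Q < m)%N%:R * vtau R Q m).
  have -> : S3 = bilinear gamma h beta c N v u 1 (16 * N).+1.
    rewrite /S3 /bilinear; apply: eq_big_nat => d /andP[d0 d1]; apply: eq_big_nat => m m1.
    have -> : v d = (Q < d)%N%:R * mangoldt R d by rewrite /v -[(d <= _)%N]ltnS d1 [LHS]mul1r.
    suff -> : u m = (Q < m)%N%:R * vtau R Q m by [].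
    by rewrite /u -[(m <= _)%N]ltnS m1 [LHS]mul1r.
  apply: (@bilinear_total R gamma h beta c _ _ K T N Q J) => //.
  - move=> m; rewrite /u; case: (boolP (0 < m <= 16 * N)%N) => hm; last first.
      by rewrite [_%:R * _]mul0r normr0; apply: le_trans D1.
    rewrite [_%:R * _]mul1r; apply: le_trans (hD _ hm); apply: le_trans (vtau_norm R Q m).
    rewrite normrM -[leRHS]mul1r ler_wpM2r //.
    by case: (_ < _)%N; rewrite ?normr0 ?normr1.
  - move=> d; rewrite /v; case: (leqP d (16 * N)) => hd; last by rewrite [_%:R * _]mul0r normr0.
    rewrite [_%:R * _]mul1r; case: (ltnP Q d) => dQ; last by rewrite [_%:R * _]mul0r normr0.
    have d0 : (0 < d)%N by exact: leq_ltn_trans dQ.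
    rewrite [_%:R * _]mul1r ger0_norm ?mangoldt_ge0 //; apply: le_trans (mangoldt_le_ln _ d0) _.
    by rewrite ler_ln ?posrE ?ltr0n ?muln_gt0 // ler_nat.
  - by move=> m mQ; rewrite /u (ltnNge Q) mQ [_%:R * vtau _ _ _]mul0r mulr0.
  - by move=> d dQ; rewrite /v (ltnNge Q) dQ [_%:R * mangoldt _ _]mul0r mulr0.
have sq0 : 0 <= sq by exact: sqrtr_ge0.
have e1 : `|S1 - S2 - S3| <= `|S1| + `|S2| + `|S3|.
  by apply: le_trans (ler_normB _ _) _; rewrite lerD2r; exact: ler_normB.
have e2 : 1 * (lam * N%:R * J%:R * sq) <= D * (lam * N%:R * J%:R * sq).
  by rewrite ler_wpM2r // !mulr_ge0.
apply: le_trans e1 _; move: b1 b2 b3 e2; move: `|S1| `|S2| `|S3| (harm R Q.+1) => x y z t.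
by clear; move: N%:R J%:R => n j; lra.
Qed.

Lemma exp_sum_of_squares (R : realType) (gamma h beta c T C1 C2 D : R) (N Q J : nat) :
  1 <= T -> T <= Q%:R <= 2 * T -> 8 * T ^+ 3 <= N%:R -> (16 * N <= 4 ^ J)%N ->
  0 <= C1 -> 0 <= C2 -> 1 <= D ->
  (forall n, (0 < n <= 16 * N)%N -> (size (divisors n))%:R <= D) ->
  (forall L, (Q <= L)%N -> (L * L <= 16 * N)%N ->
     pair_total gamma h beta N L Q ^+ 2 <= C1 * N%:R ^+ 2) ->
  (forall d b, (0 < d <= Q)%N -> (b <= (16 * N %/ d).+1)%N ->
     (\sum_((N %/ d).+1 <= m < b) ec (phase gamma h beta c (d * m))) ^+ 2 <=
       C2 * ((N%:R / d%:R) ^+ 2 / T)) ->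
  `|\sum_(1 <= n < (16 * N).+1) (in_range N n)%:R * (mangoldt R n * ec (phase gamma h beta c n))| <=
  ln (16 * N)%:R * N%:R * (5 * harm R Q.+1 + 4 * J%:R * D) *
    Num.sqrt ((C2 + 64 * (16 + 2 * Num.sqrt C1)) / T).
Proof.
move=> T1 /andP[Q1 Q2] hN NJ C10 C20 D1 hD hP hE.
have Tp : 0 < T by exact: lt_le_trans T1.
have Q0 : (0 < Q)%N by rewrite -(ltr0n R); exact: lt_le_trans Q1.
have Q3 : (Q * Q * Q <= N)%N.
  rewrite -(ler_nat R) !natrM; apply: le_trans hN.
  have -> : 8 * T ^+ 3 = (2 * T) * (2 * T) * (2 * T) by ring.
  by rewrite !ler_pM // !mulr_ge0 // ltW.
have hP' L : (Q <= L)%N -> (L * L <= 16 * N)%N -> pair_total gamma h beta N L Q <= Num.sqrt C1 * N%:R.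
  move=> QL LN; rewrite -(@ler_pXn2r _ 2) ?nnegrE ?mulr_ge0 ?sqrtr_ge0 ?pair_total_ge0 //.
  by rewrite exprMn sqr_sqrtr // hP.
have hE' d b : (0 < d <= Q)%N -> (b <= (16 * N %/ d).+1)%N ->
     `|\sum_((N %/ d).+1 <= m < b) ec (phase gamma h beta c (d * m))| <= Num.sqrt (C2 / T) * (N%:R / d%:R).
  move=> dQ bd; rewrite -(@ler_pXn2r _ 2) ?nnegrE ?mulr_ge0 ?sqrtr_ge0 ?invr_ge0 //.
  rewrite real_normK ?num_real // exprMn sqr_sqrtr ?divr_ge0 ?(ltW Tp) //.
  by apply: le_trans (hE _ _ dQ bd) _; rewrite mulrA mulrAC.
apply: le_trans (exp_sum_bound Tp Q1 Q0 Q3 NJ (sqrtr_ge0 C1) D1 hD hP' hE') _.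
have H0 : 0 <= harm R Q.+1 by apply: sumr_ge0 => i _; rewrite invr_ge0.
have s0 := sqrtr_ge0 C1.
set C := C2 + _.
have c1 : Num.sqrt (C2 / T) <= Num.sqrt (C / T).
  by rewrite ler_wsqrtr // ler_wpM2r ?invr_ge0 ?(ltW Tp) // /C lerDl !mulr_ge0 // addr_ge0 ?mulr_ge0.
have c2 : Num.sqrt (64 * (16 + 2 * Num.sqrt C1) / T) <= Num.sqrt (C / T).
  by rewrite ler_wsqrtr // ler_wpM2r ?invr_ge0 ?(ltW Tp) // /C lerDr.
rewrite -[leRHS]mulrA ler_wpM2l ?mulr_ge0 ?ln_nat_ge0 // [leRHS]mulrDl lerD //.
  by rewrite mulrAC ler_wpM2l // mulr_ge0.
by rewrite ler_wpM2l // !mulr_ge0 // (le_trans _ D1).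
Qed.

(** [s] is the square root of N. The blocks have L <= 4 s, and the two conditions that bound [s]
    below are those of [pair_total_far] at the extreme L = 4 s. *)
Lemma exp_sum_far (R : realType) : exists2 C : R, 0 < C &
  forall (gamma h beta c th T W D s : R) (a0 : int) (q0 k N Q Y J : nat),
  0 < gamma < 1 -> 0 <= h -> 1 <= T -> 1 <= W -> 1 <= D ->
  T <= Q%:R <= 2 * T -> T ^+ 2 <= Y%:R <= 2 * T ^+ 2 ->
  good_approx th a0 q0 -> (0 < k)%N ->
  (forall x : nat, nd (2 * beta * x%:R) = nd ((k * x)%:R * th)) ->
  h <= W * N%:R `^ (1 - gamma) ->
  (forall n, (0 < n <= 16 * N)%N -> (size (divisors n))%:R <= D) ->
  0 <= s -> s ^+ 2 = N%:R -> 512 * W * T ^+ 3 <= s ->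
  16 * D ^+ 2 * k%:R * T ^+ 2 * Num.sqrt (W * T ^+ 3) <= s ->
  D ^+ 2 * k%:R * T ^+ 2 <= q0%:R -> q0%:R <= 4 * T ^+ 4 ->
  8 * k%:R * T ^+ 3 <= q0%:R -> 512 * k%:R * W * T ^+ 7 <= N%:R ->
  32 * q0%:R * W * T ^+ 3 <= N%:R -> (16 * N <= 4 ^ J)%N ->
  `|\sum_(1 <= n < (16 * N).+1) (in_range N n)%:R * (mangoldt R n * ec (phase gamma h beta c n))| <=
  ln (16 * N)%:R * N%:R * (5 * harm R Q.+1 + 4 * J%:R * D) * Num.sqrt (C / T).
Proof.
have [C1 C10 key] := pair_total_far R.
exists (33 * 298 + 64 * (16 + 2 * Num.sqrt C1)).
  by rewrite addr_gt0 ?mulr_gt0 ?ltr0n // ltr_wpDr ?mulr_ge0 ?sqrtr_ge0.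
move=> gamma h beta c th T W D s a0 q0 k N Q Y J g01 h0 T1 W1 D1 hQ hY ga k0 hb hW hD s0 s2 hs1 hs2 hq1 hq2 hq3 hN1 hN2 NJ.
have Tp : 0 < T by exact: lt_le_trans T1.
have Wp : 0 < W by exact: lt_le_trans W1.
have kp : 1 <= k%:R :> R by rewrite ler1n.
have [T3 _] := scale_facts T1 kp W1 hN1.
have /andP[Q1 Q2] := hQ; have /andP[Y1 Y2] := hY.
have Qp : 0 < Q%:R :> R by exact: lt_le_trans Q1.
have Yp : 0 < Y%:R :> R by apply: lt_le_trans Y1; rewrite exprn_gt0.
have YQ : Q%:R * Y%:R <= 4 * T ^+ 3.
  have -> : 4 * T ^+ 3 = (2 * T) * (2 * T ^+ 2) by ring.
  by rewrite ler_pM // ltW.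
have T8 : 8 * T ^+ 3 <= N%:R.
  apply: le_trans (_ : s <= _).
    apply: le_trans hs1; rewrite ler_wpM2r ?exprn_ge0 ?(ltW Tp) //.
    by move: W1; clear; lra.
  rewrite -s2 expr2 -[leLHS]mul1r ler_wpM2r //; apply: le_trans hs1.
  by rewrite !mulr_ege1 ?ler1n ?exprn_ege1.
have p298 : 0 <= 33 * 298 :> R by rewrite mulr_ge0 ?ler0n.
apply: (@exp_sum_of_squares R gamma h beta c T C1 (33 * 298) D N Q J) => //.
- exact: ltW.
- move=> L QL LN.
  have L0 : (0 < L)%N by apply: leq_trans QL; rewrite -(ltr0n R).
  have Lp : 0 < L%:R :> R by rewrite ltr0n.
  have Ls : L%:R <= 4 * s.
    rewrite -(@ler_pXn2r _ 2) ?nnegrE ?mulr_ge0 // exprMn s2 -!natrX -natrM ler_nat.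
    by rewrite -mulnn; apply: leq_trans LN _.
  have D0 : 0 <= D by exact: le_trans D1.
  (* [key] wants a natural bound; divisor counts are integers, so the integer part of [D] still
     bounds them. *)
  have [D' D'D DD'] : exists2 D' : nat, D'%:R <= D & D < D'.+1%:R.
    by have /andP[] := truncn_itv D0; exists (Num.trunc D).
  have DD : D'%:R ^+ 2 <= D ^+ 2 by rewrite ler_pXn2r ?nnegrE.
  have dk : D'%:R ^+ 2 * k%:R * T ^+ 2 <= D ^+ 2 * k%:R * T ^+ 2.
    by rewrite ler_wpM2r ?exprn_ge0 ?(ltW Tp) // ler_wpM2r.
  have WYQ : 4 * W * Q%:R * Y%:R <= 16 * (W * T ^+ 3).
    have -> : 16 * (W * T ^+ 3) = 4 * W * (4 * T ^+ 3) by ring.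
    by rewrite -mulrA ler_wpM2l // mulr_ge0 // ltW.
  apply: (@key gamma h beta th T W a0 q0 k N L Q Y D') => //.
  + move=> n /andP[n0 nX]; rewrite -(ler_nat R).
    have hn : (size (divisors n))%:R <= D.
      apply: hD; rewrite n0 /=; apply: leq_trans nX _.
      rewrite -(ler_nat R) !natrM.
      apply: le_trans (_ : (4 * T ^+ 3) * (4 * (4 * s)) <= _).
        by rewrite [Y%:R * _]mulrA [Y%:R * _]mulrC ler_pM ?mulr_ge0 ?ler_wpM2l // ltW.
      rewrite -s2.
      have : 4 * T ^+ 3 * s <= s * s.
        rewrite ler_wpM2r //; apply: le_trans hs1.
        rewrite ler_wpM2r ?exprn_ge0 ?(ltW Tp) //.
        by move: W1; clear; lra.
      by move: (T ^+ 3) => t; clear; rewrite expr2; lra.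
    have : (size (divisors n) < D'.+1)%N.
      by rewrite -(ltr_nat R); exact: le_lt_trans hn _.
    by rewrite ltnS ler_nat.
  + rewrite ler_pdivlMr ?mulr_gt0 ?ltr0n //.
    apply: le_trans (_ : 4 * (16 * (W * T ^+ 3)) * (2 * (4 * s)) <= _).
      rewrite ler_pM ?mulr_ge0 ?(ltW Wp) ?(ltW Lp) ?ler_wpM2l //.
      by move: WYQ; clear; lra.
    have -> : 4 * (16 * (W * T ^+ 3)) * (2 * (4 * s)) = (512 * W * T ^+ 3) * s by ring.
    by rewrite -s2 expr2 ler_wpM2r.
  + exact: le_trans dk hq1.
  + apply: le_trans (_ : D ^+ 2 * k%:R * T ^+ 2 * (4 * s) * (4 * Num.sqrt (W * T ^+ 3)) <= _).
      rewrite ler_pM ?sqrtr_ge0 ?mulr_ge0 ?exprn_ge0 ?(ltW Tp) //.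
        by rewrite ler_pM ?mulr_ge0 ?exprn_ge0 ?(ltW Tp).
      have -> : 4 * Num.sqrt (W * T ^+ 3) = Num.sqrt (16 * (W * T ^+ 3)).
        have {1}-> : 4 = Num.sqrt (4 ^+ 2) :> R by rewrite sqrtr_sqr ger0_norm.
        by rewrite -sqrtrM ?exprn_ge0 //; congr Num.sqrt; ring.
      by rewrite ler_wsqrtr.
    have -> : D ^+ 2 * k%:R * T ^+ 2 * (4 * s) * (4 * Num.sqrt (W * T ^+ 3)) =
      16 * D ^+ 2 * k%:R * T ^+ 2 * Num.sqrt (W * T ^+ 3) * s by ring.
    by rewrite -s2 expr2 ler_wpM2r.
  (* L >= Q >= T and Y >= T^2 make k Y Q (4 L) at least 4 T^4. *)
  + rewrite -(ler_nat R); apply: le_trans hq2 _.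
    rewrite !natrM -[leLHS]mul1r ler_pM ?mulr_ge0 ?exprn_ge0 ?(ltW Tp) //.
    have -> : 4 * T ^+ 4 = T ^+ 2 * (T * (4 * T)) by ring.
    rewrite ler_pM ?mulr_ge0 ?exprn_ge0 ?(ltW Tp) // ler_pM ?mulr_ge0 ?(ltW Tp) // ler_wpM2l //.
    by apply: le_trans Q1 _; rewrite ler_nat.
- move=> d b /andP[d0 dQ] bd.
  apply: (@type_one_sum_far R gamma h beta c th T W a0 q0 k N Y d b) => //.
  by apply: le_trans Q2; rewrite ler_nat.
Qed.

Lemma exp_sum_zero (R : realType) (gamma : R) : 0 < gamma < 1 -> exists2 C : R, 0 < C &
  forall (h c T W D s : R) (N Q Y J : nat),
  1 <= h -> 1 <= T -> 1 <= W -> 1 <= D ->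
  T <= Q%:R <= 2 * T -> T ^+ 2 <= Y%:R <= 2 * T ^+ 2 ->
  h <= W * N%:R `^ (1 - gamma) ->
  (forall n, (0 < n <= 16 * N)%N -> (size (divisors n))%:R <= D) ->
  0 <= s -> s ^+ 2 = N%:R -> 512 * W * T ^+ 3 <= s ->
  512 * W * T ^+ 7 <= N%:R -> (16 * N <= 4 ^ J)%N ->
  N%:R `^ (1 - gamma) * harm R Y <= T ->
  N%:R `^ (1 - gamma) * (harm R Q * harm R Y) <= T ->
  `|\sum_(1 <= n < (16 * N).+1) (in_range N n)%:R * (mangoldt R n * ec (phase gamma h 0 c n))| <=
  ln (16 * N)%:R * N%:R * (5 * harm R Q.+1 + 4 * J%:R * D) * Num.sqrt (C / T).
Proof.
move=> g01.
have [C1 C10 key] := pair_total_zero g01; have [C2 C20 key2] := type_one_sum_zero g01.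
exists (C2 + 64 * (16 + 2 * Num.sqrt C1)).
  by rewrite addr_gt0 // mulr_gt0 // ltr_wpDr ?mulr_ge0 ?sqrtr_ge0.
move=> h c T W D s N Q Y J h1 T1 W1 D1 hQ hY hW hD s0 s2 hs1 hN1 NJ hh1 hh2.
have Tp : 0 < T by exact: lt_le_trans T1.
have Wp : 0 < W by exact: lt_le_trans W1.
have /andP[Q1 Q2] := hQ; have /andP[Y1 Y2] := hY.
have Qp : 0 < Q%:R :> R by exact: lt_le_trans Q1.
have Yp : 0 < Y%:R :> R by apply: lt_le_trans Y1; rewrite exprn_gt0.
have YQ : Q%:R * Y%:R <= 4 * T ^+ 3.
  have -> : 4 * T ^+ 3 = (2 * T) * (2 * T ^+ 2) by ring.
  by rewrite ler_pM // ltW.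
have T8 : 8 * T ^+ 3 <= N%:R.
  apply: le_trans (_ : s <= _).
    apply: le_trans hs1; rewrite ler_wpM2r ?exprn_ge0 ?(ltW Tp) //.
    by move: W1; clear; lra.
  rewrite -s2 expr2 -[leLHS]mul1r ler_wpM2r //; apply: le_trans hs1.
  by rewrite !mulr_ege1 ?ler1n ?exprn_ege1.
apply: (@exp_sum_of_squares R gamma h 0 c T C1 C2 D N Q J) => //; [exact: ltW|exact: ltW| |].
- move=> L QL LN.
  have L0 : (0 < L)%N by apply: leq_trans QL; rewrite -(ltr0n R).
  have Lp : 0 < L%:R :> R by rewrite ltr0n.
  have Ls : L%:R <= 4 * s.
    rewrite -(@ler_pXn2r _ 2) ?nnegrE ?mulr_ge0 // exprMn s2 -!natrX -natrM ler_nat.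
    by rewrite -mulnn; apply: leq_trans LN _.
  have WYQ : 4 * W * Q%:R * Y%:R <= 16 * (W * T ^+ 3).
    have -> : 16 * (W * T ^+ 3) = 4 * W * (4 * T ^+ 3) by ring.
    by rewrite -mulrA ler_wpM2l // mulr_ge0 // ltW.
  apply: (@key h T W N L Q Y) => //.
  rewrite ler_pdivlMr ?mulr_gt0 ?ltr0n //.
  apply: le_trans (_ : 4 * (16 * (W * T ^+ 3)) * (2 * (4 * s)) <= _).
    rewrite ler_pM ?mulr_ge0 ?(ltW Wp) ?(ltW Lp) ?ler_wpM2l //.
    by move: WYQ; clear; lra.
  have -> : 4 * (16 * (W * T ^+ 3)) * (2 * (4 * s)) = (512 * W * T ^+ 3) * s by ring.
  by rewrite -s2 expr2 ler_wpM2r.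
- move=> d b /andP[d0 dQ] bd.
  apply: (@key2 h c T W N Y d b) => //.
  by apply: le_trans Q2; rewrite ler_nat.
Qed.

(** * Choice of the parameters *)

Lemma powRX (R : realType) (x a : R) (n : nat) : (x `^ a) ^+ n = x `^ (a * n%:R).
Proof. by rewrite powRrM powR_mulrn ?powR_ge0. Qed.

Lemma powR_add (R : realType) (x a b : R) : 0 < x -> x `^ a * x `^ b = x `^ (a + b).
Proof. by move=> x0; rewrite powRD // (gt_eqF x0) implybT. Qed.

Lemma powR_ge1 (R : realType) (x a : R) : 1 <= x -> 0 <= a -> 1 <= x `^ a.
Proof. by move=> x1 a0; have := ler_powR x1 a0; rewrite powRr0. Qed.

Lemma near_powR_absorb (R : realType) (a b C : R) : a < b ->
  \forall N \near \oo, C * (N%:R : R) `^ a <= N%:R `^ b.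
Proof.
move=> ab; near=> N.
have N1 : 1 <= N%:R :> R by near: N; exact: nbhs_infty_ger.
have hN : `|C| `^ (b - a)^-1 <= N%:R by near: N; exact: nbhs_infty_ger.
have d0 : 0 < b - a by rewrite subr_gt0.
have N0 : 0 < N%:R :> R by exact: lt_le_trans N1.
have -> : b = a + (b - a) by ring.
rewrite -powR_add // mulrC ler_wpM2l ?powR_ge0 //.
apply: le_trans (ler_norm C) _.
have -> : `|C| = (`|C| `^ (b - a)^-1) `^ (b - a).
  by rewrite -powRrM mulVf ?gt_eqF // powRr1.
by apply: ge0_ler_powR; rewrite ?nnegrE ?powR_ge0 // ltW.
Unshelve. all: by end_near.
Qed.

Lemma ln_le_self (R : realType) (x : R) : 0 < x -> ln x <= x.
Proof.
move=> x0; have := @le_ln1Dx R (x - 1); rewrite (_ : 1 + (x - 1) = x); last by ring.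
by move=> h; apply: le_trans (h _) _; rewrite ?ltrBrDr ?addNr // lerBlDr lerDl.
Qed.

(** ln y is 2 / e times ln y^(e/2), hence at most 2 / e times y^(e/2); doubling the exponent absorbs
    the constants. *)
Lemma near_ln_absorb (R : realType) (e : R) : 0 < e ->
  \forall N \near \oo, ln (16 * N)%:R <= (N%:R : R) `^ e.
Proof.
move=> e0; near=> N.
have N1 : 1 <= N%:R :> R by near: N; exact: nbhs_infty_ger.
have N0 : 0 < N%:R :> R by exact: lt_le_trans N1.
have h : 2 / e * 16 `^ (e / 2) * N%:R `^ (e / 2) <= N%:R `^ e.
  by near: N; apply: near_powR_absorb; lra.
apply: le_trans h; rewrite natrM -mulrA -powRM // -ler_pdivrMl ?divr_gt0 //.
rewrite invf_div -ln_powR ln_le_self // powR_gt0 // mulr_gt0 //.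
Unshelve. all: by end_near.
Qed.

Lemma ln4_ge (R : realType) : 3 / 4 <= ln (4 : R).
Proof.
have := @le_ln1Dx R (4^-1 - 1); rewrite (_ : 1 + (4^-1 - 1) = 4^-1 :> R); last by ring.
by rewrite lnV ?posrE // => h; have := h ltac:(lra); lra.
Qed.

Lemma ln_16_ge1 (R : realType) (N : nat) : (0 < N)%N -> 1 <= ln (16 * N)%:R :> R.
Proof.
move=> N0; apply: le_trans (_ : ln (16%:R : R) <= _).
  have -> : 16%:R = 4 ^+ 2 :> R by ring.
  by rewrite lnXn // mulr2n; have := ln4_ge R; lra.
by rewrite ler_ln ?posrE ?ltr0n ?muln_gt0 // ler_nat leq_pmulr.
Qed.

Lemma up_log4_le (R : realType) (N : nat) : (0 < N)%N ->
  (up_log 4 (16 * N))%:R <= 3 * ln (16 * N)%:R :> R.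
Proof.
move=> N0; have l1 := ln_16_ge1 R N0.
have N16 : (1 < 16 * N)%N by rewrite (leq_trans _ (leq_pmulr _ N0)).
have := up_log_gtn (isT : (1 < 4)%N) N16.
have : (0 < up_log 4 (16 * N))%N by rewrite up_log_gt0.
case: (up_log _ _) => // J _ /= hJ.
have : J%:R * ln (4 : R) <= ln (16 * N)%:R.
  rewrite mulr_natl -lnXn // ler_ln ?posrE ?exprn_gt0 ?ltr0n ?muln_gt0 //.
  by rewrite -natrX ler_nat ltnW.
have : J%:R * (3 / 4) <= J%:R * ln (4 : R) by rewrite ler_wpM2l // ln4_ge.
rewrite -natr1; move: l1; move: (ln _) (J%:R * ln _) => x y; lra.
Qed.

Lemma harm_le (R : realType) (n : nat) : (0 < n)%N -> harm R n.+1 <= 1 + ln n%:R.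
Proof.
elim: n => // -[|n] IH _; first by rewrite /harm big_nat1 invr1 ln1 addr0.
rewrite /harm big_nat_recr //= -/(harm R n.+2).
apply: le_trans (_ : 1 + ln n.+1%:R + n.+2%:R^-1 <= _); first by rewrite lerD2r IH.
rewrite -addrA lerD2l -lerBrDl.
have n1 : 0 < n.+1%:R :> R by rewrite ltr0n.
have n2 : 0 < n.+2%:R :> R by rewrite ltr0n.
rewrite -lerN2 opprB -ln_div ?posrE //.
have := @le_ln1Dx R (- n.+2%:R^-1).
have -> : 1 + - n.+2%:R^-1 = n.+1%:R / n.+2%:R :> R.
  by rewrite -[n.+1%:R](addrK 1) natr1 mulrBl mul1r divff ?gt_eqF.
by apply; rewrite ltrN2 invf_lt1 // ltr1n.
Qed.

Lemma harm_ge0 (R : realType) (n : nat) : 0 <= harm R n.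
Proof. by apply: sumr_ge0 => i _; rewrite invr_ge0. Qed.

Lemma harm_le_ln (R : realType) (n X : nat) : (0 < n <= 16 * X)%N ->
  harm R n <= 2 * ln (16 * X)%:R /\ harm R n.+1 <= 2 * ln (16 * X)%:R.
Proof.
move=> /andP[n0 nX]; have X0 : (0 < X)%N.
  by have := leq_trans n0 nX; rewrite muln_gt0.
have h : harm R n.+1 <= 2 * ln (16 * X)%:R.
  apply: le_trans (harm_le R n0) _.
  have : ln n%:R <= ln (16 * X)%:R :> R by rewrite ler_ln ?posrE ?ltr0n ?muln_gt0 // ler_nat.
  by have := ln_16_ge1 R X0; move: (ln _) (ln _) => x y; lra.
by split=> //; apply: le_trans h; rewrite /harm big_nat_recr //= lerDl invr_ge0.
Qed.

(* These inequalities are the hypotheses of [exp_sum_far] and [exp_sum_zero] for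
   T = x^(2 sigma + 2 eta), W = x^eta, D = x^(eta / 8), k <= x^(delta + eta) and
   q0 between x^(15 sigma / 2) and twice that. *)
Lemma near_parameter_facts (R : realType) (sigma delta C Cd : R)
    (eta := delta / 16) :
  0 < delta -> delta < sigma -> 14 * sigma + 15 * delta = 1 -> 0 <= C ->
  \forall N \near \oo, let x : R := N%:R in
   [/\ 1 <= x, 512 * x `^ (6 * sigma + 7 * eta) <= x `^ 2^-1,
       16 * x `^ (7 * sigma + delta + (8 + 3 / 4) * eta) <= x `^ 2^-1,
       1 * x `^ (4 * sigma + delta + (5 + 1 / 4) * eta) <= x `^ (15 / 2 * sigma) &
   [/\ 2 * x `^ (15 / 2 * sigma) <= x `^ (8 * sigma + 8 * eta), 8 * x `^ (6 * sigma + delta + 7 * eta) <= x `^ (15 / 2 * sigma),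
       512 * x `^ (14 * sigma + delta + 16 * eta) <= x `^ 1,
       64 * x `^ (13 * sigma + sigma / 2 + 7 * eta) <= x `^ 1 &
   [/\ ln (16 * N)%:R <= x `^ (eta / 16),
       4 * x `^ (sigma - delta + eta / 8) <= x `^ (2 * sigma + 2 * eta),
       22 * Num.sqrt C * x `^ (eta / 4) <= x `^ (3 / 8 * eta) &
       Cd * x `^ (eta / 16) <= x `^ (eta / 8)]]].
Proof.
move=> d0 ds e1 C0; have eE : eta * 16 = delta by rewrite /eta; field.
have e0 : 0 < eta by rewrite /eta; lra.
move: eta eE e0 => eta eE e0.
(* Apart from the logarithm, each clause compares two powers of x; the exponent inequalities are
   linear consequences of 14 sigma + 15 delta = 1, delta < sigma and 16 eta = delta. *)
near=> N; split; first by near: N; exact: nbhs_infty_ger.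
- by near: N; apply: near_powR_absorb; lra.
- by near: N; apply: near_powR_absorb; lra.
- by near: N; apply: near_powR_absorb; lra.
split.
- by near: N; apply: near_powR_absorb; lra.
- by near: N; apply: near_powR_absorb; lra.
- by near: N; apply: near_powR_absorb; lra.
- by near: N; apply: near_powR_absorb; lra.
split.
- by near: N; apply: near_ln_absorb; lra.
- by near: N; apply: near_powR_absorb; lra.
- by near: N; apply: near_powR_absorb; lra.
- by near: N; apply: near_powR_absorb; lra.
Unshelve. all: by end_near.
Qed.

Lemma exists_between_double (R : realType) (T : R) : 1 <= T ->
  exists Q : nat, T <= Q%:R <= 2 * T.
Proof.
move=> T1; have T0 : 0 <= T by exact: le_trans T1.
have [n hn] : exists n : nat, n%:R <= T < n.+1%:R.
  by have := truncn_itv T0; exists (Num.trunc T).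
exists n.+1; case/andP: hn => h1 h2; rewrite ltW //= -natr1.
by move: T1 h1; clear; lra.
Qed.

(** N is the integer part of q^(1 / tau). As tau <= 1, N is at least q, and q <= (2 N)^tau <= 2
    N^tau. *)
Lemma exists_scale (R : realType) (tau : R) (q m : nat) : 0 < tau <= 1 -> (m < q)%N ->
  exists2 N : nat, (m <= N)%N & N%:R `^ tau <= q%:R <= 2 * N%:R `^ tau.
Proof.
move=> /andP[t0 t1] mq.
have q1 : 1 <= q%:R :> R by rewrite ler1n (leq_ltn_trans _ mq).
have q0 : 0 < q%:R :> R by exact: lt_le_trans q1.
have z0 : 0 <= q%:R `^ tau^-1 :> R by exact: powR_ge0.
have zq : (q%:R `^ tau^-1) `^ tau = q%:R :> R by rewrite -powRrM mulVf ?gt_eqF // powRr1 // ltW.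
have qz : q%:R <= q%:R `^ tau^-1 :> R.
  by rewrite -[leLHS]powRr1 ?(ltW q0) // ler_powR // invf_ge1.
have [N /andP[h1 h2]] : exists N : nat, N%:R <= (q%:R : R) `^ tau^-1 < N.+1%:R.
  by have := truncn_itv z0; exists (Num.trunc (q%:R `^ tau^-1 : R)).
have qN : (q <= N)%N.
  by have := le_lt_trans qz h2; rewrite ltr_nat ltnS.
exists N; first exact: leq_trans (ltnW mq) qN.
have N1 : 1 <= N%:R :> R by apply: le_trans q1 _; rewrite ler_nat.
apply/andP; split.
  by rewrite -[leRHS]zq ge0_ler_powR ?nnegrE // ltW.
rewrite -[leLHS]zq; apply: le_trans (_ : (2 * N%:R) `^ tau <= _).
  rewrite ge0_ler_powR ?nnegrE ?mulr_ge0 ?(ltW t0) //.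
  by apply: le_trans (ltW h2) _; rewrite -natr1; move: N1; clear; lra.
rewrite powRM // ler_wpM2r ?powR_ge0 //.
by rewrite -[leRHS]powRr1 // ler_powR // ler1n.
Qed.

(** The root of 1 / T saves x^(sigma + eta). Logarithms and divisor counts cost lam^2 D <= x^(eta /
    4), and constants raise this to x^(3 eta / 8). The 22 is 5 * 2 + 4 * 3. *)
Lemma collect_bound (R : realType) (x sigma eta C C' lam H J D T : R) :
  1 <= x -> 0 < eta -> 0 <= C' <= C -> T = x `^ (2 * sigma + 2 * eta) -> 1 <= lam ->
  lam <= x `^ (eta / 16) -> D = x `^ (eta / 8) -> 0 <= H <= 2 * lam -> 0 <= J <= 3 * lam ->
  22 * Num.sqrt C * x `^ (eta / 4) <= x `^ (3 / 8 * eta) ->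
  lam * x * (5 * H + 4 * J * D) * Num.sqrt (C' / T) <= x `^ (1 - sigma - eta / 2).
Proof.
move=> x1 e0 /andP[C0 CC] TE l1 lx DE /andP[H0 H2] /andP[J0 J3] hC.
have x0 : 0 < x by exact: lt_le_trans x1.
have D1 : 1 <= D by rewrite DE powR_ge1 // divr_ge0 // ltW.
have l0 : 0 <= lam by exact: le_trans l1.
have D0 : 0 <= D by exact: le_trans D1.
have h1 : 5 * H + 4 * J * D <= 22 * (lam * D).
  have a : J * D <= 3 * (lam * D) by rewrite mulrA ler_wpM2r.
  have b : lam * 1 <= lam * D by rewrite ler_wpM2l.
  by move: a b H2; clear; lra.
have h2 : Num.sqrt (C' / T) <= Num.sqrt C * x `^ (- (sigma + eta)).
  have -> : x `^ (- (sigma + eta)) = Num.sqrt (T^-1).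
    rewrite -powR12_sqrt ?invr_ge0 ?TE ?powR_ge0 // -powRN -powRrM; congr powR.
    by field.
  by rewrite -sqrtrM ?(le_trans C0) // ler_wsqrtr // ler_wpM2r // invr_ge0 TE powR_ge0.
have h3 : lam * (lam * D) <= x `^ (eta / 4).
  have -> : x `^ (eta / 4) = x `^ (eta / 16) * (x `^ (eta / 16) * x `^ (eta / 8)).
    by rewrite !powR_add //; congr powR; field.
  by rewrite -DE !ler_pM ?mulr_ge0.
apply: le_trans (_ : lam * x * (22 * (lam * D)) * (Num.sqrt C * x `^ (- (sigma + eta))) <= _).
  rewrite ler_pM ?sqrtr_ge0 ?mulr_ge0 ?(ltW x0) //.
    by rewrite addr_ge0 ?mulr_ge0.
  by rewrite ler_wpM2l ?mulr_ge0 ?(ltW x0).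
have -> : lam * x * (22 * (lam * D)) * (Num.sqrt C * x `^ (- (sigma + eta))) =
   (22 * Num.sqrt C * (lam * (lam * D))) * (x * x `^ (- (sigma + eta))) by ring.
have xx : x * x `^ (- (sigma + eta)) = x `^ (1 - (sigma + eta)).
  by rewrite -{1}(powRr1 (ltW x0)) powR_add.
rewrite xx; apply: le_trans (_ : x `^ (3 / 8 * eta) * x `^ (1 - (sigma + eta)) <= _).
  rewrite ler_wpM2r ?powR_ge0 //; apply: le_trans hC.
  by rewrite ler_wpM2l // mulr_ge0 ?sqrtr_ge0.
by rewrite powR_add // ler_powR //; move: e0; clear; lra.
Qed.

Definition mangoldt_sum (R : realType) (gamma h beta c : R) (N : nat) : R :=
  \sum_(1 <= n < (16 * N).+1) (in_range N n)%:R * (mangoldt R n * ec (phase gamma h beta c n)).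

(** The cosine is even, so h >= 0 may be assumed. *)
Lemma mangoldt_sumN (R : realType) (gamma h beta c : R) (N : nat) :
  mangoldt_sum gamma (- h) (- beta) (- c) N = mangoldt_sum gamma h beta c N.
Proof.
by apply: eq_bigr => n _; rewrite /phase !mulNr -!opprD ecN.
Qed.

Lemma mangoldt_sum_small (R : realType) (gamma alpha : R) (delta := (14 * gamma - 13) / 29)
    (sigma := 1 - gamma + delta) (eta := delta / 16) :
  13 / 14 < gamma < 1 -> (forall (n : nat) (m : int), (0 < n)%N -> n%:R * (2 * alpha) != m%:~R) ->
  forall n0 : nat, exists2 N : nat, (n0 <= N)%N &
    forall (h k : int) (c : R), (h != 0) || (k != 0) ->
      `|h%:~R| <= N%:R `^ (1 - gamma + eta) -> `|k%:~R| <= N%:R `^ (delta + eta) ->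
      `|mangoldt_sum gamma h%:~R (k%:~R * alpha) c N| <= N%:R `^ (1 - sigma - eta / 2).
Proof.
move=> /andP[g1 g2] hirr n0.
have d0 : 0 < delta by rewrite /delta; lra.
have sE : 1 - gamma = sigma - delta by rewrite /sigma; ring.
have e1 : 14 * sigma + 15 * delta = 1 by rewrite /sigma /delta; field.
have ds : delta < sigma by rewrite /sigma; lra.
have e0 : 0 < eta by rewrite /eta; lra.
have eE : delta = 16 * eta by rewrite /eta; field.
have g01 : 0 < gamma < 1 by rewrite g2 andbT; lra.
have [Cf Cf0 far] := exp_sum_far R; have [Cz Cz0 zero] := exp_sum_zero g01.
have C0 : 0 <= Cf + Cz by rewrite addr_ge0 // ltW.
have [Cd Cd1 hdiv] : exists2 C : R, 1 <= C & forall n, (0 < n)%N ->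
    (size (divisors n))%:R <= C * n%:R `^ (eta / 16).
  by apply: divisor_bound; rewrite divr_gt0.
have := near_parameter_facts (Cd * 16 `^ (eta / 16)) d0 ds e1 C0.
rewrite -/eta; clearbody eta sigma delta => -[N1 _ facts].
(* A denominator of 2 alpha comes first and the scale N is read off from it; q0 beyond n0 and N1
   makes N as large. *)
have [q0 [a0 [hq ga]]] := good_approx_large (maxn n0 N1) hirr.
have tau01 : 0 < 15 / 2 * sigma <= 1.
  by apply/andP; move: ds d0 e1; clear; split; lra.
have [N hN /andP[qN1 qN2]] := exists_scale tau01 hq.
have N0 : (n0 <= N)%N by apply: leq_trans hN; exact: leq_maxl.
exists N => //.
have {facts} := facts N (leq_trans (leq_maxr _ _) hN).
set x : R := N%:R => -[x1 f1 f2 f3 [f4 f5 f6 f7 [f8 f9 f10 f11]]].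
have xp : 0 < x by exact: lt_le_trans x1.
have Npos : (0 < N)%N by rewrite -(ltr0n R).
have [T TE] : exists T, T = x `^ (2 * sigma + 2 * eta) by eexists.
have [W WE] : exists W, W = x `^ eta by eexists.
have [D DE] : exists D, D = x `^ (eta / 8) by eexists.
have [s sE'] : exists s, s = x `^ 2^-1 by eexists.
have T1 : 1 <= T by rewrite TE powR_ge1 //; move: e0 eE ds; clear; lra.
have W1 : 1 <= W by rewrite WE powR_ge1 //; move: e0 eE ds; clear; lra.
have D1 : 1 <= D by rewrite DE powR_ge1 //; move: e0 eE ds; clear; lra.
have T21 : 1 <= T ^+ 2 by rewrite exprn_ege1.
have [Q hQ] := exists_between_double T1; have [Y hY] := exists_between_double T21.
have s0 : 0 <= s by rewrite sE' powR_ge0.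
have s2 : s ^+ 2 = x by rewrite sE' powRX mulVf ?powRr1 // ltW.
have T3 : T ^+ 3 = x `^ (6 * sigma + 6 * eta) by rewrite TE powRX; congr powR; ring.
have T2 : T ^+ 2 = x `^ (4 * sigma + 4 * eta) by rewrite TE powRX; congr powR; ring.
have T4 : T ^+ 4 = x `^ (8 * sigma + 8 * eta) by rewrite TE powRX; congr powR; ring.
have T7 : T ^+ 7 = x `^ (14 * sigma + 14 * eta) by rewrite TE powRX; congr powR; ring.
have WT3 : W * T ^+ 3 = x `^ (6 * sigma + 7 * eta).
  by rewrite T3 WE powR_add //; congr powR; ring.
have hs1 : 512 * W * T ^+ 3 <= s by rewrite -mulrA WT3 sE'.
have hdivN n : (0 < n <= 16 * N)%N -> (size (divisors n))%:R <= D.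
  move=> /andP[n1 n2]; apply: le_trans (hdiv n n1) _.
  rewrite DE; apply: le_trans f11; rewrite -mulrA ler_wpM2l ?(le_trans _ Cd1) //.
  rewrite -powRM ?(ltW xp) // ge0_ler_powR ?nnegrE ?mulr_ge0 ?(ltW xp) ?divr_ge0 ?(ltW e0) //.
  by rewrite /x -natrM ler_nat.
pose J := up_log 4 (16 * N).
have NJ : (16 * N <= 4 ^ J)%N by exact: up_logP.
have JL : J%:R <= 3 * ln (16 * N)%:R :> R by exact: up_log4_le.
have lam1 : 1 <= ln (16 * N)%:R :> R by exact: ln_16_ge1.
clearbody J.
have /andP[Q1 Q2] := hQ; have /andP[Y1 Y2] := hY.
have T0 : 0 < T by exact: lt_le_trans T1.
have T3x : 512 * T ^+ 3 <= x.
  apply: le_trans (_ : s <= _).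
    apply: le_trans hs1; rewrite -mulrA ler_wpM2l ?ler0n // -[leLHS]mul1r ler_wpM2r //.
    by rewrite exprn_ge0 // ltW.
  rewrite -s2 expr2 -[leLHS]mul1r ler_wpM2r //.
  by apply: le_trans hs1; rewrite !mulr_ege1 ?ler1n ?exprn_ege1.
have Yx : Y%:R <= x.
  apply: le_trans Y2 _; apply: le_trans T3x.
  have -> : 512 * T ^+ 3 = (512 * T) * T ^+ 2 by ring.
  by rewrite ler_wpM2r ?exprn_ge0 ?(ltW T0) //; move: T1; clear; lra.
have Qx : Q%:R <= x.
  apply: le_trans Q2 _; apply: le_trans T3x.
  have -> : 512 * T ^+ 3 = (512 * T ^+ 2) * T by ring.
  by rewrite ler_wpM2r ?(ltW T0) //; move: T21; clear; lra.
have Q0 : (0 < Q <= 16 * N)%N.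
  rewrite -(ltr0n R) (lt_le_trans T0 Q1) /=; apply: (@leq_trans N); last by rewrite leq_pmull.
  by rewrite -(ler_nat R).
have Y0 : (0 < Y <= 16 * N)%N.
  rewrite -(ltr0n R) (lt_le_trans _ Y1) ?exprn_gt0 //=.
  apply: (@leq_trans N); last by rewrite leq_pmull.
  by rewrite -(ler_nat R).
have [HQ HQ1] := harm_le_ln R Q0; have [HY _] := harm_le_ln R Y0.
have fin C' : 0 <= C' <= Cf + Cz ->
    ln (16 * N)%:R * x * (5 * harm R Q.+1 + 4 * J%:R * D) * Num.sqrt (C' / T) <=
      x `^ (1 - sigma - eta / 2).
  by move=> hC'; apply: (@collect_bound R x sigma eta (Cf + Cz)) => //; rewrite ?harm_ge0 ?ler0n.
have main (h k : int) (c : R) : 0 <= h -> (h != 0) || (k != 0) ->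
      `|h%:~R| <= x `^ (1 - gamma + eta) -> `|k%:~R| <= x `^ (delta + eta) ->
      `|mangoldt_sum gamma h%:~R (k%:~R * alpha) c N| <= x `^ (1 - sigma - eta / 2).
  move=> h0 hk hh hk'.
  have h0R : 0 <= h%:~R :> R by rewrite ler0z.
  have hW : h%:~R <= W * N%:R `^ (1 - gamma).
    rewrite WE -/x powR_add // addrC; apply: le_trans hh; exact: ler_norm.
  (* With k = 0 the slopes vanish and h >= 1, since h and k are not both 0; otherwise the
     approximation of 2 alpha is used with |k|. *)
  case: (eqVneq k 0) => [k0|k0].
    have h1 : 1 <= h%:~R :> R.
      by move: hk; rewrite k0 eqxx orbF => hne; rewrite (_ : 1 = 1%:~R :> R) // ler_int; move: h0 hne; clear; lia.
    rewrite k0 mul0r; apply: le_trans (fin Cz _); last first.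
      by rewrite (ltW Cz0) lerDr ltW.
    apply: (@zero h%:~R c T W D s N Q Y J) => //.
    - rewrite -/x -[leRHS](powRr1 (ltW xp)); apply: le_trans f6.
      rewrite -mulrA T7 WE powR_add // ler_wpM2l ?ler0n // ler_powR //.
      by move: e0 eE; clear; lra.
    - rewrite -/x sE; apply: le_trans (_ : x `^ (sigma - delta) * (2 * x `^ (eta / 16)) <= _).
        by rewrite ler_wpM2l ?powR_ge0 //; apply: le_trans HY _; rewrite ler_wpM2l.
      rewrite TE; apply: le_trans f9.
      rewrite mulrCA powR_add // ler_pM ?powR_ge0 ?ler_nat // ler_powR //.
      by move: e0; clear; lra.
    - rewrite -/x sE TE; apply: le_trans f9.
      apply: le_trans (_ : x `^ (sigma - delta) * ((2 * x `^ (eta / 16)) * (2 * x `^ (eta / 16))) <= _).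
        rewrite ler_wpM2l ?powR_ge0 // ler_pM ?harm_ge0 //.
          by apply: le_trans HQ _; rewrite ler_wpM2l.
        by apply: le_trans HY _; rewrite ler_wpM2l.
      have -> : x `^ (sigma - delta) * ((2 * x `^ (eta / 16)) * (2 * x `^ (eta / 16))) =
        4 * (x `^ (sigma - delta) * (x `^ (eta / 16) * x `^ (eta / 16))) by ring.
      rewrite !powR_add //; apply: le_of_eq; congr (_ * powR _ _); by field.
  have kn0 : (0 < `|k|)%N by rewrite absz_gt0.
  have kx : (`|k|%N)%:R <= x `^ (delta + eta).
    by apply: le_trans hk'; rewrite natr_absz intr_norm.
  apply: le_trans (fin Cf _); last by rewrite (ltW Cf0) lerDl ltW.
  have xk a : 0 <= a -> a * (`|k|%N)%:R <= a * x `^ (delta + eta).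
    by move=> a0'; rewrite ler_wpM2l.
  have kk (a e b : R) : 0 <= a -> a * x `^ (e + (delta + eta)) <= b -> a * x `^ e * (`|k|%N)%:R <= b.
    move=> a0' hb; apply: le_trans (xk _ _) _; first by rewrite mulr_ge0 ?powR_ge0.
    by rewrite -mulrA powR_add.
  apply: (@far gamma h%:~R (k%:~R * alpha) c (2 * alpha) T W D s a0 q0 `|k|%N N Q Y J) => //.
  (* [nd] is even, so the sign of k drops out. *)
  - move=> n; have -> : 2 * (k%:~R * alpha) * n%:R = k%:~R * (n%:R * (2 * alpha)) by ring.
    rewrite natrM -mulrA; case: (lerP 0 k) => ks.
      by rewrite -{1}(gez0_abs ks) pmulrn.
    by rewrite -{1}(opprK k) -(ltz0_abs ks) rmorphN /= mulNr ndN pmulrn.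
  - have e : D ^+ 2 * (T ^+ 2 * Num.sqrt (W * T ^+ 3)) = x `^ (7 * sigma + (7 + 3 / 4) * eta).
      by rewrite WT3 -powR12_sqrt ?powR_ge0 // -powRrM T2 DE powRX !powR_add //; congr powR; field.
    have -> : 16 * D ^+ 2 * (`|k|%N)%:R * T ^+ 2 * Num.sqrt (W * T ^+ 3) =
      16 * (D ^+ 2 * (T ^+ 2 * Num.sqrt (W * T ^+ 3))) * (`|k|%N)%:R by ring.
    rewrite e sE'; apply: kk => //; apply: le_trans f2; apply: le_of_eq.
    by congr (_ * powR _ _); ring.
  - have e : D ^+ 2 * T ^+ 2 = x `^ (4 * sigma + (4 + 1 / 4) * eta).
      by rewrite T2 DE powRX powR_add //; congr powR; field.
    have -> : D ^+ 2 * (`|k|%N)%:R * T ^+ 2 = 1 * (D ^+ 2 * T ^+ 2) * (`|k|%N)%:R by ring.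
    rewrite e; apply: le_trans qN1; apply: kk => //; apply: le_trans f3; apply: le_of_eq.
    by congr (_ * powR _ _); ring.
  - apply: le_trans qN2 _; apply: le_trans f4 _; rewrite T4 -[leLHS]mul1r ler_wpM2r ?powR_ge0 //.
    by rewrite ler1n.
  - have -> : 8 * (`|k|%N)%:R * T ^+ 3 = 8 * T ^+ 3 * (`|k|%N)%:R by ring.
    rewrite T3; apply: le_trans qN1; apply: kk => //; apply: le_trans f5; apply: le_of_eq.
    by congr (_ * powR _ _); ring.
  - have e : W * T ^+ 7 = x `^ (14 * sigma + 15 * eta).
      by rewrite T7 WE powR_add //; congr powR; ring.
    have -> : 512 * (`|k|%N)%:R * W * T ^+ 7 = 512 * (W * T ^+ 7) * (`|k|%N)%:R by ring.
    rewrite e -/x -[leRHS](powRr1 (ltW xp)); apply: kk; rewrite ?ler0n //.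
    by apply: le_trans f6; apply: le_of_eq; congr (_ * powR _ _); ring.
  - have -> : 32 * q0%:R * W * T ^+ 3 = 32 * (W * T ^+ 3) * q0%:R by ring.
    rewrite WT3 -/x -[leRHS](powRr1 (ltW xp)); apply: le_trans f7.
    apply: le_trans (_ : 32 * x `^ (6 * sigma + 7 * eta) * (2 * x `^ (15 / 2 * sigma)) <= _).
      by rewrite ler_wpM2l // mulr_ge0 ?powR_ge0 ?ler0n.
    have -> : 32 * x `^ (6 * sigma + 7 * eta) * (2 * x `^ (15 / 2 * sigma)) =
      64 * (x `^ (6 * sigma + 7 * eta) * x `^ (15 / 2 * sigma)) by ring.
    rewrite powR_add //; apply: le_of_eq; congr (_ * powR _ _); by field.
move=> h k c hk hh hk'; case: (lerP 0 h) => h0; first exact: main.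
rewrite -mangoldt_sumN -mulNr -!rmorphN; apply: main => //.
- by rewrite oppr_ge0 ltW.
- by rewrite !oppr_eq0.
- by rewrite rmorphN normrN.
- by rewrite rmorphN normrN.
Qed.

(** * From the box modulo 1 to primes *)

Lemma powR_le1 (R : realType) (x a : R) : 1 <= x -> a <= 0 -> x `^ a <= 1.
Proof. by move=> x1 a0; have := ler_powR x1 a0; rewrite powRr0. Qed.

Lemma irrational_double (R : realType) (alpha : R) : irrational alpha ->
  forall (n : nat) (m : int), (0 < n)%N -> n%:R * (2 * alpha) != m%:~R.
Proof.
move=> ha n m n0; apply/eqP => e; apply: ha.
have np : n%:R != 0 :> R by rewrite pnatr_eq0 -lt0n.
exists (m%:~R / (n * 2)%:R) => //.
rewrite fmorph_div /= ratr_int ratr_nat -e natrM; field; exact: np.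
Qed.

Lemma dist_int_le_nd (R : realType) (x : R) : dist_int x <= nd x.
Proof.
apply: ge_inf; last by exists (Num.floor (x + 2^-1)).
by exists 0 => _ [m _ <-]; exact: normr_ge0.
Qed.

Lemma floor_root (R : realType) (gamma : R) (p m : nat) : 0 < gamma ->
  p%:R `^ gamma < m%:R :> R -> m%:R < p.+1%:R `^ gamma :> R ->
  Num.floor (m%:R `^ (1 / gamma) : R) = p%:Z.
Proof.
move=> g0 h1 h2; apply: floor_def.
have mm : (m%:R `^ (1 / gamma)) `^ gamma = m%:R :> R.
  by rewrite -powRrM div1r mulVf ?gt_eqF // powRr1.
apply/andP; split.
  rewrite leNgt; apply/negP => h; move: h1; rewrite -mm ltNge => /negP; apply.
  by rewrite ge0_ler_powR ?nnegrE ?powR_ge0 // ltW.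
rewrite ltNge; apply/negP => h; move: h2; rewrite -mm ltNge => /negP; apply.
rewrite ge0_ler_powR ?nnegrE ?powR_ge0 ?(ltW g0) //.
by apply: le_trans h; rewrite intrD -natr1.
Qed.

(** The hypothesis on [nd] puts an integer strictly between p^gamma and p^gamma + 2 e, and 2 e is at
    most (p + 1)^gamma - p^gamma by the mean value theorem. The shift by [e] centres this one-sided
    window. *)
Lemma piatetski_shapiro_near (R : realType) (gamma : R) (p : nat) (e : R) :
  0 < gamma < 1 -> (0 < p)%N -> 0 < e -> 2 * e <= gamma * p.+1%:R `^ (gamma - 1) ->
  nd (p%:R `^ gamma + e) < e ->
  exists2 n : nat, (0 < n)%N & Num.floor (n%:R `^ (1 / gamma) : R) = p%:Z.
Proof.
move=> /andP[g0 g1] p0 e0 he; have [m -> _] := nd_ex (p%:R `^ gamma + e).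
rewrite ltr_norml => /andP[h1 h2].
have pp : 0 < p%:R :> R by rewrite ltr0n.
have a1 : p%:R `^ gamma < m%:~R by move: h2; clear; lra.
have a2 : m%:~R < p.+1%:R `^ gamma.
  have [z /andP[z1 z2] dz] := @powR_diff1 R gamma p%:R 1 pp ler01.
  rewrite natr1 in z2 dz.
  have hz : p.+1%:R `^ (gamma - 1) <= z `^ (gamma - 1).
    by rewrite powR_antitone ?(lt_le_trans pp) // subr_le0 ltW.
  have : gamma * p.+1%:R `^ (gamma - 1) <= gamma * z `^ (gamma - 1) by rewrite ler_wpM2l // ltW.
  by move: dz he h1; clear; lra.
have m0 : 0 < m%:~R :> R by apply: le_lt_trans a1; exact: powR_ge0.
have mE : m = `|m|%N :> int by rewrite gez0_abs // -(ler0z R) ltW.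
rewrite mE -pmulrn in a1 a2.
exists `|m|%N; first by move: m0; rewrite mE ltr0z.
exact: floor_root.
Qed.

(** [mangoldt_nonprime_sum] with bases up to about 4 sqrt(N) and logarithmically many exponents; 35
    is 5 * 7. *)
Lemma nonprime_part_le (R : realType) (N : nat) : (0 < N)%N ->
  \sum_(1 <= n < (16 * N).+1) (~~ prime n)%:R * ((in_range N n)%:R * mangoldt R n) <=
  35 * ln (16 * N)%:R ^+ 2 * N%:R `^ 2^-1.
Proof.
move=> N0; set lam := ln _; have l1 : 1 <= lam by exact: ln_16_ge1.
have N1 : 1 <= N%:R :> R by rewrite ler1n.
set r := N%:R `^ 2^-1 : R.
have r2 : r ^+ 2 = N%:R by rewrite powRX mulVf // powRr1.
have r1 : 1 <= r by rewrite powR_ge1 // invr_ge0.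
have r40 : 0 <= 4 * r by rewrite mulr_ge0 // (le_trans _ r1).
have [s /andP[s1 s2]] : exists s : nat, s%:R <= 4 * r < s.+1%:R.
  by have := truncn_itv r40; exists (Num.trunc (4 * r)).
have hs : (16 * N < s.+1 * s.+1)%N.
  rewrite -(ltr_nat R) !natrM -r2 (_ : 16 * r ^+ 2 = (4 * r) * (4 * r)); last by ring.
  by rewrite ltr_pM.
have hJ : (16 * N < 2 ^ (up_log 4 (16 * N)).*2.+1)%N.
  apply: leq_ltn_trans (up_logP _ (isT : (1 < 4)%N)) _.
  by rewrite -mul2n (_ : 4 = 2 ^ 2)%N // -expnM ltn_exp2l.
apply: le_trans (_ : s.+1%:R * (up_log 4 (16 * N)).*2.+1%:R * lam <= _).
  apply: le_trans (mangoldt_nonprime_sum R hs hJ).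
  apply: ler_sum => n _; rewrite ler_wpM2l // -[leRHS]mul1r ler_wpM2r ?mangoldt_ge0 //.
  by case: in_range.
have -> : 35 * lam ^+ 2 * r = (5 * r) * (7 * lam) * lam by ring.
rewrite ler_wpM2r ?(le_trans _ l1) // ler_pM //.
  by rewrite -natr1; move: r1 s1; clear; lra.
rewrite -natr1 -mul2n natrM; have := up_log4_le R N0; rewrite -/lam.
by move: l1; clear; lra.
Qed.

Lemma near_final_facts (R : realType) (gamma delta sigma eta eps : R) :
  0 < gamma < 1 -> 0 < delta -> 0 < eta -> 0 < eps -> eta <= delta / 16 ->
  sigma = 1 - gamma + delta -> 14 * sigma + 15 * delta = 1 ->
  \forall N \near \oo, let x : R := N%:R in
   [/\ 1 <= x, 48 / gamma * 17 `^ (1 - gamma) * x `^ (1 - gamma) <= x `^ (1 - gamma + eta),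
       24 * x `^ delta <= x `^ (delta + eta),
       ln (16 * N)%:R <= x `^ (eta / 16) &
   [/\ 35 * x `^ (2^-1 + eta / 8) <= x `^ (1 - sigma - eta / 2),
      18 * (24 / gamma * 17 `^ (1 - gamma) * 12 * 167) * x `^ (1 - eta / 2) <= x `^ 1 &
      16 `^ delta * x `^ 0 <= x `^ eps]].
Proof.
move=> /andP[g0 g1] d0 e0 ep he sE e1.
near=> N; split; first by near: N; exact: nbhs_infty_ger.
- by near: N; apply: near_powR_absorb; lra.
- by near: N; apply: near_powR_absorb; lra.
- by near: N; apply: near_ln_absorb; lra.
split.
- by near: N; apply: near_powR_absorb; lra.
- by near: N; apply: near_powR_absorb; lra.
- by near: N; apply: near_powR_absorb; lra.
Unshelve. all: by end_near.
Qed.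

Lemma exists_large_prime (R : realType) (gamma alpha beta eps : R) :
  13 / 14 < gamma < 1 -> irrational alpha -> 0 < eps -> forall n0 : nat,
  exists p : nat, [/\ (n0 < p)%N, prime p,
    exists2 n : nat, (0 < n)%N & Num.floor (n%:R `^ (1 / gamma) : R) = p%:Z
    & dist_int (alpha * p%:R ^+ 2 + beta) < p%:R `^ ((13 - 14 * gamma) / 29 + eps)].
Proof.
move=> hg halpha ep n0; have /andP[g1 g2] := hg.
have small := mangoldt_sum_small hg (irrational_double halpha).
have g0 : 0 < gamma by lra.
have g01 : 0 < gamma < 1 by rewrite g0.
move: small; set delta := (14 * gamma - 13) / 29; set sigma := 1 - gamma + delta.
set eta := delta / 16 => small.
have d0 : 0 < delta by rewrite /delta; lra.
have dE : (13 - 14 * gamma) / 29 = - delta by rewrite /delta; field.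
have e0 : 0 < eta by rewrite /eta; lra.
have e1 : 14 * sigma + 15 * delta = 1 by rewrite /sigma /delta; field.
have := near_final_facts g01 d0 e0 ep (lexx _) (erefl sigma) e1.
have sE : sigma = 1 - gamma + delta by [].
clearbody eta sigma delta => -[N1 _ facts].
have [N hN bound] := small (maxn n0 N1).
have {facts small} := facts N (leq_trans (leq_maxr _ _) hN).
set x : R := N%:R => -[x1 f1 f2 f3 [f4 f5 f6]].
have xp : 0 < x by exact: lt_le_trans x1.
have Npos : (0 < N)%N by rewrite -(ltr0n R).
have x17 : 0 < 17 * x by rewrite mulr_gt0 ?ltr0n.
(* p + 1 <= 16 N + 1 <= 17 N gives 2 eta1 <= gamma (p + 1)^(gamma - 1), as [piatetski_shapiro_near]
   requires. *)
pose eta1 := gamma / 2 * (17 * x) `^ (gamma - 1); pose eta2 := x `^ (- delta).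
have eta1_gt0 : 0 < eta1 by rewrite /eta1 !mulr_gt0 ?invr_gt0 ?powR_gt0.
have eta2_gt0 : 0 < eta2 by exact: powR_gt0.
have p17 : (17 * x) `^ (gamma - 1) <= 1.
  by rewrite powR_le1 ?subr_le0 ?(ltW g2) //; move: x1; clear; lra.
have eta1_le1 : eta1 <= 1.
  rewrite /eta1 -[leRHS]mulr1 ler_pM ?powR_ge0 ?divr_ge0 ?(ltW g0) //.
  by move: g2; clear; lra.
have eta2_le1 : eta2 <= 1.
  by rewrite powR_le1 // oppr_le0 ltW.
have inv1 (e : R) : 0 < e -> e <= 1 -> 1 <= 6 / e.
  by move=> e00 e11; rewrite ler_pdivlMr //; move: e11; clear; lra.
(* [detect] wants J * eta >= 6; J <= 12 / eta keeps the frequencies, at most 2 J, within reach of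
   [bound]. *)
have [J1 /andP[J1l J1u]] := exists_between_double (inv1 _ eta1_gt0 eta1_le1).
have [J2 /andP[J2l J2u]] := exists_between_double (inv1 _ eta2_gt0 eta2_le1).
have eta1V : eta1^-1 = 2 / gamma * 17 `^ (1 - gamma) * x `^ (1 - gamma).
  rewrite -[RHS]mulrA -powRM ?(ltW xp) // /eta1 invfM invf_div -powRN; congr (_ * powR _ _).
  by ring.
have eta2V : eta2^-1 = x `^ delta by rewrite /eta2 -powRN opprK.
set B := x `^ (1 - sigma - eta / 2) in bound f4.
have B0 : 0 <= B by exact: powR_ge0.
have ZB : \sum_(1 <= n < (16 * N).+1) (~~ prime n)%:R * ((in_range N n)%:R * mangoldt R n) <= B.
  apply: le_trans (nonprime_part_le R Npos) _; apply: le_trans f4.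
  rewrite -mulrA ler_wpM2l ?ler0n // [x `^ (_ + _)](_ : _ = x `^ (eta / 16) ^+ 2 * x `^ 2^-1).
    rewrite ler_wpM2r ?powR_ge0 // ler_pXn2r ?nnegrE ?powR_ge0 // ?(le_trans _ (ln_16_ge1 R Npos)) //.
  by rewrite powRX powR_add //; congr powR; field.
have J1u' : J1%:R <= 12 / eta1 by move: J1u; clear; lra.
have J2u' : J2%:R <= 12 / eta2 by move: J2u; clear; lra.
have hB (h k : int) : (h != 0) || (k != 0) -> (`|h| <= J1.*2)%N -> (`|k| <= J2.*2)%N ->
    `|\sum_(1 <= n < (16 * N).+1) (in_range N n)%:R * mangoldt R n *
       ec (h%:~R * (n%:R `^ gamma + eta1) + k%:~R * (alpha * n%:R ^+ 2 + beta))| <= B.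
  move=> hk hJ kJ.
  have -> : \sum_(1 <= n < (16 * N).+1) (in_range N n)%:R * mangoldt R n *
       ec (h%:~R * (n%:R `^ gamma + eta1) + k%:~R * (alpha * n%:R ^+ 2 + beta)) =
     mangoldt_sum gamma h%:~R (k%:~R * alpha) (h%:~R * eta1 + k%:~R * beta) N.
    apply: eq_bigr => n _; rewrite /phase -mulrA; congr (_ * (_ * ec _)); ring.
  apply: bound => //.
    rewrite -intr_norm -natr_absz -/x; apply: le_trans f1.
    apply: le_trans (_ : J1.*2%:R <= _); first by rewrite ler_nat.
    rewrite -mul2n natrM; apply: le_trans (_ : 2 * (12 / eta1) <= _); first by rewrite ler_wpM2l.
    by rewrite eta1V; apply: le_of_eq; field; rewrite gt_eqF.
  rewrite -intr_norm -natr_absz -/x; apply: le_trans f2.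
  apply: le_trans (_ : J2.*2%:R <= _); first by rewrite ler_nat.
  rewrite -mul2n natrM; apply: le_trans (_ : 2 * (12 / eta2) <= _); first by rewrite ler_wpM2l.
  by rewrite eta2V; apply: le_of_eq; ring.
have W0 n : 0 <= (in_range N n)%:R * mangoldt R n by rewrite mulr_ge0 // mangoldt_ge0.
have J1g : (0 < J1)%N by rewrite -(ltr0n R); apply: lt_le_trans J1l; rewrite divr_gt0.
have J2g : (0 < J2)%N by rewrite -(ltr0n R); apply: lt_le_trans J2l; rewrite divr_gt0.
have h6a : 6 <= J1%:R * eta1 by rewrite -ler_pdivrMr.
have h6b : 6 <= J2%:R * eta2 by rewrite -ler_pdivrMr.
(* J1 J2 is of order x^sigma and B = x^(1 - sigma - eta / 2), so the left side is at most x, against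
   a mass of at least 2 x. *)
have hbig : 18 * (J1%:R * J2%:R * (86 * B + 81 * B)) <
    \sum_(1 <= n < (16 * N).+1) (in_range N n)%:R * mangoldt R n.
  apply: lt_le_trans (chebyshev_interval R Npos); rewrite -/x.
  apply: le_lt_trans (_ : x < _); last by move: xp; clear; lra.
  have -> : 86 * B + 81 * B = 167 * B by ring.
  apply: le_trans (_ : 18 * ((12 / eta1) * (12 / eta2) * (167 * B)) <= _).
    by rewrite ler_wpM2l ?ler0n // ler_wpM2r ?mulr_ge0 ?ler0n // ler_pM.
  rewrite -[leRHS](powRr1 (ltW xp)); apply: le_trans f5; apply: le_of_eq.
  rewrite eta1V eta2V.
  have -> : x `^ (1 - eta / 2) = x `^ (1 - gamma) * (x `^ delta * B).
    by rewrite /B !powR_add //; congr powR; rewrite sE; ring.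
  by field; rewrite gt_eqF.
have [n [/andP[n1 nX] pn Wn xn yn]] := detect J1g J2g B0 W0 hB eta1_gt0 eta2_gt0 h6a h6b ZB hbig.
have /andP[nN n16] : in_range N n.
  by apply: contraNT Wn => /negbTE ->; rewrite [_ * _]mul0r eqxx.
exists n; split=> //.
- by apply: leq_ltn_trans nN; apply: leq_trans hN; exact: leq_maxl.
- apply: (@piatetski_shapiro_near R gamma n eta1) => //.
  have -> : 2 * eta1 = gamma * (17 * x) `^ (gamma - 1) by rewrite /eta1; field.
  rewrite ler_wpM2l ?(ltW g0) // powR_antitone ?ltr0n // ?subr_le0 ?(ltW g2) //.
  rewrite /x -natrM ler_nat; move: n16 Npos; clear; lia.
- apply: le_lt_trans (dist_int_le_nd _) _; apply: lt_le_trans yn _.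
  have np : 0 < n%:R :> R by rewrite ltr0n.
  rewrite dE -powR_add //.
  (* The detected distance is below N^(-delta), while n may be as large as 16 N; the lost factor
     16^delta is paid by N^eps <= n^eps. *)
  apply: le_trans (_ : (16 * x) `^ (- delta) * x `^ eps <= _).
    rewrite powRM ?(ltW xp) // mulrAC -[leLHS]mul1r ler_wpM2r ?powR_ge0 //.
    rewrite powRN ler_pdivlMl ?powR_gt0 // mulr1; apply: le_trans f6.
    by rewrite powRr0 mulr1.
  rewrite ler_pM ?powR_ge0 //.
    by rewrite powR_antitone ?oppr_le0 ?(ltW d0) // /x -natrM ler_nat.
  by rewrite ge0_ler_powR ?nnegrE ?(ltW ep) // ?(ltW xp) // ler_nat ltnW.
Qed.

Theorem theorem1 (R : realType) (gamma alpha beta eps : R)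
    (hgamma : 13 / 14 < gamma < 1)
    (halpha : irrational alpha)
    (heps : 0 < eps) :
  infinite_set [set p : nat |
    [/\ prime p,
        exists2 n : nat, (0 < n)%N &
          Num.floor (n%:R `^ (1 / gamma)) = p%:Z
      & dist_int (alpha * p%:R ^+ 2 + beta)
          < p%:R `^ ((13 - 14 * gamma) / 29 + eps)]].
Proof.
move=> /finite_seqP[s hs].
have [p [ps pp pf pd]] := exists_large_prime beta hgamma halpha heps (\max_(q <- s) q).
have : [set` s] p by rewrite -hs.
by move=> /= h; have := leq_bigmax_seq (P := xpredT) (F := id) _ h isT; rewrite leqNgt ps.
Qed.
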